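(* Let $(\xi_l)_{l\ge0}$ be a subordinator with Laplace–Bernstein exponent $\Phi\not\equiv0$, let $\mathcal I=\int_0^\infty e^{-\xi_l}\mathrm dl$ and let $\kappa$ be the measure on $\mathbb R_+$ whose Laplace transform is $\Phi'/\Phi$. Then $\mathcal I$ is multiplicatively infinitely divisible if and only if $\kappa(\mathrm dx)\le\mathrm dx$ (as measures on $\mathbb R_+$). Moreover, if $\mathcal I$ is multiplicatively infinitely divisible, then the Lévy measure of the infinitely divisible variable $\log\mathcal I$ is \[ 1_{(-\infty,0)}(x)\,x^{-1}\,(1-e^{-x})^{-1}\,\bigl(1-k(-x)\bigr)\,\mathrm dx, \] where $k$ denotes the density $\kappa(\mathrm dx)/\mathrm dx$.
   Context: $\Phi$ is defined by $\mathbb E[e^{-s\xi_l}]=e^{-l\Phi(s)}$; $\kappa$ is the measure on $[0,\infty)$ with $\int e^{-sx}\kappa(\mathrm dx)=\Phi'(s)/\Phi(s)$ for $s>0$. A positive random variable $X$ is multiplicatively infinitely divisible if for every integer $n\ge2$ there exist i.i.d. positive random variables $X_1,\dots,X_n$ with $X\overset{\mathrm{law}}{=}X_1\cdots X_n$ (equivalently, for $X>0$, $\log X$ is infinitely divisible). *)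

(* Defs.v *)
From HB Require Import structures.
From mathcomp Require Import all_boot all_order all_algebra.
From mathcomp Require Import all_classical all_reals all_analysis.
From mathcomp Require Import measurable_realfun.
Set Implicit Arguments. Unset Strict Implicit. Unset Printing Implicit Defensive.
Import Order.TTheory GRing.Theory Num.Theory.
Import numFieldNormedType.Exports.
Local Open Scope classical_set_scope.
Local Open Scope ring_scope.

(* Mutual independence of a finite family of real random variables:
   product rule for all Borel sets (taking B i = setT gives subfamilies). *)
Definition indep_RVs {R : realType} {d : measure_display} {Omega : measurableType d}
  (P : probability Omega R) (n : nat) (X : 'I_n -> Omega -> R) : Prop :=
  forall B : 'I_n -> set R, (forall i, measurable (B i)) ->
    P (\bigcap_(i in [set: 'I_n]) (X i @^-1` B i)) =
    (\prod_(i < n) P (X i @^-1` B i))%E.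

Section Defs.
Context {R : realType} {d : measure_display} {Omega : measurableType d}.
Variable P : probability Omega R.

Definition subordinator (X : R -> Omega -> R) : Prop :=
  [/\ (forall w, X 0 w = 0) /\
      (forall t, measurable_fun setT (X t)),
      (forall w s t, 0 <= s -> s <= t -> X s w <= X t w),
      (forall w t, 0 <= t -> (X s w @[s --> at_right t] --> X t w)),
      (forall (n : nat) (t : nat -> R), 0 <= t 0%N -> (forall i, t i <= t i.+1) ->
        indep_RVs P (fun (i : 'I_n) w => X (t i.+1) w - X (t i) w))
    & (forall s t (B : set R), 0 <= s -> 0 <= t -> measurable B ->
        P ((fun w => X (t + s) w - X t w) @^-1` B) = P (X s @^-1` B))].

(* Killing at an independent exponential time zeta of rate q >= 0
   (q = 0 : no killing, zeta = +oo a.s.). *)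
Definition killing_time (X : R -> Omega -> R) (zeta : Omega -> \bar R) (q : R) : Prop :=
  [/\ 0 <= q,
      measurable_fun setT zeta,
      (forall t, 0 <= t -> P [set w | (t%:E < zeta w)%E] = (expR (- (q * t)))%:E)
    & forall (n : nat) (t : 'I_n -> R) (B : 'I_n -> set R) (C : set (\bar R)),
        (forall i, 0 <= t i) -> measurable C -> (forall i, measurable (B i)) ->
        P (zeta @^-1` C `&` \bigcap_(i in [set: 'I_n]) (X (t i) @^-1` B i)) =
        (P (zeta @^-1` C) * P (\bigcap_(i in [set: 'I_n]) (X (t i) @^-1` B i)))%E].

Definition killed (X : R -> Omega -> R) (zeta : Omega -> \bar R) : R -> Omega -> \bar R :=
  fun t w => if (t%:E < zeta w)%E then (X t w)%:E else +oo%E.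

Definition expfun (xi : R -> Omega -> \bar R) : Omega -> \bar R :=
  fun w => (\int[lebesgue_measure]_(l in `[0%R, +oo[) expeR (- xi l w))%E.

Definition mult_inf_div (Y : Omega -> \bar R) : Prop :=
  P [set w | (0 < Y w < +oo)%E] = 1%E /\
  forall n : nat, (2 <= n)%N ->
    exists (d' : measure_display) (Omega' : measurableType d')
           (P' : probability Omega' R) (Z : 'I_n -> Omega' -> R),
      [/\ (forall i, measurable_fun setT (Z i)),
          (forall i w, 0 < Z i w),
          indep_RVs P' Z,
          (forall i j (B : set R), measurable B -> P' (Z i @^-1` B) = P' (Z j @^-1` B))
        & forall B : set (\bar R), measurable B ->
            P' ((fun w => (\prod_(i < n) Z i w)%:E) @^-1` B) = P (Y @^-1` B)].

(* Levy-Khintchine triplet (b, s2, nu) of a real random variable Y,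
   truncation function 1_{|x|<1}; written with real and imaginary parts:
   E[e^{iuY}] = exp(i b u - s2 u^2/2 + int (e^{iux} - 1 - iux 1_{|x|<1}) nu(dx)). *)
Definition levy_khintchine (Y : Omega -> R) (b s2 : R)
    (nu : {measure set (measurableTypeR R) -> \bar R}) : Prop :=
  [/\ 0 <= s2, nu [set 0] = 0%E,
      (\int[nu]_x (Num.min 1 (x ^+ 2))%:E < +oo)%E
    & forall u : R,
      let A := - (s2 * u ^+ 2) / 2 + fine (\int[nu]_x (cos (u * x) - 1)%:E)%E in
      let B := b * u + fine (\int[nu]_x
                 (sin (u * x) - u * x * (if `|x| < 1 then 1 else 0))%:E)%E in
      (\int[P]_w (cos (u * Y w))%:E = (expR A * cos B)%:E)%E /\
      (\int[P]_w (sin (u * Y w))%:E = (expR A * sin B)%:E)%E].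

End Defs.

(* Main.v *)
(** The moments of I are M m = E[I^m] = prod_(1 <= j <= m) j / Phi(j): those of Riemann sums along
    dyadic grids obey an exact recursion, by stationarity and independence of the increments, and
    pass to the limit. Since Phi(j) >= Phi(1), M m <= C^m m!, so these moments determine the law.

    As (ln Phi)' and 1/s are the Laplace transforms of kappa and of dx, the second differences of
    ln M are the integrals of e^(-mx) h(x) against dx - kappa(dx), with h(x) = (e^(-x) - e^(-2x))/x.

    If I is a product of n i.i.d. copies of Z_n, then E[Z_n^m] = (M m)^(1/n) and
    n E[p(Z_n)^2 (1 - Z_n)^2] >= 0 tends to the integral of p(e^(-x))^2 h(x) against dx - kappa(dx).
    Choosing Bernstein polynomials p such that p(e^(-x))^2 h(x) tends to the indicator of an interval
    gives kappa <= dx.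

    Conversely let kappa(dx) = k(x) dx with 0 <= k <= 1. For 0 <= c <= 1, the infinitely divisible law
    on (-oo, 0) with Levy density c (1 - k(x)) / (x (e^x - 1)) at -x, suitably translated, is the law
    of some ln Q with E[Q^m] = (M m)^c. It is obtained by Helly selection from sums of i.i.d.
    variables, with convergence of moments and of characteristic functions. The case c = 1/n yields
    the n-th roots of I, and c = 1 the Levy-Khintchine representation of ln I. *)
Require Import Defs.
From HB Require Import structures.
From mathcomp Require Import all_boot all_order all_algebra.
From mathcomp Require Import all_classical all_reals all_analysis.
From mathcomp Require Import measurable_realfun finmap ring lra.
Set Implicit Arguments. Unset Strict Implicit. Unset Printing Implicit Defensive.
Import Order.TTheory GRing.Theory Num.Theory.
Import numFieldNormedType.Exports.
Local Open Scope classical_set_scope.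
Local Open Scope ring_scope.
From mathcomp Require Import complex.

(** * Densities and Bernstein polynomials *)

(** The roots Z_n take values in all of ]0, oo[, where a polynomial that is nonnegative on [0, 1]
    may be negative. Hence only squares are tested, and the function to approximate is the square
    root of 1/h on an interval. Bernstein polynomials suit this: they inherit the bound of the
    function and converge at each of its continuity points, so a function that jumps at both ends of
    the interval can be used directly.

    In the converse direction the Levy density may behave like x^-2 at 0, so that its mass and its
    first moment diverge there. Small jumps are cut off, and the compensator m (1 - e^-x) is chosen
    because the compensated exponent then vanishes for m = 0 and m = 1: second differences and the
    first moment determine the rest.

    The logarithm of a limit Q requires Q > 0, which convergence does not show. It is read off from
    the law of I, once the moments have identified the two laws. Helly selection is applied to
    quantile functions, so that all limits are almost everywhere on one probability space, where
    Fatou's lemma and bounded convergence apply. *)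

Section nonneg_induction.
Local Open Scope ereal_scope.
Context d (T : measurableType d) (R : realType).
Variable P : (T -> \bar R) -> Prop.
Hypothesis P_indic : forall A, measurable A -> P (fun x => (\1_A x)%:E).
Hypothesis P_scale : forall c f, (0 <= c)%R -> measurable_fun setT f ->
  (forall x, 0 <= f x) -> P f -> P (fun x => c%:E * f x).
Hypothesis P_add : forall f g, measurable_fun setT f -> measurable_fun setT g ->
  (forall x, 0 <= f x) -> (forall x, 0 <= g x) -> P f -> P g ->
  P (fun x => f x + g x).
Hypothesis P_lim : forall (f_ : nat -> T -> \bar R) f,
  (forall n, measurable_fun setT (f_ n)) -> (forall n x, 0 <= f_ n x) ->
  (forall x, nondecreasing_seq (f_ ^~ x)) ->
  (forall x, f_ ^~ x @ \oo --> f x) ->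
  (forall n, P (f_ n)) -> P f.

Import HBNNSimple.

(** The standard machine: the simple approximations of [f] are finite combinations of indicators
    with nonnegative coefficients, and they increase to [f]. *)
Lemma nonneg_measurable_ind f : measurable_fun setT f -> (forall x, 0 <= f x) ->
  P f.
Proof.
move=> mf f0.
pose f_ := nnsfun_approx measurableT mf.
apply: (P_lim (f_ := fun n x => (f_ n x)%:E)).
- by move=> n; exact/measurable_EFinP.
- by move=> n x; rewrite lee_fin.
- by move=> x a b ab; rewrite lee_fin; exact/lefP/nd_nnsfun_approx.
- by move=> x; apply: cvg_nnsfun_approx => //.
move=> n.
have -> : (fun x => (f_ n x)%:E) = (fun x => \sum_(y <- fset_set (range (f_ n)))
    (y%:E * (\1_(f_ n @^-1` [set y]) x)%:E)).
  apply/funext => x; rewrite (fimfunE (f_ n)) fsbig_finite //= -sumEFin.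
  by apply: eq_bigr => y _; rewrite EFinM.
have : forall y, y \in (fset_set (range (f_ n)) : seq R) -> (0 <= y)%R.
  move=> y; rewrite -[y \in _]/(y \in fset_set _) in_fset_set //= => /set_mem[x _ <-]; exact: fun_ge0.
have mi (A : set T) : measurable A -> measurable_fun setT (fun x => (\1_A x)%:E : \bar R).
  by move=> mA; apply/measurable_EFinP.
have mpre y : measurable (f_ n @^-1` [set y]) by exact: measurable_funPTI.
(* Forgetting that the list enumerates the range leaves a plain list induction; the empty sum is the
   indicator of the empty set. *)
move: (finmap.enum_fset _) => s; elim: s => [_|y s IH ys].
  have -> : (fun x => \sum_(y <- [::]) (y%:E * (\1_(f_ n @^-1` [set y]) x)%:E)) =
    (fun x => (\1_(@set0 T) x)%:E : \bar R).
    by apply/funext => x; rewrite big_nil indic0.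
  exact: P_indic.
under eq_fun do rewrite big_cons.
have y0 : (0 <= y)%R by apply: ys; rewrite mem_head.
have s0 z : z \in s -> (0 <= z)%R by move=> zs; apply: ys; rewrite in_cons zs orbT.
apply: P_add.
- by apply: emeasurable_funM => //; exact: mi.
- by apply: emeasurable_sum => z; apply: emeasurable_funM => //; exact: mi.
- by move=> x; rewrite mule_ge0 // lee_fin.
- move=> x; rewrite big_seq; apply: sume_ge0 => z /s0 z0.
  by rewrite mule_ge0 // lee_fin.
- by apply: P_scale => //; [exact: mi|exact: P_indic].
- by apply: IH => z; exact: s0.
Qed.
End nonneg_induction.

Section density_measure.
Local Open Scope ereal_scope.
Context d (T : measurableType d) (R : realType).
Variables (mu : {measure set T -> \bar R}) (f : T -> R).
Hypotheses (mf : measurable_fun setT f) (f0 : forall x, (0 <= f x)%R).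

(** The two proofs are phantom arguments: carried by the term, they let the measure structure be
    attached to it. *)
Definition density of measurable_fun setT f & (forall x, (0 <= f x)%R) :=
  fun A => \int[mu]_(x in A) (f x)%:E.

Local Notation nu := (density mf f0).

Let mfE : measurable_fun setT (fun x => (f x)%:E). Proof. exact/measurable_EFinP. Qed.

Let density0 : nu set0 = 0. Proof. exact: integral_set0. Qed.

Let density_ge0 A : 0 <= nu A.
Proof. by apply: integral_ge0 => x _; rewrite lee_fin. Qed.

Let density_sigma_additive : semi_sigma_additive nu.
Proof.
move=> F mF tF mUF; rewrite /density ge0_integral_bigcup //.
- by apply: is_cvg_ereal_nneg_natsum_cond => n _ _; exact: density_ge0.
- exact: measurable_funTS.
- by move=> x _; rewrite lee_fin.
Qed.

HB.instance Definition _ := isMeasure.Build _ _ _ nu density0 density_ge0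
  density_sigma_additive.

Lemma integral_density g : measurable_fun setT g -> (forall x, 0 <= g x) ->
  \int[nu]_x g x = \int[mu]_x ((f x)%:E * g x).
Proof.
have fE0 x : 0 <= (f x)%:E by rewrite lee_fin.
apply: (nonneg_measurable_ind
  (P := fun g => \int[nu]_x g x = \int[mu]_x ((f x)%:E * g x))).
- move=> A mA; rewrite integral_indic // setIT.
  rewrite -[LHS]/(\int[mu]_(x in A) (f x)%:E) integral_mkcond.
  by apply: eq_integral => x _; rewrite epatch_indic.
- move=> c h c0 mh h0 IH; rewrite ge0_integralZl_EFin // IH.
  rewrite -ge0_integralZl_EFin //; last 2 first.
  + by move=> x _; exact: mule_ge0.
  + exact: emeasurable_funM.
  by apply: eq_integral => x _; rewrite muleCA.
- move=> h k mh mk h0 k0 IH IK; rewrite ge0_integralD // IH IK.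
  rewrite -ge0_integralD //; first by apply: eq_integral => x _; rewrite ge0_muleDr.
  + by move=> x _; exact: mule_ge0.
  + exact: emeasurable_funM.
  + by move=> x _; exact: mule_ge0.
  + exact: emeasurable_funM.
- move=> h_ h mh h0 ndh hh IH.
  have -> : \int[nu]_x h x = limn (fun n => \int[nu]_x h_ n x).
    rewrite -monotone_convergence //.
    by apply: eq_integral => x _; apply/esym/cvg_lim => //; exact: hh.
  have -> : \int[mu]_x ((f x)%:E * h x) = limn (fun n => \int[mu]_x ((f x)%:E * h_ n x)).
    rewrite -monotone_convergence //.
    + by apply: eq_integral => x _; apply/esym/cvg_lim => //; exact: cvgeZl.
    + by move=> n; exact: emeasurable_funM.
    + by move=> n x _; exact: mule_ge0.
    + by move=> x _ a b ab; apply: lee_pmul => //; exact: ndh.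
  by congr (limn _); apply/funext => n; exact: IH.
Qed.
End density_measure.

Section Bernstein.
Context (R : realFieldType).
Implicit Types (phi psi : nat -> R) (z : R).

(** De Casteljau's recursion: the mean of [phi] at a binomial variable, conditioned on the first
    trial. Monotonicity, linearity and the variance become short inductions without binomial
    coefficients. *)
Fixpoint bernstein n phi : {poly R} :=
  if n is m.+1 then
    (1 - 'X) * bernstein m phi + 'X * bernstein m (fun k => phi k.+1)
  else (phi 0%N)%:P.

Lemma bernsteinS n phi z : (bernstein n.+1 phi).[z] =
  (1 - z) * (bernstein n phi).[z] + z * (bernstein n (fun k => phi k.+1)).[z].
Proof. by rewrite /= !hornerE. Qed.

Lemma le_bernstein n phi psi z : 0 <= z <= 1 -> (forall k, phi k <= psi k) ->
  (bernstein n phi).[z] <= (bernstein n psi).[z].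
Proof.
move=> /andP[z0 z1]; elim: n phi psi => [|n IH] phi psi le; first by rewrite !hornerC.
by rewrite !bernsteinS lerD // ler_wpM2l ?subr_ge0 // IH.
Qed.

Lemma bernsteinD n a phi psi z : (bernstein n (fun k => a * phi k + psi k)).[z] =
  a * (bernstein n phi).[z] + (bernstein n psi).[z].
Proof.
elim: n phi psi => [|n IH] phi psi; first by rewrite !hornerC.
by rewrite !bernsteinS !IH; ring.
Qed.

Lemma bernstein_cst n c z : (bernstein n (fun=> c)).[z] = c.
Proof. by elim: n => [|n IH]; rewrite ?hornerC// bernsteinS !IH; ring. Qed.

(** Variance plus squared bias, about [a], of a binomial variable with parameters [n] and [z]. *)
Lemma bernstein_sqr n a z : (bernstein n (fun k => (k%:R - a) ^+ 2)).[z] =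
  n%:R * z * (1 - z) + (n%:R * z - a) ^+ 2.
Proof.
elim: n a => [|n IH] a; first by rewrite hornerC; ring.
rewrite bernsteinS IH.
have -> : (fun k => (k.+1%:R - a) ^+ 2) = (fun k => (k%:R - (a - 1)) ^+ 2) :> (nat -> R).
  by apply/funext => k; rewrite -natr1; congr (_ ^+ 2); ring.
by rewrite IH -natr1; ring.
Qed.

Lemma bernstein_bounded n phi M z : 0 <= z <= 1 -> (forall k, `|phi k| <= M) ->
  `|(bernstein n phi).[z]| <= M.
Proof.
move=> z01 phiM; rewrite ler_norml -{1}(bernstein_cst n (- M) z).
rewrite -{2}(bernstein_cst n M z).
by rewrite !le_bernstein // => k; have := phiM k; rewrite ler_norml => /andP[].
Qed.
End Bernstein.

(** Chebyshev's argument: near [z] continuity gives [e / 2], and away from [z] the bound [2 * M] is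
    absorbed by [C * (x - z) ^+ 2], whose binomial mean is of order [1 / n]. Only continuity at the
    point [z] enters, so [phi] may jump elsewhere. *)
Lemma bernstein_cvg (R : realType) (phi : R -> R) (M z : R) :
  0 <= z <= 1 -> (forall x, `|phi x| <= M) -> phi x @[x --> z] --> phi z ->
  (bernstein n.+1 (fun k => phi (k%:R / n.+1%:R))).[z] @[n --> \oo] --> phi z.
Proof.
move=> z01 phiM cphi; apply/cvgrPdist_le => e e0.
have e20 : 0 < e / 2 by lra.
have /cvgrPdist_le/(_ _ e20)/nbhs_ballP[del /= del0 ball_del] := cphi.
have M0 : 0 <= M by rewrite (le_trans (normr_ge0 _) (phiM 0)).
pose C := 2 * M / del ^+ 2.
have C0 : 0 <= C by rewrite divr_ge0 ?mulr_ge0 ?exprn_ge0 // ltW.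
have bnd x : `|phi x - phi z| <= C * (x - z) ^+ 2 + e / 2.
  have [xz|xz] := ltP `|x - z| del.
    have : `|phi z - phi x| <= e / 2 by apply: ball_del; rewrite /ball /= distrC.
    by rewrite distrC => h; rewrite (le_trans h) // lerDr mulr_ge0 // sqr_ge0.
  rewrite (le_trans (ler_normB _ _)) // -[leLHS]addr0 lerD // ?(ltW e20) //.
  rewrite (le_trans (lerD (phiM _) (phiM _))) // /C.
  rewrite mulrAC -mulrA -[leLHS]mulr1 -mulr2n -[M *+ 2]mulr_natl ler_wpM2l //.
    by rewrite mulr_ge0.
  rewrite ler_pdivlMr ?exprn_gt0 // mul1r -(real_normK (num_real (x - z))).
  by rewrite lerXn2r // ?nnegrE // ltW.
near=> n.
have hn : (e / 2)^-1 * C <= n.+1%:R.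
  near: n; exists (Num.truncn ((e / 2)^-1 * C)).+1 => // m /= hm.
  by rewrite (le_trans (ltW (truncnS_gt _))) // ler_nat ltnW.
set N := n.+1%:R : R.
have N0 : 0 < N by rewrite ltr0n.
have key : forall k : nat, `|phi (k%:R / N) - phi z| <=
   (C / N ^+ 2) * (k%:R - N * z) ^+ 2 + e / 2.
  move=> k; apply: (le_trans (bnd _)); rewrite lerD2r.
  by rewrite le_eqVlt; apply/orP; left; apply/eqP; field; rewrite gt_eqF.
have -> : phi z - (bernstein n.+1 (fun k => phi (k%:R / N))).[z] =
  - (bernstein n.+1 (fun k => 1 * phi (k%:R / N) + (- phi z))).[z].
  by rewrite bernsteinD bernstein_cst; ring.
rewrite normrN ler_norml.
have ub : (bernstein n.+1 (fun k => (C / N ^+ 2) * (k%:R - N * z) ^+ 2 + e / 2)).[z] <= e.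
  rewrite bernsteinD bernstein_cst bernstein_sqr subrr expr0n /= ?addr0.
  have -> : C / N ^+ 2 * (n.+1%:R * z * (1 - z)) = C * (z * (1 - z)) / N.
    by rewrite -/N; field; rewrite gt_eqF.
  have : C * (z * (1 - z)) / N <= e / 2; last by move: (C * _ / N) => t ?; lra.
  rewrite ler_pdivrMr //.
  have : C * (z * (1 - z)) <= C.
    by move: z01 => /andP[z0 z1]; rewrite ler_piMr // mulr_ile1 ?subr_ge0 // lerBlDr lerDl.
  move=> h; apply: (le_trans h).
  by rewrite -ler_pdivrMl.
apply/andP; split; last first.
  apply: le_trans ub; apply: le_bernstein => // k.
  by rewrite mul1r (le_trans _ (key k)) // ler_norm.
rewrite lerNl; apply: le_trans ub; rewrite -[X in X <= _]mulN1r.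
rewrite -[X in X <= _]addr0 -[X in _ + X](bernstein_cst n.+1 0 z) -bernsteinD.
apply: le_bernstein => // k.
by rewrite (le_trans _ (key k)) // addr0 mulN1r mul1r -normrN ler_norm.
Unshelve. all: by end_near. Qed.

Section bounded.
Local Open Scope ereal_scope.
Context d (T : measurableType d) (R : realType) (P : probability T R).

Lemma bounded_integrable (f : T -> R) (M : R) :
  measurable_fun setT f -> (forall x, (`|f x| <= M)%R) ->
  P.-integrable setT (EFin \o f).
Proof.
move=> mf fM; apply: measurable_bounded_integrable => //.
  by rewrite ltey_eq fin_num_measure.
exists M; split; first by rewrite num_real.
by move=> x Mx y _; exact: le_trans (fM y) (ltW Mx).
Qed.

Lemma bounded_convergence (f_ : nat -> T -> R) (f : T -> R) (M : R) :
  (forall n, measurable_fun setT (f_ n)) -> measurable_fun setT f ->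
  (forall n x, (`|f_ n x| <= M)%R) ->
  {ae P, forall x, f_ ^~ x @ \oo --> f x} ->
  \int[P]_x (f_ n x)%:E @[n --> \oo] --> \int[P]_x (f x)%:E.
Proof.
move=> mf_ mf fM cf.
have [] := @dominated_convergence _ _ _ P setT measurableT
  (fun n x => (f_ n x)%:E) (fun x => (f x)%:E) (fun=> M%:E).
- by move=> n; exact/measurable_EFinP.
- exact/measurable_EFinP.
- by apply: filterS cf => x cx _; apply/fine_cvgP; split => //; exact: nearW.
- exact: finite_measure_integrable_cst.
- by apply: aeW => x n _; rewrite lee_fin.
by [].
Qed.
End bounded.

(** * Laws determined by their moments *)

Section same_law.
Context (R : realType) d1 (T1 : measurableType d1) (P1 : probability T1 R)
  d2 (T2 : measurableType d2) (P2 : probability T2 R).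
Variables (V1 : T1 -> R) (V2 : T2 -> R).
Hypotheses (mV1 : measurable_fun setT V1) (mV2 : measurable_fun setT V2).

Lemma same_cdf_same_law :
  (forall x, P1 [set w | V1 w <= x] = P2 [set w | V2 w <= x]) ->
  forall B : set R, measurable B -> P1 (V1 @^-1` B) = P2 (V2 @^-1` B).
Proof.
move=> cdfE B mB.
pose V1' : {mfun T1 >-> R} := mfun_Sub (mem_set mV1).
pose V2' : {mfun T2 >-> R} := mfun_Sub (mem_set mV2).
have fl d (T : measurableType d) (P : probability T R) (V : T -> R)
    (mV : measurable_fun setT V) (A : set R) : measurable A -> (P (V @^-1` A) < +oo)%E.
  move=> mA; apply: le_lt_trans (probability_le1 P _) (ltry 1).
  by rewrite -[X in measurable X]setTI; exact: mV.
have -> : P1 (V1 @^-1` B) = pushforward P1 V1' B by [].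
have -> : P2 (V2 @^-1` B) = pushforward P2 V2' B by [].
apply: (measure_unique (@ocitv R) (fun k => `](- k%:R), k%:R]%classic)) => //.
- exact: ocitvI.
- by move=> k; exact: is_ocitv.
- rewrite -subTset => x _ /=.
  exists (Num.bound `|x|) => //=; rewrite in_itv /=.
  by have := archi_boundP (normr_ge0 x); rewrite ltr_norml => /andP[-> /ltW].
- move=> A [[a b] _ <-] /=.
  have [ab|ba] := leP a b; last first.
    by rewrite set_itv_ge ?measure0// bnd_simp -leNgt ltW.
  have : `]a, b]%classic = `]-oo, b] `\` `]-oo, a] => [|->].
    by rewrite -[RHS]setCK setCD setCitvl setUC -[LHS]setCK setCitv.
  have sab : `]-oo, a]%classic `<=` `]-oo, b]%classic by exact: subset_itvl.
  have fin : forall x, P1 (V1 @^-1` `]-oo, x]) = P2 (V2 @^-1` `]-oo, x]).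
    move=> x; have := cdfE x.
    have E d (T : measurableType d) (V : T -> R) :
        V @^-1` `]-oo, x] = [set w | V w <= x].
      by apply/seteqP; split => w /=; rewrite in_itv.
    by rewrite !E.
  rewrite measureD //; last exact: (fl _ _ P1 _ mV1).
  rewrite measureD //; last exact: (fl _ _ P2 _ mV2).
  by rewrite !setIidr //; congr (_ - _)%E; exact: fin.
- by move=> k; exact: (fl _ _ P1 _ mV1).
Qed.

Hypotheses (V1_01 : forall w, 0 <= V1 w <= 1) (V2_01 : forall w, 0 <= V2 w <= 1).
Hypothesis moments : forall n,
  (\int[P1]_w (V1 w ^+ n)%:E = \int[P2]_w (V2 w ^+ n)%:E)%E.

(** Hausdorff's moment problem. Equal moments give equal integrals of polynomials, hence of bounded
    continuous functions through their Bernstein polynomials, hence equal distribution functions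
    through continuous ramps. *)
Lemma same_moments01_same_law B : measurable B ->
  P1 (V1 @^-1` B) = P2 (V2 @^-1` B).
Proof.
have bV1 n w : `|V1 w ^+ n| <= 1.
  have /andP[v0 v1] := V1_01 w; rewrite normrX ger0_norm //.
  by rewrite exprn_ile1.
have bV2 n w : `|V2 w ^+ n| <= 1.
  have /andP[v0 v1] := V2_01 w; rewrite normrX ger0_norm //.
  by rewrite exprn_ile1.
have horner_bnd (p : {poly R}) : exists M, forall x, 0 <= x <= 1 -> `|p.[x]| <= M.
  elim/poly_ind : p => [|p c [M pM]]; first by exists 0 => x _; rewrite horner0 normr0.
  exists (M + `|c|) => x x01; rewrite !hornerE (le_trans (ler_normD _ _)) // lerD2r.
  have /andP[x0 x1] := x01; rewrite normrM (ger0_norm x0) (le_trans _ (pM _ x01)) //.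
  by rewrite ler_piMr.
(* The extra power lets an induction along Horner's scheme [p * 'X + c%:P] shift the factor ['X]
   into [n]. *)
have polyE (p : {poly R}) n :
    (\int[P1]_w (p.[V1 w] * V1 w ^+ n)%:E = \int[P2]_w (p.[V2 w] * V2 w ^+ n)%:E)%E.
  elim/poly_ind : p n => [|p c IH] n.
    by rewrite !integral0_eq // => w _; rewrite horner0 mul0r.
  have [M pM] := horner_bnd p.
  have gen d (T : measurableType d) (P : probability T R) (V : T -> R) :
     measurable_fun setT V -> (forall w, 0 <= V w <= 1) ->
     (\int[P]_w ((p * 'X + c%:P).[V w] * V w ^+ n)%:E =
      \int[P]_w (p.[V w] * V w ^+ n.+1)%:E + c%:E * \int[P]_w (V w ^+ n)%:E)%E.
    move=> mV V01.
    have bV m w : `|V w ^+ m| <= 1.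
      have /andP[v0 v1] := V01 w; rewrite normrX ger0_norm //.
      by rewrite exprn_ile1.
    have mVn m : measurable_fun setT (fun w => V w ^+ m) by exact: measurable_funX.
    have mpV : measurable_fun setT (fun w => p.[V w]).
      by apply: measurableT_comp mV => //; apply: continuous_measurable_fun; exact: continuous_horner.
    rewrite -integralZl //=; last exact: bounded_integrable (bV n).
    rewrite -integralD //=.
    - apply: eq_integral => w _; rewrite -EFinM -EFinD !hornerE exprS.
      by congr EFin; ring.
    - apply: (@bounded_integrable _ _ _ _ _ M); first exact: measurable_funM.
      move=> w; rewrite normrM -[leRHS]mulr1 ler_pM // pM //.
    - apply: (integrableZl measurableT); exact: bounded_integrable (bV n).
  by rewrite !gen // IH moments.
have contE (g : R -> R) (M : R) : continuous g -> (forall x, `|g x| <= M) ->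
    (\int[P1]_w (g (V1 w))%:E = \int[P2]_w (g (V2 w))%:E)%E.
  move=> cg gM.
  pose b n : {poly R} := bernstein n.+1 (fun k => g (k%:R / n.+1%:R)).
  have lim d (T : measurableType d) (P : probability T R) (V : T -> R) :
     measurable_fun setT V -> (forall w, 0 <= V w <= 1) ->
     (\int[P]_w (b n).[V w]%:E @[n --> \oo] --> \int[P]_w (g (V w))%:E)%E.
    move=> mV V01; apply: (@bounded_convergence _ _ _ _ _ _ M).
    - move=> n; apply: measurableT_comp mV => //.
      by apply: continuous_measurable_fun; exact: continuous_horner.
    - by apply: measurableT_comp mV => //; exact: continuous_measurable_fun.
    - by move=> n w; exact: bernstein_bounded.
    - by apply: aeW => w; exact: (bernstein_cvg (V01 w) gM (cg _)).
  apply: cvg_unique (lim _ _ _ _ mV1 V1_01) _ => //.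
  suff -> : (fun n => \int[P1]_w ((b n).[V1 w])%:E)%E =
     (fun n => \int[P2]_w ((b n).[V2 w])%:E)%E by exact: lim.
  apply/funext => n; have := polyE (b n) 0%N.
  under eq_integral do rewrite mulr1.
  by under [RHS]eq_integral do rewrite mulr1.
apply: same_cdf_same_law => x.
(* For [k > 0], a ramp equal to 1 up to [x] and to 0 beyond [x + 1 / k]; it tends to the indicator
   of []-oo, x]]. *)
pose g k z : R := Num.max 0 (Num.min 1 (1 - k%:R * (z - x))).
have cg k : continuous (g k).
  move=> z; have -> : g k = cst 0 \max (cst 1 \min (fun z => 1 - k%:R * (z - x))) by [].
  apply: (@continuous_max R R); first exact: cvg_cst.
  apply: (@continuous_min R R); first exact: cvg_cst.
  apply: cvgB; first exact: cvg_cst.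
  apply: cvgM; first exact: cvg_cst.
  by apply: cvgB; [exact: cvg_id|exact: cvg_cst].
have g01 k z : `|g k z| <= 1.
  by rewrite ger0_norm /g ?le_max ?lexx // ge_max ler01 ge_min lexx.
have lim d (T : measurableType d) (P : probability T R) (V : T -> R) :
   measurable_fun setT V ->
   (\int[P]_w (g k (V w))%:E @[k --> \oo] --> P [set w | (V w <= x)%R])%E.
  move=> mV.
  have mA : measurable [set w | V w <= x].
    rewrite (_ : [set w | V w <= x] = setT `&` V @^-1` `]-oo, x]).
      exact: (mV measurableT _ (measurable_itv `]-oo, x])).
    by rewrite setTI; apply/seteqP; split=> w /=; rewrite in_itv.
  have -> : P [set w | V w <= x] = (\int[P]_w (\1_[set w | V w <= x] w)%:E)%E.
    by rewrite integral_indic // setIT.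
  apply: (@bounded_convergence _ _ _ _ _ _ 1) => //.
  - move=> n; apply: measurableT_comp mV => //.
    by apply: continuous_measurable_fun; exact: cg.
  - apply: aeW => w; rewrite indicE; have [Vx|Vx] := boolP (w \in _).
      apply: cvg_near_cst; apply: nearW => k; rewrite /g.
      move: Vx => /set_mem /= Vx.
      by apply/eqP; rewrite min_l ?max_r // lerBrDr gerDl mulr_ge0_le0 // subr_le0.
    have {}Vx : x < V w by move: Vx; rewrite ltNge; apply: contra => h; apply/mem_set.
    apply: cvg_near_cst; near=> k; rewrite /g; apply/eqP; rewrite max_l //.
    rewrite ge_min; apply/orP; right; rewrite subr_le0.
    rewrite -ler_pdivrMr ?subr_gt0 // mul1r.
    near: k; exists (Num.truncn ((V w - x)^-1)).+1 => // m /= hm.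
    by rewrite (le_trans (ltW (truncnS_gt _))) // ler_nat.
apply: cvg_unique (lim _ _ _ _ mV1) _ => //.
suff -> : (fun k => \int[P1]_w (g k (V1 w))%:E)%E =
   (fun k => \int[P2]_w (g k (V2 w))%:E)%E by exact: lim.
by apply/funext => k; exact: contE (cg k) (g01 k).
Unshelve. all: by end_near. Qed.

End same_law.

(** Up to sign, differentiating the remainder of order [K + 1] yields that of order [K]. By
    induction the bound plus [s] times the remainder, for [s = 1] and [s = -1], is nondecreasing,
    and it vanishes at 0. *)
Lemma expRN_taylor (R : realType) K (x : R) : 0 <= x ->
  `|expR (- x) - \sum_(k < K) (- x) ^+ k / k`!%:R| <= x ^+ K / K`!%:R.
Proof.
elim: K x => [|K IH] x x0.
  rewrite big_ord0 subr0 expr0 fact0 divr1 ger0_norm ?expR_ge0 //.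
  by rewrite -expR0 ler_expR oppr_le0.
pose p m : {poly R} := \poly_(k < m) ((-1) ^+ k / k`!%:R).
have pE m y : \sum_(k < m) (- y) ^+ k / k`!%:R = (p m).[y].
  rewrite horner_poly; apply: eq_bigr => k _.
  by rewrite -mulN1r exprMn; ring.
have dp m : (p m.+1)^`() = - p m.
  apply/polyP => i; rewrite coef_deriv coefN !coef_poly ltnS.
  case: ifP => _; last by rewrite mul0rn oppr0.
  rewrite -mulr_natr exprS factS natrM.
  have : i.+1%:R != 0 :> R by rewrite pnatr_eq0.
  have : i`!%:R != 0 :> R by rewrite pnatr_eq0 -lt0n fact_gt0.
  by move=> ? ?; field; apply/andP.
pose q : {poly R} := (K.+1`!%:R^-1)%:P * 'X^(K.+1).
have dq y : q^`().[y] = y ^+ K / K`!%:R.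
  rewrite derivM derivC mul0r add0r derivXn !hornerE hornerMn hornerXn /=.
  rewrite factS natrM invfM -mulr_natr.
  have : K.+1%:R != 0 :> R by rewrite pnatr_eq0.
  have : K`!%:R != 0 :> R by rewrite pnatr_eq0 -lt0n fact_gt0.
  by move=> ? ?; field; apply/andP.
have q0 : q.[0] = 0 by rewrite !hornerE expr0n mulr0.
have p0 : (p K.+1).[0] = 1.
  by rewrite horner_poly big_ord_recl /= big1 ?addr0 ?fact0 ?divr1 ?expr0 ?mulr1 // => i _;
     rewrite expr0n /= mulr0.
have key (s : R) : `|s| <= 1 -> 0 <= (q - s *: p K.+1).[x] + s * expR (- x).
  move=> s1.
  pose g y := (q - s *: p K.+1).[y] + s * expR (- y).
  have dg (y : R) : is_derive y 1 g ((q - s *: p K.+1)^`().[y] + s * - expR (- y)).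
    apply: is_deriveD.
    have dN : is_derive y 1 (fun y : R => expR (- y)) (- expR (- y)).
      by apply: is_derive_eq; rewrite /GRing.scale /=; ring.
    exact: (@is_deriveZ R R R (fun y : R => expR (- y)) s y 1 _ dN).
  have g0 : g 0 = 0 by rewrite /g hornerD hornerN hornerZ q0 p0 oppr0 expR0; ring.
  rewrite -g0; apply: (@ger0_derive1_ndecry R g 0) => //.
  - move=> y; rewrite in_itv /= andbT => y0.
    rewrite derive1E derive_val derivB derivZ dp hornerD hornerN hornerZ dq hornerN.
    have := IH y (ltW y0); rewrite pE.
    set a := expR _; set b := (p K).[y]; set c := y ^+ K / _ => h.
    have : s * (a - b) <= c.
      apply: le_trans h; apply: le_trans (ler_norm _) _; rewrite normrM.
      by rewrite ler_piMl.
    have -> : c - s * - b + s * - a = c - s * (a - b) by ring.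
    by rewrite subr_ge0.
  - by apply: derivable_within_continuous => y _; apply: ex_derive; exact: dg.
have qx : x ^+ K.+1 / K.+1`!%:R = q.[x] by rewrite !hornerE mulrC.
rewrite pE qx ler_norml; apply/andP; split.
  have := key (1); rewrite normr1 lexx => /(_ isT).
  rewrite hornerD hornerN hornerZ; lra.
have := key (-1); rewrite normrN normr1 lexx => /(_ isT).
rewrite hornerD hornerN hornerZ; lra.
Qed.

Section exp_moments.
Context (R : realType).

(** The quotient is [n!] times a binomial coefficient of [n + K], and these coefficients sum to
    [2 ^ (n + K)]. *)
Lemma fact_moment_bound (n K : nat) : (n + K)`!%:R / K`!%:R <= n`!%:R * 2 ^+ (n + K) :> R.
Proof.
rewrite ler_pdivrMr ?ltr0n ?fact_gt0 //.
rewrite -mulrA -natrX -!natrM ler_nat.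
have := bin_fact (leq_addr K n); rewrite addKn => <-.
rewrite mulnCA leq_mul2l [in leqRHS]mulnC [in leqLHS]mulnC leq_mul2l.
apply/orP; right; apply/orP; right.
rewrite -[X in (_ <= X ^ _)%N]/(1 + 1)%N expnDn.
rewrite (bigD1 (inord n)) //= inordK ?ltnS ?leq_addr //.
by rewrite !exp1n !muln1 leq_addr.
Qed.

Variables (C : R).
Hypothesis C0 : 0 < C.

(* The Laplace transform and its derivatives at [l] determine those at [l + r], with a step [r]
   independent of [l]. *)
Lemma laplace_step d (T : measurableType d) (P : probability T R) (X : T -> R)
  (l : R) (n K : nat) :
  measurable_fun setT X -> (forall w, 0 <= X w) ->
  (forall n, (\int[P]_w (X w ^+ n)%:E <= (C ^+ n * n`!%:R)%:E)%E) -> 0 <= l ->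
  forall r, r = (4 * C)^-1 ->
  `| (\int[P]_w (X w ^+ n * expR (- ((l + r) * X w)))) -
     \sum_(k < K) (- r) ^+ k / k`!%:R * (\int[P]_w (X w ^+ (n + k) * expR (- (l * X w)))) |
  <= n`!%:R * (2 * C) ^+ n * (2^-1) ^+ K.
Proof.
move=> mX X0 XC l0 r rE.
have r0 : 0 < r by rewrite rE invr_gt0 mulr_gt0.
have mXn k : measurable_fun setT (fun w => X w ^+ k) by exact: measurable_funX.
have mE a : measurable_fun setT (fun w => expR (- (a * X w))).
  by apply: measurableT_comp => //; apply: measurableT_comp => //; exact: measurable_funM.
have iX k : P.-integrable setT (fun w => (X w ^+ k)%:E).
  apply/integrableP; split; first exact/measurable_EFinP.
  apply: le_lt_trans (ltry (C ^+ k * k`!%:R)).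
  rewrite (_ : \int[P]_w _ = \int[P]_w (X w ^+ k)%:E)%E ?XC //.
  by apply: eq_integral => w _; rewrite gee0_abs // lee_fin exprn_ge0.
have iXE k a : 0 <= a -> P.-integrable setT (EFin \o (fun w => X w ^+ k * expR (- (a * X w)))).
  move=> a0; apply: le_integrable (iX k) => //.
    by apply/measurable_EFinP; exact: measurable_funM.
  move=> w _ /=; rewrite lee_fin normrM ler_piMr // ger0_norm ?expR_ge0 //.
  by rewrite -expR0 ler_expR oppr_le0 mulr_ge0.
have sumE : \sum_(k < K) (- r) ^+ k / k`!%:R * (\int[P]_w (X w ^+ (n + k) * expR (- (l * X w)))) =
  \int[P]_w (X w ^+ n * expR (- (l * X w)) * \sum_(k < K) (- (r * X w)) ^+ k / k`!%:R) /\
  P.-integrable setT (EFin \o (fun w => X w ^+ n * expR (- (l * X w)) *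
     \sum_(k < K) (- (r * X w)) ^+ k / k`!%:R)).
  elim: K => [|K [IH1 IH2]].
    rewrite big_ord0; split.
      by under eq_Rintegral do rewrite big_ord0 mulr0; rewrite Rintegral_cst // mul0r.
    under eq_fun do rewrite /= big_ord0 mulr0; exact: integrable0.
  rewrite big_ord_recr /= IH1.
  have E w : X w ^+ n * expR (- (l * X w)) * (\sum_(k < K.+1) (- (r * X w)) ^+ k / k`!%:R) =
     X w ^+ n * expR (- (l * X w)) * (\sum_(k < K) (- (r * X w)) ^+ k / k`!%:R) +
     ((- r) ^+ K / K`!%:R) * (X w ^+ (n + K) * expR (- (l * X w))).
    have : (- (r * X w)) ^+ K = (- r) ^+ K * X w ^+ K by rewrite -mulNr exprMn.
    by rewrite big_ord_recr /= mulrDr exprD => ->; congr (_ + _); ring.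
  split; last first.
    rewrite (_ : EFin \o _ = (EFin \o (fun w => (X w ^+ n * expR (- (l * X w)) *
        \sum_(k < K) (- (r * X w)) ^+ k / k`!%:R)%R)) \+ (fun w => ((- r) ^+ K / K`!%:R)%:E *
        (EFin \o (fun w => (X w ^+ (n + K) * expR (- (l * X w)))%R)) w))%E.
      by apply: integrableD => //; apply: integrableZl => //; exact: iXE.
    by apply/funext => w /=; rewrite E EFinD EFinM.
  under [RHS]eq_Rintegral do rewrite E.
  rewrite RintegralD //; last first.
    by apply: (integrableZl measurableT ((- r) ^+ K / K`!%:R) (iXE _ _ l0)).
  by rewrite RintegralZl //; exact: iXE.
have lr0 : 0 <= l + r by rewrite addr_ge0 // ltW.
have [-> iS] := sumE.
rewrite -RintegralB //; last by apply: iXE; rewrite addr_ge0 // ltW.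
apply: (le_trans (le_normr_Rintegral _ _)) => //.
  exact: (integrableB measurableT (iXE n _ lr0) iS).
(* The choice [r * C = 1 / 4] beats the factor [2 ^ K] of the binomial bound and leaves
   [2 ^ - K]. *)
have rK : r ^+ K / K`!%:R * (C ^+ (n + K) * (n + K)`!%:R) <= n`!%:R * (2 * C) ^+ n * (2^-1) ^+ K.
  have := fact_moment_bound n K.
  have rC : r ^+ K * C ^+ K = (4^-1) ^+ K.
    by rewrite -exprMn; congr (_ ^+ _); rewrite rE; field; rewrite gt_eqF.
  have -> : r ^+ K / K`!%:R * (C ^+ (n + K) * (n + K)`!%:R) =
     C ^+ n * (4^-1) ^+ K * ((n + K)`!%:R / K`!%:R) by rewrite -rC exprD; ring.
  have -> : n`!%:R * (2 * C) ^+ n * (2^-1) ^+ K = C ^+ n * (4^-1) ^+ K * (n`!%:R * 2 ^+ (n + K)).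
    rewrite exprMn exprD; have -> : (4^-1) ^+ K = (2^-1) ^+ K * (2^-1) ^+ K :> R.
      by rewrite -exprMn; congr (_ ^+ _); field.
    have : 2 ^+ K * (2^-1) ^+ K = 1 :> R by rewrite -exprMn divff ?expr1n.
    move: (2 ^+ K) (2^-1 ^+ K) => a b ab.
    by transitivity (C ^+ n * (b * (a * b)) * (n`!%:R * 2 ^+ n)); [rewrite ab|]; ring.
  by move=> h; apply: ler_wpM2l => //; rewrite mulr_ge0 ?exprn_ge0 ?invr_ge0 // ltW.
apply: le_trans rK; rewrite -lee_fin.
have -> : ((r ^+ K / K`!%:R * (C ^+ (n + K) * (n + K)`!%:R))%:E =
   (r ^+ K / K`!%:R)%:E * (C ^+ (n + K) * (n + K)`!%:R)%:E)%E by rewrite EFinM.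
rewrite /Rintegral fineK; last first.
  apply: integrable_fin_num => //.
  exact: (integrable_abse (integrableB measurableT (iXE n _ lr0) iS)).
have c0 : 0 <= r ^+ K / K`!%:R by rewrite divr_ge0 ?exprn_ge0 // ltW.
apply: le_trans (lee_wpmul2l _ (XC (n + K)%N)); last by rewrite lee_fin.
rewrite -ge0_integralZl_EFin //; last 2 first.
  - by move=> w _; rewrite lee_fin exprn_ge0.
  - exact/measurable_EFinP.
apply: ge0_le_integral => //.
- apply/measurable_EFinP; apply: measurableT_comp => //; apply: measurable_funB.
    exact: measurable_funM.
  by move: iS => /measurable_int /measurable_EFinP.
- by apply/measurable_EFinP; exact: measurable_funM.
move=> w _; rewrite -EFinM lee_fin.
have -> : - ((l + r) * X w) = - (l * X w) + - (r * X w) by ring.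
rewrite expRD mulrA -mulrBr normrM [leLHS]mulrC.
have := expRN_taylor K (mulr_ge0 (ltW r0) (X0 w)).
set t := `|_ - _| => ht.
have : t * `|X w ^+ n * expR (- (l * X w))| <= (r * X w) ^+ K / K`!%:R * X w ^+ n.
  apply: ler_pM => //; first exact: normr_ge0.
  rewrite ger0_norm ?mulr_ge0 ?exprn_ge0 ?expR_ge0 //.
  rewrite ler_piMr ?exprn_ge0 // -expR0 ler_expR oppr_le0 mulr_ge0 //.
move=> h; apply: (le_trans h); rewrite exprMn exprD le_eqVlt; apply/orP; left.
by apply/eqP; ring.
Qed.

(** The moments of [expR (- (r * X))], a variable with values in [[0, 1]], are the values of the
    Laplace transform at the points [j * r]. These are reached from 0, where the derivatives are the
    moments up to sign, by steps of fixed length [r]; Hausdorff's case concludes. The growth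
    [C ^ n * n!] is what keeps the step length uniform. *)
Lemma same_moments_same_law d1 (T1 : measurableType d1) (P1 : probability T1 R)
  d2 (T2 : measurableType d2) (P2 : probability T2 R) (X1 : T1 -> R) (X2 : T2 -> R) :
  measurable_fun setT X1 -> measurable_fun setT X2 ->
  (forall w, 0 <= X1 w) -> (forall w, 0 <= X2 w) ->
  (forall n, (\int[P1]_w (X1 w ^+ n)%:E = \int[P2]_w (X2 w ^+ n)%:E)%E) ->
  (forall n, (\int[P1]_w (X1 w ^+ n)%:E <= (C ^+ n * n`!%:R)%:E)%E) ->
  forall B : set R, measurable B -> P1 (X1 @^-1` B) = P2 (X2 @^-1` B).
Proof.
move=> mX1 mX2 X10 X20 X12 X1C B mB.
have X2C n : (\int[P2]_w (X2 w ^+ n)%:E <= (C ^+ n * n`!%:R)%:E)%E by rewrite -X12.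
set r := (4 * C)^-1.
have r0 : 0 < r by rewrite invr_gt0 mulr_gt0.
have LE j n : \int[P1]_w (X1 w ^+ n * expR (- ((j%:R * r) * X1 w))) =
    \int[P2]_w (X2 w ^+ n * expR (- ((j%:R * r) * X2 w))).
  elim: j n => [|j IH] n.
    under eq_Rintegral do rewrite mul0r mul0r oppr0 expR0 mulr1.
    under [RHS]eq_Rintegral do rewrite mul0r mul0r oppr0 expR0 mulr1.
    by rewrite /Rintegral X12.
  have jr0 : 0 <= j%:R * r by rewrite mulr_ge0 // ltW.
  have -> : j.+1%:R * r = j%:R * r + r by rewrite -natr1; ring.
  set L1 := Rintegral _ _ _; set L2 := Rintegral _ _ _.
  apply/eqP; rewrite -subr_eq0 -normr_le0.
  pose D := n`!%:R * (2 * C) ^+ n.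
  have D0 : 0 <= D by rewrite mulr_ge0 // exprn_ge0 // mulr_ge0 // ltW.
  (* By the induction hypothesis both Taylor sums are the same [S], so only the two remainders are
     left, for every [K]. *)
  have bnd K : `|L1 - L2| <= (D + D) * (2^-1) ^+ K.
    have h1 := laplace_step n K mX1 X10 X1C jr0 (erefl _ : r = _).
    have h2 := laplace_step n K mX2 X20 X2C jr0 (erefl _ : r = _).
    rewrite -/L1 in h1; rewrite -/L2 in h2.
    move: h1 h2; under eq_bigr do rewrite IH.
    set S := \sum_(k < K) _ => h1 h2.
    rewrite distrC in h2.
    have -> : L1 - L2 = (L1 - S) + (S - L2) by ring.
    by rewrite (le_trans (ler_normD _ _)) // mulrDl lerD.
  have lim : (D + D) * (2^-1) ^+ K @[K --> \oo] --> (D + D) * 0.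
    by apply: cvgM; [exact: cvg_cst|apply: cvg_expr; rewrite ger0_norm; lra].
  rewrite mulr0 in lim.
  have <- : limn (fun K => (D + D) * 2^-1 ^+ K) = 0 by exact/cvg_lim.
  by apply: limr_ge; [apply/cvg_ex; exists 0|exact: nearW].
pose V1 w := expR (- (r * X1 w)); pose V2 w := expR (- (r * X2 w)).
pose B' := (fun v => - (ln v / r)) @^-1` B.
have mB' : measurable B'.
  rewrite -[B']setTI; apply: (_ : measurable_fun setT (fun v : R => - (ln v / r))) => //.
  by apply: measurableT_comp => //; apply: measurable_funM.
have BE (x : R) : B x = B' (expR (- (r * x))).
  by rewrite /B' /preimage /mkset expRK; congr B; field; rewrite gt_eqF.
have -> : X1 @^-1` B = V1 @^-1` B' by apply/funext => w; exact: BE.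
have -> : X2 @^-1` B = V2 @^-1` B' by apply/funext => w; exact: BE.
have mV d (T : measurableType d) (X : T -> R) : measurable_fun setT X ->
    measurable_fun setT (fun w => expR (- (r * X w))).
  by move=> mX; do 2 apply: measurableT_comp => //; exact: measurable_funM.
have V01 d (T : measurableType d) (X : T -> R) w : 0 <= X w -> 0 <= expR (- (r * X w)) <= 1.
  by move=> Xw; rewrite expR_ge0 -expR0 ler_expR oppr_le0 mulr_ge0 // ltW.
apply: same_moments01_same_law => //; [exact: mV|exact: mV| | |].
- by move=> w; exact: V01.
- by move=> w; exact: V01.
move=> j.
have fin d (T : measurableType d) (P : probability T R) (X : T -> R) :
    measurable_fun setT X -> (forall w, 0 <= X w) ->
    (\int[P]_w (expR (- (r * X w)) ^+ j)%:E =
    (\int[P]_w (X w ^+ 0 * expR (- ((j%:R * r) * X w))))%:E)%E.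
  move=> mX X0.
  have -> : (\int[P]_w (X w ^+ 0 * expR (- ((j%:R * r) * X w)))) =
    \int[P]_w (expR (- (r * X w)) ^+ j).
    apply: eq_Rintegral => w _; rewrite expr0 mul1r -expRM_natl; congr expR; ring.
  rewrite /Rintegral fineK //; apply: integrable_fin_num => //.
  apply: (@bounded_integrable _ _ _ _ _ 1).
    by apply: measurable_funX; exact: mV.
  by move=> w; have /andP[? ?] := V01 _ _ X w (X0 w); rewrite ger0_norm ?exprn_ge0 // exprn_ile1.
by rewrite /V1 /V2 !fin // LE.
Unshelve. all: by end_near. Qed.
End exp_moments.

(** * Expectations of products of independent variables *)

Section expect.
Local Open Scope ereal_scope.
Context d (T : measurableType d) (R : realType) (P : {measure set T -> \bar R}).

(** For [c = +oo] multiplication is not continuous at 0. Monotonicity repairs this: either all terms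
    vanish, or the products are eventually [+oo]. *)
Lemma cvge_mull_nondecreasing (c : \bar R) (u : nat -> \bar R) (l : \bar R) : 0 <= c ->
  (forall n, 0 <= u n) -> nondecreasing_seq u -> u @ \oo --> l ->
  (fun n => c * u n) @ \oo --> c * l.
Proof.
move=> c0 u0 ndu ul.
have [cfin|] := boolP (c \is a fin_num); first exact: cvgeZl.
rewrite ge0_fin_numE // -leNgt leye_eq => /eqP ->.
have lE : l = ereal_sup (range u).
  by apply/esym; apply: cvg_unique ul => //; exact: ereal_nondecreasing_cvgn.
have ule n : u n <= l by rewrite lE; apply: ereal_sup_ubound; exists n.
have l0 : 0 <= l by rewrite (le_trans (u0 0%N)).
move: (l0); rewrite le_eqVlt => /predU1P[l0'|lgt0].
  have un0 n : u n = 0 by apply/eqP; rewrite eq_le u0 l0' ule.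
  rewrite -l0' mule0.
  suff -> : (fun n => +oo * u n) = cst 0 by exact: cvg_cst.
  by apply/funext => n; rewrite un0 mule0.
have [n un] : exists n, 0 < u n.
  apply: contrapT => /forallNP h; move: lgt0; apply/negP; rewrite -leNgt lE.
  by apply: ge_ereal_sup => _ [n _ <-]; rewrite leNgt; exact/negP/h.
rewrite gt0_mulye //; apply: cvg_near_cst; exists n => // m /= nm.
by rewrite gt0_mulye // (lt_le_trans un) // ndu.
Qed.

(* Extends a factorization from indicators of an event of D to nonnegative functions of D. *)
Lemma expectation_step d' (T' : measurableType d') (W W' : T -> R) (D : T -> T') (c : \bar R) :
  measurable_fun setT W -> measurable_fun setT W' -> measurable_fun setT D ->
  (forall w, (0 <= W w)%R) -> (forall w, (0 <= W' w)%R) -> 0 <= c ->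
  (forall B, measurable B ->
     \int[P]_w (W w * \1_(D @^-1` B) w)%:E = c * \int[P]_w (W' w * \1_(D @^-1` B) w)%:E) ->
  forall f : T' -> R, measurable_fun setT f -> (forall x, (0 <= f x)%R) ->
    \int[P]_w (W w * f (D w))%:E = c * \int[P]_w (W' w * f (D w))%:E.
Proof.
move=> mW mW' mD W0 W'0 c0 WE f mf f0.
have mDf (h : T' -> \bar R) : measurable_fun setT h -> measurable_fun setT (fun w => h (D w)).
  by move=> mh; exact: measurableT_comp mD.
have mp (V : T -> R) (h : T' -> \bar R) : measurable_fun setT V -> measurable_fun setT h ->
    measurable_fun setT (fun w => (V w)%:E * h (D w)).
  by move=> mV mh; apply: emeasurable_funM; [exact/measurable_EFinP|exact: mDf].
suff : \int[P]_w ((W w)%:E * (f (D w))%:E) = c * \int[P]_w ((W' w)%:E * (f (D w))%:E).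
  by under eq_integral do rewrite -EFinM; under [in RHS]eq_integral do rewrite -EFinM.
apply: (@nonneg_measurable_ind _ T' R (fun h : T' -> \bar R =>
  \int[P]_w ((W w)%:E * h (D w)) = c * \int[P]_w ((W' w)%:E * h (D w))) _ _ _ _
  (fun x => (f x)%:E)); last 2 first.
- exact/measurable_EFinP.
- by move=> x; rewrite lee_fin.
- move=> B mB; have := WE B mB.
  by under eq_integral do rewrite EFinM; under [in RHS]eq_integral do rewrite EFinM.
- move=> a h a0 mh h0 IH.
  under eq_integral do rewrite muleCA; under [in RHS]eq_integral do rewrite muleCA.
  rewrite !ge0_integralZl_EFin //; last 4 first.
  + by move=> w _; rewrite mule_ge0 // lee_fin.
  + exact: mp.
  + by move=> w _; rewrite mule_ge0 // lee_fin.
  + exact: mp.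
  by rewrite IH muleCA.
- move=> g h mg mh g0 h0 IHg IHh.
  have E (V : T -> R) : measurable_fun setT V -> (forall w, (0 <= V w)%R) ->
    \int[P]_w ((V w)%:E * (g (D w) + h (D w))) =
    \int[P]_w ((V w)%:E * g (D w)) + \int[P]_w ((V w)%:E * h (D w)).
    move=> mV V0; rewrite -ge0_integralD //.
    + by apply: eq_integral => w _; rewrite ge0_muleDr.
    + by move=> w _; rewrite mule_ge0 // lee_fin.
    + exact: mp.
    + by move=> w _; rewrite mule_ge0 // lee_fin.
    + exact: mp.
  have p0 (u : T' -> \bar R) : (forall x, 0 <= u x) ->
      0 <= \int[P]_w ((W' w)%:E * u (D w)).
    by move=> u0; apply: integral_ge0 => w _; rewrite mule_ge0 // lee_fin.
  by rewrite (E W) // (E W') // IHg IHh [RHS]ge0_muleDr ?p0.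
- move=> h_ h mh h0 ndh hh IH.
  have E (V : T -> R) : measurable_fun setT V -> (forall w, (0 <= V w)%R) ->
    \int[P]_w ((V w)%:E * h_ n (D w)) @[n --> \oo] --> \int[P]_w ((V w)%:E * h (D w)).
    move=> mV V0.
    have -> : \int[P]_w ((V w)%:E * h (D w)) =
        \int[P]_w (limn (fun n => (V w)%:E * h_ n (D w))).
      by apply: eq_integral => w _; apply/esym/cvg_lim => //; exact: cvgeZl.
    apply: cvg_monotone_convergence => //.
    + by move=> n; exact: mp.
    + by move=> n w _; rewrite mule_ge0 // lee_fin.
    + by move=> w _ a b ab; apply: lee_pmul => //; rewrite ?lee_fin //; exact: ndh.
  apply: cvg_unique (E W mW W0) _ => //.
  rewrite (_ : (fun n => _) = (fun n => c * \int[P]_w ((W' w)%:E * h_ n (D w)))); last first.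
    by apply/funext => n; exact: IH.
  apply: cvge_mull_nondecreasing (E W' mW' W'0) => //.
  + by move=> n; apply: integral_ge0 => w _; rewrite mule_ge0 // lee_fin.
  + move=> a b ab; apply: ge0_le_integral => //.
    * by move=> w _; rewrite mule_ge0 // lee_fin.
    * exact: mp.
    * exact: mp.
    * by move=> w _; apply: lee_pmul => //; rewrite ?lee_fin //; exact: ndh.
Qed.
End expect.

Section independent.
Local Open Scope ereal_scope.
Context d (T : measurableType d) (R : realType) (P : probability T R) (n : nat).
Variable X : 'I_n -> T -> R.
Hypothesis mX : forall i, measurable_fun setT (X i).

Lemma prod_indic (B : 'I_n -> set R) w :
  (\prod_i \1_(B i) (X i w))%R = \1_(\bigcap_(i in [set: 'I_n]) (X i @^-1` B i)) w :> R.
Proof.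
rewrite indicE; have [/set_mem h|h] := boolP (w \in _).
  by rewrite big1 // => i _; rewrite indicE mem_set //; exact: h.
have : ~ (forall i, B i (X i w)) by move=> h'; move/negP: h; apply; apply/mem_set => i _; exact: h'.
move=> /existsNP[i Bi]; rewrite (bigD1 i) //= indicE memNset // mul0r //.
Qed.

(* A factor g0 with \int g0 * prod_i 1_{B i}(X i) = c * \int prod_i 1_{B i}(X i) may be a
   random variable independent of the X i; the indicators are replaced one at a time. *)
Lemma expectation_prod_factor (g0 : T -> R) (c : \bar R) :
  measurable_fun setT g0 -> (forall w, (0 <= g0 w)%R) -> 0 <= c ->
  (forall B : 'I_n -> set R, (forall i, measurable (B i)) ->
    \int[P]_w (g0 w * \prod_i \1_(B i) (X i w))%:E =
    c * \int[P]_w (\prod_i \1_(B i) (X i w))%:E) ->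
  forall f : 'I_n -> R -> R, (forall i, measurable_fun setT (f i)) ->
  (forall i x, (0 <= f i x)%R) ->
  \int[P]_w (g0 w * \prod_i f i (X i w))%:E = c * \int[P]_w (\prod_i f i (X i w))%:E.
Proof.
move=> mg0 g00 c0 gB f mf f0.
(* The first [k] factors are already functions, the others still indicators. The induction
   quantifies over all [B], since replacing the next indicator uses the factorization for every
   event of that variable. *)
pose h k (B : 'I_n -> set R) (i : 'I_n) := if (i < k)%N then f i else \1_(B i).
have mh k B i : measurable (B i) -> measurable_fun setT (h k B i).
  by rewrite /h; case: ifP.
have h0 k B i x : (0 <= h k B i x)%R by rewrite /h; case: ifP => // _; rewrite indicE.
suff key k : (k <= n)%N -> forall B, (forall i, measurable (B i)) ->
    \int[P]_w (g0 w * \prod_i h k B i (X i w))%:E = c * \int[P]_w (\prod_i h k B i (X i w))%:E.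
  have := key n (leqnn n) (fun=> setT) (fun=> measurableT).
  have E w : (\prod_i h n (fun=> setT) i (X i w) = \prod_i f i (X i w))%R.
    by apply: eq_bigr => i _; rewrite /h ltn_ord.
  by under eq_integral do rewrite E; under [in RHS]eq_integral do rewrite E.
elim: k => [_|k IH kn] B mB.
  exact: gB.
pose j := Ordinal kn.
have hE B' w : (\prod_i h k.+1 B' i (X i w) =
    (\prod_(i | i != j) h k.+1 B' i (X i w)) * f j (X j w))%R.
  by rewrite (bigD1 j) //= mulrC; congr (_ * _)%R; rewrite /h /= ltnSn.
have hE' B' C w : (\prod_i h k (fun i => if i == j then C else B' i) i (X i w) =
    (\prod_(i | i != j) h k.+1 B' i (X i w)) * \1_(X j @^-1` C) w)%R.
  rewrite (bigD1 j) //= mulrC; congr (_ * _)%R.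
    apply: eq_bigr => i ij; rewrite /h ltnS (negbTE ij) [(i <= k)%N]leq_eqVlt.
    by rewrite -[(nat_of_ord i == k)]/(i == j) (negbTE ij).
  by rewrite /h ltnn eqxx.
have mW : measurable_fun setT (fun w => \prod_(i | i != j) h k.+1 B i (X i w))%R.
  under eq_fun do rewrite -big_filter.
  apply: measurable_prod => i _.
  by apply: measurableT_comp => //; exact: mh.
have W0 w : (0 <= \prod_(i | i != j) h k.+1 B i (X i w))%R by apply: prodr_ge0.
under eq_integral do rewrite hE mulrA; under [in RHS]eq_integral do rewrite hE.
apply: (@expectation_step _ _ _ _ _ _ (fun w => g0 w * \prod_(i | i != j) h k.+1 B i (X i w))%R) => //.
- exact: measurable_funM.
- by move=> w; rewrite mulr_ge0.
move=> C mC; pose B' i := if i == j then C else B i.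
transitivity (\int[P]_w (g0 w * \prod_i h k B' i (X i w))%:E).
  by apply: eq_integral => w _; rewrite hE' mulrA.
rewrite IH //; first last.
- by move=> i; rewrite /B'; case: ifP.
- exact: ltnW.
by congr (_ * _); apply: eq_integral => w _; rewrite hE'.
Qed.

Lemma expectation_prod : indep_RVs P X ->
  forall f : 'I_n -> R -> R, (forall i, measurable_fun setT (f i)) ->
  (forall i x, (0 <= f i x)%R) ->
  \int[P]_w (\prod_i f i (X i w))%:E = \prod_i \int[P]_w (f i (X i w))%:E.
Proof.
move=> iX f mf f0.
pose h k (B : 'I_n -> set R) (i : 'I_n) := if (i < k)%N then f i else \1_(B i).
have mh k B i : measurable (B i) -> measurable_fun setT (h k B i).
  by rewrite /h; case: ifP.
have h0 k B i x : (0 <= h k B i x)%R by rewrite /h; case: ifP => // _; rewrite indicE.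
suff key k : (k <= n)%N -> forall B, (forall i, measurable (B i)) ->
    \int[P]_w (\prod_i h k B i (X i w))%:E = \prod_i \int[P]_w (h k B i (X i w))%:E.
  have := key n (leqnn n) (fun=> setT) (fun=> measurableT).
  have E w : (\prod_i h n (fun=> setT) i (X i w) = \prod_i f i (X i w))%R.
    by apply: eq_bigr => i _; rewrite /h ltn_ord.
  under eq_integral do rewrite E.
  by move=> ->; apply: eq_bigr => i _; rewrite /h ltn_ord.
have mpre i (C : set R) : measurable C -> measurable (X i @^-1` C).
  by move=> mC; rewrite -[X in measurable X]setTI; exact: mX.
elim: k => [_|k IH kn] B mB.
  under eq_integral do rewrite prod_indic.
  have mcap : measurable (\bigcap_(i in [set: 'I_n]) (X i @^-1` B i)).
    by apply: fin_bigcap_measurable => // i _; exact: mpre.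
  rewrite integral_indic // setIT.
  transitivity (\prod_i P (X i @^-1` B i)); first exact: iX.
  apply: eq_bigr => i _.
  by rewrite -[RHS]/(\int[P]_w (\1_(X i @^-1` B i) w)%:E) integral_indic ?setIT //; exact: mpre.
pose j := Ordinal kn.
have hE w : (\prod_i h k.+1 B i (X i w) =
    (\prod_(i | i != j) h k.+1 B i (X i w)) * f j (X j w))%R.
  by rewrite (bigD1 j) //= mulrC; congr (_ * _)%R; rewrite /h /= ltnSn.
have hki C i : i != j -> h k (fun i => if i == j then C else B i) i = h k.+1 B i.
  move=> ij; rewrite /h ltnS (negbTE ij) [(i <= k)%N]leq_eqVlt.
  by rewrite -[(nat_of_ord i == k)]/(i == j) (negbTE ij).
have hE' C w : (\prod_i h k (fun i => if i == j then C else B i) i (X i w) =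
    (\prod_(i | i != j) h k.+1 B i (X i w)) * \1_(X j @^-1` C) w)%R.
  rewrite (bigD1 j) //= mulrC; congr (_ * _)%R.
    by apply: eq_bigr => i ij; rewrite hki.
  by rewrite /h ltnn eqxx.
have mW : measurable_fun setT (fun w => \prod_(i | i != j) h k.+1 B i (X i w))%R.
  under eq_fun do rewrite -big_filter.
  apply: measurable_prod => i _.
  by apply: measurableT_comp => //; exact: mh.
have W0 w : (0 <= \prod_(i | i != j) h k.+1 B i (X i w))%R by apply: prodr_ge0.
under eq_integral do rewrite hE.
pose c := \prod_(i | i != j) \int[P]_w (h k.+1 B i (X i w))%:E.
have c0 : 0 <= c.
  by apply: prode_ge0 => i _; apply: integral_ge0 => w _; rewrite lee_fin.
rewrite (@expectation_step _ _ _ _ _ _ _ (fun=> 1%R) (X j) c) //.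
- rewrite (bigD1 j) //= muleC /h /= ltnSn; congr (_ * _).
  by under eq_integral do rewrite mul1r.
move=> C mC; pose B' i := if i == j then C else B i.
transitivity (\int[P]_w (\prod_i h k B' i (X i w))%:E).
  by apply: eq_integral => w _; rewrite hE'.
rewrite IH //; first last.
- by move=> i; rewrite /B'; case: ifP.
- exact: ltnW.
rewrite (bigD1 j) //= muleC; congr (_ * _).
  by apply: eq_bigr => i ij; rewrite hki.
by rewrite /h /B' ltnn eqxx; under [RHS]eq_integral do rewrite mul1r.
Qed.
End independent.

(** * Helly selection *)

Section quantile.
Context (R : realType).
Local Notation unif := (uniform_prob (@ltr01 R)).

(** [Q] is 0 outside the unit interval, hence not monotone on the line. The function [h] extends
    [- expR (- Q)] monotonically by -1 on the left and 0 on the right, and [Q] is recovered from it,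
    with the convention that [ln] is 0 at 0. *)
Lemma nondecreasing01_measurable (Q : R -> R) :
  (forall p p', 0 < p -> p <= p' -> p' < 1 -> Q p <= Q p') -> (forall p, 0 <= Q p) ->
  (forall p, ~~ (0 < p < 1) -> Q p = 0) -> measurable_fun setT Q.
Proof.
move=> ndQ Q0 Qout.
pose h p : R := - (if p <= 0 then 1 else if p < 1 then expR (- Q p) else 0).
have ndh : nondecreasing_fun h.
  move=> p p' pp'; rewrite /h lerN2.
  have [p'0|p'0] := leP p' 0; first by rewrite (le_trans pp' p'0).
  have [p'1|p'1] := ltP p' 1; last first.
    by case: ifP => // _; case: ifP => // _; exact: expR_ge0.
  have [p0|p0] := leP p 0; first by rewrite -expR0 ler_expR oppr_le0.
  by rewrite (le_lt_trans pp' p'1) ler_expR lerN2 ndQ.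
have mh : measurable_fun setT h by exact: nondecreasing_measurable.
have -> : Q = (fun p => - ln (- h p)).
  apply/funext => p; rewrite /h opprK.
  have [p0|p0] := leP p 0; first by rewrite ln1 oppr0 Qout // ltNge p0.
  have [p1|p1] := ltP p 1; first by rewrite expRK opprK.
  by rewrite ln0 // oppr0 Qout // negb_and -!leNgt p1 orbT.
by apply: measurableT_comp => //; apply: measurableT_comp; [exact: measurable_ln|exact: measurableT_comp].
Qed.

Lemma unif_null (D : set R) : countable D -> unif.-negligible (D `|` ~` `]0, 1[).
Proof.
move=> cD.
have mD : measurable D by exact: countable_measurable.
have mI : measurable (~` `]0%R, 1%R[ : set R) by apply: measurableC.
apply/negligibleP; first exact: measurableU.
apply: null_set_setU => //.
  apply: null_set_integral => //; last exact: countable_lebesgue_measure0.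
  by apply/measurable_EFinP/measurable_funTS; exact: measurable_uniform_pdf.
rewrite -[LHS]/(\int[lebesgue_measure]_(x in ~` `]0%R, 1%R[) (uniform_pdf 0 1 x)%:E)%E.
rewrite integral_uniform_pdf.
have -> : ~` `]0, 1[ `&` `[0, 1] = [set 0] `|` [set 1] :> set R.
  apply/seteqP; split => x /=; rewrite !in_itv /=.
    move=> [/negP]; rewrite negb_and -!leNgt => /orP[] h /andP[x0 x1]; [left|right];
    by apply/eqP; rewrite eq_le; apply/andP; split.
  by move=> [->|->]; rewrite ltxx ?lexx ?ler01 ?andbF.
rewrite integral_setU //=.
- by rewrite !integral_set1 adde0.
- by apply/measurable_EFinP/measurable_funTS; exact: measurable_uniform_pdf.
- rewrite /disj_set; apply/eqP/seteqP; split => x //= [-> /eqP].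
  by rewrite eq_sym oner_eq0.
Qed.

Lemma unif_itv (c : R) : 0 <= c <= 1 -> unif (`]0, 1[ `&` `]-oo, c]) = c%:E.
Proof.
move=> /andP[c0 c1]; rewrite /uniform_prob integral_uniform_pdf.
have E : forall A : set R, A `<=` `[0, 1]%classic -> measurable A ->
   (\int[lebesgue_measure]_(x in A) (uniform_pdf 0 1 x)%:E = lebesgue_measure A)%E.
  move=> A A01 mA; rewrite -[RHS]mul1e -integral_cst //.
  apply: eq_integral => x /set_mem /A01 /=; rewrite in_itv /= => x01.
  by rewrite /uniform_pdf x01 subr0 invr1.
rewrite E; last 2 first.
- by move=> x [].
- by do 2 apply: measurableI => //.
move: c1; rewrite le_eqVlt => /predU1P[->|c1].
  rewrite (_ : `]0, 1[ `&` `]-oo, 1] `&` `[0, 1] = `]0, 1[%classic); last first.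
    apply/seteqP; split => x /=; rewrite !in_itv /=; first by move=> [[]].
    by move=> /[dup] /andP[x0 x1]; rewrite !ltW ?x0 ?x1.
  by rewrite lebesgue_measure_itv /= lte_fin ltr01 -EFinB subr0.
rewrite (_ : `]0, 1[ `&` `]-oo, c] `&` `[0, 1] = `]0, c]%classic); last first.
  apply/seteqP; split => x /=; rewrite !in_itv /=.
    by move=> [[/andP[-> _] ->]].
  by move=> /andP[x0 xc]; rewrite xc x0 (le_lt_trans xc c1) !ltW // (le_lt_trans xc c1).
rewrite lebesgue_measure_itv /= lte_fin; case: ltP => [_|h]; first by rewrite -EFinB subr0.
by have -> : c = 0 by apply/eqP; rewrite eq_le h c0.
Qed.

(** [Q] is the left-continuous inverse of the distribution function. The last clause is the half of
    the Galois connection that turns a lower bound on the distribution function into an upper bound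
    on the quantile. *)
Lemma quantile_exists d (T : measurableType d) (P : probability T R) (V : T -> R) :
  measurable_fun setT V -> (forall w, 0 <= V w) ->
  exists Q : R -> R,
   [/\ measurable_fun setT Q, forall p, 0 <= Q p,
       forall p p', 0 < p -> p <= p' -> p' < 1 -> Q p <= Q p',
       forall B : set R, measurable B -> unif (Q @^-1` B) = P (V @^-1` B)
     & forall p x, 0 < p < 1 -> (p%:E <= P [set w | (V w <= x)%R])%E -> Q p <= x].
Proof.
move=> mV V0.
pose V' : {RV P >-> R} := mfun_Sub (mem_set mV).
have cdfE x : cdf V' x = P [set w | V w <= x].
  rewrite /cdf /distribution /pushforward; congr (P _).
pose F x := fine (cdf V' x).
have FE x : (F x)%:E = P [set w | V w <= x].
  by rewrite /F cdfE fineK // -cdfE fin_num_measure.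
have ndF x y : x <= y -> F x <= F y.
  by move=> xy; rewrite -lee_fin /F !fineK ?fin_num_measure //; exact: cdf_nondecreasing.
have F0 x : x < 0 -> F x = 0.
  move=> x0; rewrite /F cdfE (_ : [set w | V w <= x] = set0) ?measure0 //.
  apply/seteqP; split => w //=; rewrite leNgt => /negP; apply.
  by rewrite (lt_le_trans x0).
have F01 x : 0 <= F x <= 1.
  by rewrite fine_ge0 //= -lee_fin /F fineK ?fin_num_measure // cdf_le1.
have F1 p : p < 1 -> exists x, p <= F x.
  move=> p1; have : F x @[x --> +oo] --> (1 : R) by apply: fine_cvg; exact: cvg_cdfy1.
  move=> /cvgrPdist_lt/(_ (1 - p)); rewrite subr_gt0 => /(_ p1) [M [_ HM]].
  exists (M + 1); have := HM (M + 1); rewrite ltrDl ltr01 => /(_ isT).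
  by have /andP[_ h] := F01 (M + 1); rewrite ger0_norm ?subr_ge0 //; lra.
have Frc x p : (forall y, x < y -> p <= F y) -> p <= F x.
  move=> h; have : F y @[y --> x^'+] --> F x.
    by apply: fine_cvg; rewrite fineK ?fin_num_measure //; exact: cdf_right_continuous.
  move=> Fx; have <- : lim (F y @[y --> x^'+]) = F x by exact/cvg_lim.
  apply: limr_ge; first by apply/cvg_ex; exists (F x).
  by near=> y; apply: h; near: y; exact: nbhs_right_gt.
pose S p := [set x | p <= F x].
have lbS p : 0 < p -> lbound (S p) 0.
  move=> p0 x; rewrite /S /= => px; rewrite leNgt; apply/negP => /F0 Fx.
  by rewrite Fx leNgt p0 in px.
pose Q p := if 0 < p < 1 then inf (S p) else 0.
(* Galois connection between [Q] and [F]; the direction from [Q] to [F] uses right continuity of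
   [F]. *)
have QP p x : 0 < p < 1 -> (Q p <= x) = (p <= F x).
  move=> /[dup] p01 /andP[p0 p1]; rewrite /Q p01; apply/idP/idP => h; last first.
    by apply: ge_inf => //; exists 0; exact: lbS.
  apply: Frc => y xy.
  have hi : has_inf (S p) by split; [have [z Hz] := F1 _ p1; exists z|exists 0; exact: lbS].
  have yx : 0 < y - x by rewrite subr_gt0.
  have [z /= Sz zy] := inf_adherent yx hi.
  by apply: (le_trans Sz); apply: ndF; apply: ltW; apply: (lt_le_trans zy); lra.
have Q0 p : 0 <= Q p.
  rewrite /Q; case: ifP => // /andP[p0 p1]; apply: lb_le_inf; last exact: lbS.
  by have [z Hz] := F1 _ p1; exists z.
have ndQ p p' : 0 < p -> p <= p' -> p' < 1 -> Q p <= Q p'.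
  move=> p0 pp' p'1.
  have p01 : 0 < p < 1 by rewrite p0 (le_lt_trans pp').
  have p01' : 0 < p' < 1 by rewrite p'1 (lt_le_trans p0).
  by rewrite QP // (le_trans pp') // -QP.
have mQ : measurable_fun setT Q.
  apply: nondecreasing01_measurable => // p p01; by rewrite /Q (negbTE p01).
exists Q; split => //; last by move=> p x p01; rewrite -FE lee_fin QP.
apply: same_cdf_same_law => // x; rewrite -FE.
have -> : [set p | Q p <= x] = (`]0, 1[ `&` `]-oo, F x]) `|`
    (~` `]0, 1[ `&` [set p : R | Q p <= x]).
  apply/seteqP; split => p /=; rewrite !in_itv /=.
    have [p01 h|_ h] := boolP (0 < p < 1); [left|right] => //.
    by rewrite -QP.
  by case => [[p01]|[_ //]]; rewrite QP.
have mQx : measurable [set p : R | Q p <= x].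
  rewrite (_ : [set p | Q p <= x] = setT `&` Q @^-1` `]-oo, x]).
    exact: (mQ measurableT _ (measurable_itv `]-oo, x])).
  by rewrite setTI; apply/seteqP; split=> w /=; rewrite in_itv.
have mc : measurable (~` `]0%R, 1%R[ : set R) by apply: measurableC.
rewrite measureU //=.
- have h : unif (~` `]0, 1[ `&` [set p : R | Q p <= x]) = 0%E.
    apply/eqP; rewrite eq_le measure_ge0 andbT.
    have mc0 : measurable (set0 `|` ~` `]0%R, 1%R[ : set R) by rewrite set0U.
    have h := (negligibleP unif mc0).1 (@unif_null set0 (countable0 _)).
    rewrite -[leRHS]h; apply: le_measure.
    + by apply/mem_set; exact: measurableI.
    + exact/mem_set.
    + by rewrite set0U => p [].
  by rewrite h adde0 unif_itv // F01.
- exact: measurableI.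
- exact: measurableI.
- by apply/seteqP; split => p //= -[[? _] [? _]].
Unshelve. all: by end_near. Qed.
End quantile.

Section helly.
Context (R : realType).
Local Notation unif := (uniform_prob (@ltr01 R)).

(* Quantile functions are monotone; a diagonal subsequence (taken along an ultrafilter)
   converges at rational points, hence off the countably many jumps of the limit. *)
Lemma helly_quantiles d (T : measurableType d) (nu : nat -> probability T R) (V : T -> R) (C : R) :
  measurable_fun setT V -> (forall w, 0 <= V w) -> 0 <= C ->
  (forall n, (\int[nu n]_w (V w)%:E <= C%:E)%E) ->
  exists (phi : nat -> nat) (Q_ : nat -> R -> R) (Q : R -> R),
   [/\ forall n, (n <= phi n)%N,
       (forall n, measurable_fun setT (Q_ n)) /\ measurable_fun setT Q,
       (forall n p, 0 <= Q_ n p) /\ (forall p, 0 <= Q p),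
       forall n (B : set R), measurable B -> unif (Q_ n @^-1` B) = nu (phi n) (V @^-1` B)
     & {ae unif, forall p, Q_ n p @[n --> \oo] --> Q p}].
Proof.
move=> mV V0 C0 VC.
have [q qP] := choice (fun n => quantile_exists (nu n) mV V0).
have mq n : measurable_fun setT (q n) by have [] := qP n.
have q0 n p : 0 <= q n p by have [] := qP n.
have ndq n p p' : 0 < p -> p <= p' -> p' < 1 -> q n p <= q n p' by have [_ _ + _ _] := qP n; exact.
have qlaw n (B : set R) : measurable B -> unif (q n @^-1` B) = nu n (V @^-1` B).
  by have [_ _ _ + _] := qP n; exact.
(* Tightness by Markov's inequality: the mass beyond [(C + 1) / (1 - p)] is at most [1 - p]. Adding
   1 to [C] keeps the threshold positive when [C = 0]. *)
have qC n p : 0 < p < 1 -> q n p <= (C + 1) / (1 - p).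
  move=> /[dup] p01 /andP[p0 p1]; have [_ _ _ _ /(_ p _ p01)] := qP n; apply.
  set x := (C + 1) / (1 - p).
  have x0 : 0 < x by rewrite divr_gt0 ?subr_gt0 //; lra.
  have mA : measurable [set w | V w <= x].
    rewrite (_ : [set w | V w <= x] = setT `&` V @^-1` `]-oo, x]).
      exact: (mV measurableT _ (measurable_itv `]-oo, x])).
    by rewrite setTI; apply/seteqP; split=> w /=; rewrite in_itv.
  have mi : measurable_fun setT (fun w => (\1_(~` [set w | V w <= x]) w)%:E : \bar R).
    by apply/measurable_EFinP; apply: measurable_indic; exact: measurableC.
  have markov : (x%:E * nu n (~` [set w | (V w <= x)%R]) <= C%:E)%E.
    apply: le_trans (VC n).
    rewrite -[X in (_ * nu n X)%E]setIT -integral_indic //; last exact: measurableC.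
    rewrite -ge0_integralZl_EFin //; last by exact: ltW.
    apply: ge0_le_integral => //.
    - by move=> w _; rewrite -EFinM lee_fin mulr_ge0 // ltW.
    - exact: emeasurable_funM.
    - exact/measurable_EFinP.
    - move=> w _; rewrite -EFinM lee_fin indicE; have [/set_mem /= h|_] := boolP (w \in _).
        by rewrite mulr1; move/negP: h; rewrite -ltNge => /ltW.
      by rewrite mulr0.
  move: markov; rewrite probability_setC //.
  have /fineK <- : nu n [set w | V w <= x] \is a fin_num by rewrite fin_num_measure.
  set y := fine _; rewrite -EFinB -EFinM !lee_fin => h.
  have : 1 - y <= 1 - p; last by lra.
  rewrite -(ler_pM2l x0); apply: (le_trans h).
  by rewrite /x divfK ?gt_eqF ?subr_gt0 //; lra.
(* Along an ultrafilter finer than [\oo] every bounded sequence converges, so the limit [L] exists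
   at all points of []0, 1[] at once. *)
have [U [UU oU]] := @ultraFilterLemma nat \oo _.
have PU : ProperFilter U by exact: ultra_proper.
pose E p := [set x | U [set n | q n p <= x]].
pose L p := inf (E p).
have Elb p : lbound (E p) 0.
  move=> x /= /filter_ex [n /= h]; exact: le_trans (q0 n p) h.
have E0 p : 0 < p < 1 -> E p !=set0.
  move=> p01; exists ((C + 1) / (1 - p)); rewrite /E /=.
  apply: filterS (filterT) => n _; exact: qC.
have L0 p : 0 < p < 1 -> 0 <= L p by move=> /E0 h; exact: lb_le_inf (Elb p).
have LC p : 0 < p < 1 -> L p <= (C + 1) / (1 - p).
  move=> p01; apply: ge_inf; first by exists 0; exact: Elb.
  by rewrite /E /=; apply: filterS (filterT) => n _; exact: qC.
have LU p e : 0 < p < 1 -> 0 < e -> U [set n | `|q n p - L p| <= e].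
  move=> p01 e0.
  have hi : has_inf (E p) by split; [exact: E0|exists 0; exact: Elb].
  have [x /= Ux xL] := inf_adherent e0 hi.
  have Ul : U [set n | L p - e <= q n p].
    have [//|Uc] := in_ultra_setVsetC [set n | L p - e <= q n p] UU.
    have : L p <= L p - e; last by move=> ?; lra.
    apply: ge_inf; first by exists 0; exact: Elb.
    apply: filterS Uc => n /= /negP; rewrite -ltNge; exact: ltW.
  apply: filterS (filterI Ux Ul) => n /= [h1 h2].
  by rewrite ler_norml; apply/andP; split; [lra|rewrite /L in xL *; lra].
have ndL p p' : 0 < p -> p <= p' -> p' < 1 -> L p <= L p'.
  move=> p0 pp' p'1; apply: lb_le_inf; first by apply: E0; rewrite (lt_le_trans p0).
  move=> x /= Ux; apply: ge_inf; first by exists 0; exact: Elb.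
  by apply: filterS Ux => n /=; apply: le_trans; exact: ndq.
(* An enumeration of the rationals; the default 0 is harmless, as only values in []0, 1[] are
   tested. *)
pose r i : R := ratr (odflt (0 : rat) (choice.unpickle i)).
(* Diagonal extraction: a finite intersection of members of [U] gives one index past [j] that serves
   the codes up to [j] simultaneously, with error [1 / (j + 1)]. *)
have A_ j : exists n, (j <= n)%N /\ forall i, (i <= j)%N -> 0 < r i < 1 ->
    `|q n (r i) - L (r i)| <= j.+1%:R^-1.
  suff : forall m, U [set n | (j <= n)%N /\ forall i, (i <= m)%N -> 0 < r i < 1 ->
      `|q n (r i) - L (r i)| <= j.+1%:R^-1] by move=> /(_ j)/filter_ex.
  have jU : U [set n | (j <= n)%N] by apply: oU; exists j.
  have j0 : 0 < j.+1%:R^-1 :> R by rewrite invr_gt0.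
  have hU i : U [set n | 0 < r i < 1 -> `|q n (r i) - L (r i)| <= j.+1%:R^-1].
    have [ri|ri] := boolP (0 < r i < 1).
      by apply: filterS (LU _ _ ri j0) => n /= + _.
    by apply: filterS (filterT) => n _ //=.
  elim => [|m IH].
    by apply: filterS (filterI jU (hU 0%N)) => n /= [jn h]; split => // i; rewrite leqn0 => /eqP ->.
  apply: filterS (filterI IH (hU m.+1)) => n /= [[jn h] h']; split => // i.
  by rewrite leq_eqVlt => /predU1P[->//|]; rewrite ltnS; exact: h.
have [phi phiP] := choice A_.
pose Q_ j := q (phi j).
have rat_cvg (s : rat) : 0 < (ratr s : R) < 1 -> Q_ j (ratr s) @[j --> \oo] --> L (ratr s).
  move=> s01; apply/cvgrPdist_le => e e0.
  near=> j.
  have [_ /(_ (choice.pickle s))] := phiP j; rewrite /r choice.pickleK /= => h.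
  rewrite distrC (le_trans (h _ s01)) //; first by near: j; exact: nbhs_infty_ge.
  rewrite invf_ple ?posrE // ltW //.
  near: j; exists (Num.truncn e^-1).+1 => // m /= hm.
  by rewrite (lt_trans (truncnS_gt _)) // ltr_nat ltnS.
(* The candidate limit is rebuilt from the left out of rational points, where convergence of the
   subsequence is known. *)
pose below p := [set L (ratr s) | s in [set s : rat | 0 < (ratr s : R) < p]].
pose Q p := if 0 < p < 1 then sup (below p) else 0.
have below_ub p : 0 < p < 1 -> ubound (below p) (L p).
  move=> /andP[p0 p1] x [s /= /andP[s0 sp] <-]; apply: ndL => //; exact: ltW.
have below0 p : 0 < p < 1 -> below p !=set0.
  move=> /andP[p0 p1]; have [s] := rat_in_itvoo p0; rewrite in_itv /= => s0p.
  by exists (L (ratr s)); exists s.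
have Q0 p : 0 <= Q p.
  rewrite /Q; case: ifP => // p01; have [x bx] := below0 _ p01.
  have [s /= /andP[s0 sp] xE] := bx.
  apply: (@le_trans _ _ x); last by apply: ub_le_sup => //; exists (L p); exact: below_ub.
  rewrite -xE L0 // s0 (lt_trans sp) //; by case/andP: p01.
have ndQ p p' : 0 < p -> p <= p' -> p' < 1 -> Q p <= Q p'.
  move=> p0 pp' p'1.
  have p01 : 0 < p < 1 by rewrite p0 (le_lt_trans pp').
  have p01' : 0 < p' < 1 by rewrite p'1 (lt_le_trans p0).
  rewrite /Q p01 p01'; apply: ge_sup; first exact: below0.
  move=> x [s /= /andP[s0 sp] <-]; apply: ub_le_sup; first by exists (L p'); exact: below_ub.
  by exists s => //=; rewrite s0 (lt_le_trans sp).
(* At a point of [D] a rational strictly separates the values of [L] on the two sides. By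
   monotonicity distinct points need distinct rationals, so [D] is countable; off [D] rational
   points on both sides pin the limit down. *)
pose D := [set p : R | 0 < p < 1 /\ exists s : rat,
   (forall t : rat, 0 < (ratr t : R) < p -> L (ratr t) < ratr s) /\
   (forall t : rat, p < (ratr t : R) < 1 -> ratr s < L (ratr t))].
have cD : countable D.
  pose sep p (c : rat) := D p ->
     (forall t : rat, 0 < (ratr t : R) < p -> L (ratr t) < ratr c) /\
     (forall t : rat, p < (ratr t : R) < 1 -> ratr c < L (ratr t)).
  have sep_ex p : exists c, sep p c.
    by have [[p01 [s sP]]|nD] := pselect (D p); [exists s|exists 0].
  have [c cP] := choice sep_ex.
  apply/countable_injP; exists (fun p => choice.pickle (c p)).
  have lt_inj p p' : D p -> D p' -> p < p' -> c p <> c p'.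
    move=> Dp Dp' pp' cc.
    have [s] := rat_in_itvoo pp'; rewrite in_itv /= => /andP[ps sp'].
    have [[/andP[p0 p1] _] [/andP[p'0 p'1] _]] := (Dp, Dp').
    have [_ /(_ s)] := cP _ Dp; rewrite ps (lt_trans sp' p'1) => /(_ isT) h1.
    have [/(_ s) + _] := cP _ Dp'; rewrite sp' (lt_trans p0 ps) => /(_ isT) h2.
    by have := lt_trans h1 h2; rewrite cc ltxx.
  move=> p p' /set_mem Dp /set_mem Dp' /(pcan_inj choice.pickleK) cc.
  have [pp'|pp'|//] := ltgtP p p'; first by have := lt_inj _ _ Dp Dp' pp' cc.
  by have := lt_inj _ _ Dp' Dp pp' (esym cc).
exists phi, Q_, Q; split.
- by move=> j; have [] := phiP j.
- split=> [n|]; first exact: mq.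
  by apply: nondecreasing01_measurable => // p p01; rewrite /Q (negbTE p01).
- by split => [n p|//]; exact: q0.
- by move=> n B mB; exact: qlaw.
apply: negligibleS (unif_null cD) => p /= ncvg.
apply: contrapT => /not_orP [nD] /contrapT; rewrite /= in_itv /= => p01.
apply: ncvg; have /andP[p0 p1] := p01.
have QE : Q p = sup (below p) by rewrite /Q p01.
have hs : has_sup (below p) by split; [exact: below0|exists (L p); exact: below_ub].
apply/cvgrPdist_le => e e0.
have [x [s /= /andP[s0 sp] <-] hsx] := sup_adherent e0 hs.
have [t [/andP[pt t1] tQ]] : exists t : rat, p < (ratr t : R) < 1 /\ L (ratr t) <= Q p + e / 2.
  apply: contrapT => /forallNP h; apply: nD; split => //.
  have /rat_in_itvoo[c] : Q p < Q p + e / 2 by rewrite ltrDl divr_gt0.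
  rewrite in_itv /= => /andP[Qc cQ]; exists c; split => t t01.
    apply: le_lt_trans Qc; rewrite QE; apply: ub_le_sup; first by exists (L p); exact: below_ub.
    by exists t.
  rewrite (lt_trans cQ) // ltNge; apply/negP => tQ; exact: (h t).
have s01 : 0 < (ratr s : R) < 1 by rewrite s0 (lt_trans sp).
have t01 : 0 < (ratr t : R) < 1 by rewrite t1 (lt_trans p0).
have e20 : 0 < e / 2 by rewrite divr_gt0.
have gap : 0 < L (ratr s) - (Q p - e) by rewrite subr_gt0 QE.
have /cvgrPdist_lt/(_ _ gap) cs := rat_cvg _ s01.
have /cvgrPdist_lt/(_ _ e20) ct := rat_cvg _ t01.
near=> j.
have hs' : `|L (ratr s) - Q_ j (ratr s)| < L (ratr s) - (Q p - e) by near: j.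
have ht' : `|L (ratr t) - Q_ j (ratr t)| < e / 2 by near: j.
have h1 : Q_ j (ratr s) <= Q_ j p by apply: ndq => //; exact: ltW.
have h2 : Q_ j p <= Q_ j (ratr t) by apply: ndq => //; exact: ltW.
move: hs' ht'; rewrite !ltr_norml => /andP[a1 a2] /andP[b1 b2].
by rewrite ler_norml; apply/andP; split; lra.
Unshelve. all: by end_near. Qed.
End helly.

(** * Moments of the exponential functional *)

Lemma cvgn_sum (R : realType) (I : Type) (s : seq I) (f : I -> nat -> R) (l : I -> R) :
  (forall i, f i n @[n --> \oo] --> l i) ->
  \sum_(i <- s) f i n @[n --> \oo] --> \sum_(i <- s) l i.
Proof.
move=> fl; elim: s => [|i s IH].
  by under eq_fun do rewrite big_nil; rewrite big_nil; exact: cvg_cst.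
by under eq_fun do rewrite big_cons; rewrite big_cons; exact: cvgD.
Qed.

Lemma Rintegral_sum d (T : measurableType d) (R : realType) (mu : {measure set T -> \bar R})
  (D : set T) (I : Type) (s : seq I) (f : I -> T -> R) : measurable D ->
  (forall i, mu.-integrable D (EFin \o f i)) ->
  mu.-integrable D (EFin \o (fun x => \sum_(i <- s) f i x)) /\
  \int[mu]_(x in D) (\sum_(i <- s) f i x) = \sum_(i <- s) \int[mu]_(x in D) f i x.
Proof.
move=> mD fi; elim: s => [|i s [IH1 IH2]].
  split; first by under eq_fun do rewrite /= big_nil; exact: integrable0.
  by under eq_Rintegral do rewrite big_nil; rewrite big_nil /Rintegral integral0.
split.
  rewrite (_ : EFin \o _ = ((EFin \o f i) \+ (EFin \o (fun x => (\sum_(i <- s) f i x)%R)))%E).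
    exact: integrableD.
  by apply/funext => x /=; rewrite big_cons EFinD.
under eq_Rintegral do rewrite big_cons.
by rewrite RintegralD // big_cons IH2.
Qed.

Section beta.
Context (R : realType).
Variable phi : nat -> R.
Hypothesis phi0 : forall m, 0 < phi m.+1.

(* The m-th moment of the n-step Riemann sum of mesh h of the exponential functional. *)
Fixpoint beta (h : R) n m : R :=
  if n is n'.+1 then
    if m == 0%N then 1
    else expR (- (h * phi m)) * \sum_(k < m.+1) 'C(m, k)%:R * h ^+ (m - k) * beta h n' k
  else (m == 0%N)%:R.

Lemma beta0 h n : beta h n 0 = 1. Proof. by case: n. Qed.

Lemma beta_ge0 h n m : 0 <= h -> 0 <= beta h n m.
Proof.
move=> h0; elim: n m => [|n IH] m /=; first by case: (m == 0%N).
case: ifP => // _; rewrite mulr_ge0 ?expR_ge0 // sumr_ge0 // => k _.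
by rewrite !mulr_ge0 // exprn_ge0.
Qed.

Lemma le_betaS h n m : 0 <= h -> beta h n m <= beta h n.+1 m.
Proof.
move=> h0; elim: n m => [|n IH] m.
  case: m => [|m]; first by rewrite !beta0.
  by rewrite [beta h 0 _]/= beta_ge0.
case: m => [|m]; first by rewrite !beta0.
rewrite [leLHS]/= [leRHS]/= ler_wpM2l ?expR_ge0 // ler_sum // => k _.
by rewrite ler_wpM2l ?IH // mulr_ge0 // exprn_ge0.
Qed.

Let rho h m : R := expR (- (h * phi m)).

Lemma betaS h n m : beta h n.+1 m.+1 = rho h m.+1 *
  (\sum_(k < m.+1) 'C(m.+1, k)%:R * h ^+ (m.+1 - k) * beta h n k + beta h n m.+1).
Proof. by rewrite [LHS]/= big_ord_recr /= binn subnn expr0 !mul1r. Qed.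

Lemma rho_lt1 h m : 0 < h -> rho h m.+1 < 1.
Proof. by move=> h0; rewrite /rho -expR0 ltr_expR oppr_lt0 mulr_gt0. Qed.

(** Monotone in [n] and bounded: [beta h n m <= beta h n.+1 m] and the recursion give
    [b <= rho * (A + b)] with [rho < 1], hence [b <= rho * A / (1 - rho)], where [A] only involves
    lower moments. *)
Lemma beta_cvg h : 0 < h -> exists l : nat -> R,
  [/\ forall m, beta h n m @[n --> \oo] --> l m, l 0%N = 1 &
      forall m, l m.+1 = rho h m.+1 *
        (\sum_(k < m.+1) 'C(m.+1, k)%:R * h ^+ (m.+1 - k) * l k + l m.+1)].
Proof.
move=> h0; have h0' := ltW h0.
have ndb m : nondecreasing_seq (fun n => beta h n m).
  by apply/nondecreasing_seqP => n; exact: le_betaS.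
have bnd m : exists M, forall n, beta h n m <= M.
  elim/ltn_ind: m => m IH; case: m IH => [|m] IH; first by exists 1 => n; rewrite beta0.
  have [M MP] : exists M : nat -> R, forall k, (k < m.+1)%N -> forall n, beta h n k <= M k.
    pose b k M := (k < m.+1)%N -> forall n, beta h n k <= M.
    suff /choice[M MP] : forall k, exists M, b k M by exists M.
    move=> k; have [km|km] := boolP (k < m.+1)%N; last by exists 0 => /(negP km).
    by have [M HM] := IH k km; exists M.
  pose A := \sum_(k < m.+1) 'C(m.+1, k)%:R * h ^+ (m.+1 - k) * M k.
  exists (rho h m.+1 * A / (1 - rho h m.+1)) => n.
  rewrite ler_pdivlMr ?subr_gt0 ?rho_lt1 // mulrBr mulr1 lerBlDr.
  apply: (le_trans (le_betaS _ _ h0')); rewrite betaS mulrDr lerD //; last by rewrite mulrC.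
  rewrite ler_wpM2l ?expR_ge0 // ler_sum // => k _.
  by rewrite ler_wpM2l ?MP // mulr_ge0 // exprn_ge0.
have cb m : cvgn (fun n => beta h n m).
  by have [M MP] := bnd m; apply: nondecreasing_is_cvgn => //; exists M => _ [n _ <-].
exists (fun m => limn (fun n => beta h n m)); split => [m||m].
- exact: cb.
- by under eq_fun do rewrite beta0; exact: lim_cst.
apply/cvg_lim => //; rewrite -cvg_shiftS.
under eq_fun do rewrite betaS.
apply: cvgM; first exact: cvg_cst.
apply: cvgD; last exact: cb.
apply: cvgn_sum => k.
by apply: cvgM; [exact: cvg_cst|exact: cb].
Qed.

Definition exp_moment m : R := \prod_(j < m) (j.+1%:R / phi j.+1).

(** With [c = phi m.+1], the inequalities [1 - h * c <= rho] and [(1 + h * c) * rho <= 1] squeeze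
    the ratio between [rho / c] and [1 / c]. *)
Lemma rho_ratio_cvg m : (fun p : nat => 2 ^- p * rho (2 ^- p) m.+1 / (1 - rho (2 ^- p) m.+1))
  @ \oo --> (phi m.+1)^-1.
Proof.
have c0 := phi0 m; set c := phi m.+1 in c0 *.
have pow0 : (fun p : nat => 2 ^- p : R) @ \oo --> 0.
  under eq_fun do rewrite -exprVn.
  by apply: cvg_expr; rewrite ger0_norm; lra.
have rho1 : (fun p : nat => rho (2 ^- p) m.+1 / c) @ \oo --> c^-1.
  rewrite -[X in _ --> X]mul1r; apply: cvgM; last exact: cvg_cst.
  have {2}-> : 1 = expR (- (0 * c)) by rewrite mul0r oppr0 expR0.
  apply: (@continuous_cvg _ _ _ _ _ _ expR); first exact: continuous_expR.
  by apply: cvgN; apply: cvgM => //; exact: cvg_cst.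
apply: (squeeze_cvgr _ rho1 (cvg_cst c^-1)); apply: nearW => p.
have hp0 : 0 < 2 ^- p :> R by rewrite invr_gt0 exprn_gt0.
have := rho_lt1 m hp0; move: (2 ^- p) hp0 => h hp0.
rewrite /rho -/c => r1.
have r0 : 0 < expR (- (h * c)) by exact: expR_gt0.
have h1 := expR_ge1Dx (- (h * c)); have h2 := expR_ge1Dx (h * c).
have e12 : expR (h * c) * expR (- (h * c)) = 1 by rewrite -expRD subrr expR0.
have h3 : (1 + h * c) * expR (- (h * c)) <= 1 by rewrite -[leRHS]e12 ler_wpM2r // ltW.
move: (expR (- _)) r0 r1 h1 h3 => r r0 r1 h1 h3.
have hc0 : 0 < h * c by rewrite mulr_gt0.
have r1' : 0 < 1 - r by rewrite subr_gt0.
apply/andP; split.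
  rewrite ler_pdivrMr // mulrAC ler_pdivlMr // mulrAC -mulrA [leRHS]mulrC.
  have -> : c * r * h = r * (h * c) by ring.
  by rewrite ler_wpM2l ?(ltW r0) //; lra.
rewrite ler_pdivrMr // ler_pdivlMl //.
have -> : c * (h * r) = h * c * r by ring.
by move: h3; rewrite mulrDl mul1r; lra.
Qed.

(** The fixed-point equation of [beta_cvg] is linear in the moment of order [m.+1]. Divided by
    [1 - rho], which is of order [h], it keeps only the term [k = m] in the limit; the terms with
    [k < m] carry a further power of [h]. What remains is the recursion of [exp_moment]. *)
Lemma beta_limits : exists l : nat -> nat -> R,
  [/\ forall p m, beta (2 ^- p) n m @[n --> \oo] --> l p m,
      forall p n m, beta (2 ^- p) n m <= l p m &
      forall m, l p m @[p --> \oo] --> exp_moment m].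
Proof.
have h0 p : 0 < 2 ^- p :> R by rewrite invr_gt0 exprn_gt0.
have [l lP] := choice (fun p => beta_cvg (h0 p)).
exists l; split => [p m|p n m|m].
- by have [] := lP p.
- have [cl _ _] := lP p; rewrite -(cvg_lim _ (cl m)) //.
  apply: (nondecreasing_cvgn_le (u_ := fun n => beta (2 ^- p) n m)).
    by apply/nondecreasing_seqP => k; apply: le_betaS; exact: ltW.
  by apply/cvg_ex; exists (l p m).
have pow0 k : (fun p : nat => (2 ^- p) ^+ k.+1 : R) @ \oo --> 0.
  have -> : (fun p : nat => (2 ^- p) ^+ k.+1 : R) = (fun p : nat => ((2^-1) ^+ k.+1) ^+ p).
    by apply/funext => p; rewrite -exprVn exprAC.
  by apply: cvg_expr; rewrite ger0_norm ?exprn_ge0 // exprn_ilt1 //; lra.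
elim/ltn_ind: m => -[|m] IH.
  rewrite /exp_moment big_ord0; apply: cvg_near_cst; apply: nearW => p.
  by have [_ -> _] := lP p.
have -> : (fun p => l p m.+1) = (fun p => (2 ^- p * rho (2 ^- p) m.+1 / (1 - rho (2 ^- p) m.+1)) *
    (m.+1%:R * l p m + \sum_(k < m) 'C(m.+1, k)%:R * (2 ^- p) ^+ (m - k) * l p k)).
  apply/funext => p; have [_ _ /(_ m)] := lP p.
  have := rho_lt1 m (h0 p); have hp0 := h0 p; move: (2 ^- p) hp0 => h hp0 r1.
  rewrite big_ord_recr /= subSnn expr1 binSn => lE.
  have SE : \sum_(k < m) 'C(m.+1, k)%:R * h ^+ (m.+1 - k) * l p k =
     h * \sum_(k < m) 'C(m.+1, k)%:R * h ^+ (m - k) * l p k.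
    rewrite mulr_sumr; apply: eq_bigr => k _.
    by rewrite subSn ?(ltnW (ltn_ord k)) // exprS; ring.
  rewrite SE in lE; move: lE; set S := \sum_(k < m) _ => lE.
  have e : l p m.+1 * (1 - rho h m.+1) = h * rho h m.+1 * (m.+1%:R * l p m + S).
    by rewrite mulrBr mulr1 {1}lE; ring.
  by rewrite mulrAC -e mulfK // gt_eqF // subr_gt0.
rewrite /exp_moment big_ord_recr /= -/(exp_moment m).
have -> : exp_moment m * (m.+1%:R / phi m.+1) = (phi m.+1)^-1 * (m.+1%:R * exp_moment m + 0) by ring.
apply: cvgM; first exact: rho_ratio_cvg.
apply: cvgD.
  by apply: cvgM; [exact: cvg_cst|exact: IH].
have {2}-> : 0 = \sum_(k < m) 'C(m.+1, k)%:R * 0 * exp_moment k :> R.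
  by rewrite big1 // => k _; rewrite mulr0 mul0r.
apply: cvgn_sum => k.
apply: cvgM; last by apply: IH; rewrite ltnS ltnW.
apply: cvgM; first exact: cvg_cst.
have -> : (m - k)%N = (m - k).-1.+1 by rewrite prednK // subn_gt0.
exact: pow0.
Qed.
End beta.

Lemma measurable_expRN (R : realType) (a : R) : measurable_fun setT (fun x : R => expR (- (a * x))).
Proof.
by do 2 apply: measurableT_comp => //.
Qed.

Lemma fatou_le d (T : measurableType d) (R : realType) (mu : {measure set T -> \bar R})
    (u : nat -> T -> \bar R) (f : T -> \bar R) (c : nat -> R) (l : R) :
  (forall n, measurable_fun setT (u n)) -> measurable_fun setT f ->
  (forall n w, 0 <= u n w)%E -> (forall w, 0 <= f w)%E ->
  {ae mu, forall w, u n w @[n --> \oo] --> f w} ->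
  (forall n, \int[mu]_w u n w <= (c n)%:E)%E -> c n @[n --> \oo] --> l ->
  (\int[mu]_w f w <= l%:E)%E.
Proof.
move=> mu_ mf u0 f0 uf uc cl.
have -> : (\int[mu]_w f w = \int[mu]_w limn_einf (u ^~ w))%E.
  apply: ge0_ae_eq_integral => //.
  - rewrite (_ : (fun w => _) = (fun w => - limn_esup (fun n => - u n w))%E) //.
    apply: measurableT_comp => //; apply: measurable_fun_limn_esup => n.
    exact: measurableT_comp.
  - by move=> w _; rewrite limn_einf_lim lime_ge //; [exact: is_cvg_einfs|
      apply: nearW => n; apply: le_ereal_inf_tmp => _ [m _ <-]].
  - by apply: filterS uf => w uw _; rewrite (cvg_limn_einf_sup uw).1.
apply: le_trans (fatou _ _ _ _) _ => //.
have <- : limn (fun n => (c n)%:E) = l%:E by apply/cvg_lim => //; apply: cvg_EFin => //; exact: nearW.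
rewrite limn_einf_lim; apply: lee_lim; first exact: is_cvg_einfs.
  by apply/cvg_ex; exists l%:E; apply: cvg_EFin => //; exact: nearW.
apply: nearW => n; apply: le_trans (uc n).
by apply: ereal_inf_lbound; exists n => //=.
Qed.

Lemma cvg_exprn (R : realType) (u : nat -> R) (l : R) m :
  u n @[n --> \oo] --> l -> u n ^+ m @[n --> \oo] --> l ^+ m.
Proof.
move=> ul; elim: m => [|m IH]; first exact: cvg_cst.
by rewrite exprS; under eq_cvg do rewrite exprS; exact: cvgM.
Qed.

(** * Riemann sums of the killed path *)

Section exponential_functional.
Context (R : realType) (d : measure_display) (Omega : measurableType d)
  (P : probability Omega R) (X : R -> Omega -> R) (zeta : Omega -> \bar R) (q : R) (Phi : R -> R).
Hypothesis sX : subordinator P X.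
Hypothesis kX : killing_time P X zeta q.
Hypothesis LX : forall l s, 0 <= l -> 0 < s ->
  (\int[P]_w expeR (- (s%:E * killed X zeta l w)) = (expR (- (l * Phi s)))%:E)%E.

Let mX t : measurable_fun setT (X t). Proof. by have [[]] := sX. Qed.
Let X0 w : X 0 w = 0. Proof. by have [[]] := sX. Qed.
Let ndX w s t : 0 <= s -> s <= t -> X s w <= X t w.
Proof. by have [_ + _ _ _] := sX; apply. Qed.
Let rcX w t : 0 <= t -> X s w @[s --> at_right t] --> X t w.
Proof. by have [_ _ + _ _] := sX; apply. Qed.
Let iX (n : nat) (t : nat -> R) : 0 <= t 0%N -> (forall i, t i <= t i.+1) ->
  indep_RVs P (fun (i : 'I_n) w => X (t i.+1) w - X (t i) w).
Proof. by have [_ _ _ + _] := sX; apply. Qed.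
Let stX s t (B : set R) : 0 <= s -> 0 <= t -> measurable B ->
  P ((fun w => X (t + s) w - X t w) @^-1` B) = P (X s @^-1` B).
Proof. by have [_ _ _ _] := sX; apply. Qed.
Let mz : measurable_fun setT zeta. Proof. by have [] := kX. Qed.
Let zE t : 0 <= t -> P [set w | (t%:E < zeta w)%E] = (expR (- (q * t)))%:E.
Proof. by have [_ _ + _] := kX; apply. Qed.
Let zX (n : nat) (t : 'I_n -> R) (B : 'I_n -> set R) (C : set (\bar R)) :
  (forall i, 0 <= t i) -> measurable C -> (forall i, measurable (B i)) ->
  P (zeta @^-1` C `&` \bigcap_(i in [set: 'I_n]) (X (t i) @^-1` B i)) =
  (P (zeta @^-1` C) * P (\bigcap_(i in [set: 'I_n]) (X (t i) @^-1` B i)))%E.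
Proof. by have [_ _ _ +] := kX; apply. Qed.

Let X_ge0 w t : 0 <= t -> 0 <= X t w.
Proof. by move=> t0; rewrite -(X0 w) ndX. Qed.

(** Killing sends the path to [+oo], where the exponential vanishes, so it acts on [exp (- xi_t)] as
    a factor 0 or 1. *)
Definition alive t w : R := if (t%:E < zeta w)%E then 1 else 0.

(* This is exp (- xi_t). *)
Definition exp_killed t w : R := alive t w * expR (- X t w).
Local Notation G := exp_killed.

Lemma mset_alive t : measurable [set w | (t%:E < zeta w)%E].
Proof.
rewrite (_ : [set w | _] = setT `&` zeta @^-1` `]t%:E, +oo[%classic).
  by apply: mz => //; exact: emeasurable_itv.
by rewrite setTI; apply/seteqP; split=> w /=; rewrite in_itv /= andbT.
Qed.

Lemma aliveE t : alive t = \1_[set w | (t%:E < zeta w)%E] :> (_ -> R).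
Proof.
apply/funext => w; rewrite /alive indicE; case: ifPn => h; first by rewrite mem_set.
by rewrite memNset //; apply/negP.
Qed.

Lemma measurable_alive t : measurable_fun setT (alive t).
Proof. by rewrite aliveE; apply: measurable_indic; exact: mset_alive. Qed.

Lemma measurable_expX (a t : R) : measurable_fun setT (fun w => expR (- (a * X t w))).
Proof. by do 2 apply: measurableT_comp => //; exact: measurable_funM. Qed.

Lemma measurable_exp_killed t : measurable_fun setT (G t).
Proof.
apply: measurable_funM; first exact: measurable_alive.
by do 2 apply: measurableT_comp => //.
Qed.

Lemma alive01 t w : 0 <= alive t w <= 1.
Proof. by rewrite /alive; case: ifP; rewrite ?lexx ?ler01. Qed.

Lemma exp_killed_ge0 t w : 0 <= G t w.
Proof. by rewrite mulr_ge0 ?expR_ge0 //; have /andP[] := alive01 t w. Qed.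

Lemma exp_killed_le1 t w : 0 <= t -> G t w <= 1.
Proof.
move=> t0; rewrite /G mulr_ile1 ?expR_ge0 //; try by have /andP[] := alive01 t w.
by rewrite -expR0 ler_expR oppr_le0 X_ge0.
Qed.

Lemma expeR_killed t w : expeR (- killed X zeta t w) = (G t w)%:E.
Proof. by rewrite /killed /G /alive; case: ifP => _ /=; rewrite ?mul1r ?mul0r. Qed.

Lemma alive_nonincreasing s t w : s <= t -> alive t w <= alive s w.
Proof.
move=> st; rewrite /alive; case: ifP => [tz|_]; last by case: ifP.
by rewrite (le_lt_trans _ tz) // lee_fin.
Qed.

Lemma exp_killed_nonincreasing s t w : 0 <= s -> s <= t -> G t w <= G s w.
Proof.
move=> s0 st; rewrite /G ler_pM ?expR_ge0 ?alive_nonincreasing //; first by have /andP[] := alive01 t w.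
by rewrite ler_expR lerN2 ndX.
Qed.

Section moments_on_grid.
Variable h : R.
Hypothesis h0 : 0 < h.
Let psi (a : nat) : R := \int[P]_w expR (- (a%:R * X h w)).

Let psiE a : (\int[P]_w (expR (- (a%:R * X h w)))%:E = (psi a)%:E)%E.
Proof.
rewrite /psi /Rintegral fineK //; apply: integrable_fin_num => //.
apply: (@bounded_integrable _ _ _ _ _ 1); first exact: measurable_expX.
move=> w; rewrite ger0_norm ?expR_ge0 // -expR0 ler_expR oppr_le0 mulr_ge0 //.
exact: X_ge0 (ltW h0).
Qed.

Let step_law (a l : nat) :
  (\int[P]_w (expR (- (a%:R * (X (l.+1%:R * h) w - X (l%:R * h) w))))%:E = (psi a)%:E)%E.
Proof.
pose D w := X (l.+1%:R * h) w - X (l%:R * h) w.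
have mD : measurable_fun setT D by exact: measurable_funB.
pose f x : \bar R := (expR (- (a%:R * x)))%:E.
have mf : measurable_fun setT f.
  by apply/measurable_EFinP; exact: measurable_expRN.
pose D' : {mfun Omega >-> R} := mfun_Sub (mem_set mD).
pose Xh : {mfun Omega >-> R} := mfun_Sub (mem_set (mX h)).
rewrite -psiE.
have f0 x : (0 <= f x)%E by rewrite lee_fin expR_ge0.
transitivity (\int[pushforward P D']_x f x)%E; first by rewrite ge0_integral_pushforward.
transitivity (\int[pushforward P Xh]_x f x)%E; last by rewrite ge0_integral_pushforward.
apply: eq_measure_integral => B mB _.
have lh0 : 0 <= l%:R * h by rewrite mulr_ge0 // ltW.
transitivity (P (X h @^-1` B)) => //; rewrite -(stX (ltW h0) lh0 mB).
rewrite /pushforward; congr (P _); rewrite /D' /D /=.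
by have -> : l.+1%:R * h = l%:R * h + h by rewrite -natr1; ring.
Qed.

(** Summation by parts: the increments over the grid are independent, the values are not. *)
Let sum_incr n (a : nat -> nat) w :
  \sum_(j < n.+1) (a j)%:R * X (j%:R * h) w =
  \sum_(l < n) (\sum_(l.+1 <= j < n.+1) a j)%:R * (X (l.+1%:R * h) w - X (l%:R * h) w).
Proof.
elim: n => [|n IH]; first by rewrite big_ord_recl !big_ord0 mul0r X0 mulr0 addr0.
rewrite big_ord_recr /= IH [RHS]big_ord_recr /= big_nat1.
have -> : \sum_(l < n) (\sum_(l.+1 <= j < n.+2) a j)%:R * (X (l.+1%:R * h) w - X (l%:R * h) w) =
  \sum_(l < n) (\sum_(l.+1 <= j < n.+1) a j)%:R * (X (l.+1%:R * h) w - X (l%:R * h) w) +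
  (a n.+1)%:R * \sum_(l < n) (X (l.+1%:R * h) w - X (l%:R * h) w).
  rewrite mulr_sumr -big_split /=; apply: eq_bigr => l _.
  by rewrite big_nat_recr /= ?ltnS ?(ltnW (ltn_ord l)) // natrD mulrDl.
rewrite -(big_mkord xpredT (fun l => X (l.+1%:R * h) w - X (l%:R * h) w)) telescope_sumr //.
by rewrite mul0r X0 subr0; ring.
Qed.

(** [0 < a n] makes the product vanish unless the path is alive at the last grid time, so killing
    reduces to the single event [n h < zeta], which is independent of [X]. *)
Let expectation_grid n (a : nat -> nat) : (0 < a n)%N ->
  (\int[P]_w (\prod_(j < n.+1) G (j%:R * h) w ^+ a j)%:E =
  (expR (- (q * (n%:R * h))) * \prod_(l < n) psi (\sum_(l.+1 <= j < n.+1) a j))%:E)%E.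
Proof.
move=> an.
have nh0 (j : nat) : 0 <= j%:R * h by rewrite mulr_ge0 // ltW.
have E w : \prod_(j < n.+1) G (j%:R * h) w ^+ a j =
    alive (n%:R * h) w * \prod_(j < n.+1) expR (- ((a j)%:R * X (j%:R * h) w)).
  rewrite /G; under eq_bigr do rewrite exprMn.
  rewrite big_split /=; congr (_ * _); last first.
    by apply: eq_bigr => j _; rewrite -expRM_natl mulrN.
  rewrite {2}/alive; case: ifP => [nz|nz].
    rewrite big1 // => j _; rewrite /alive.
    rewrite (le_lt_trans _ nz) ?expr1n // lee_fin ler_wpM2r ?(ltW h0) // ler_nat.
    by rewrite -ltnS.
  by rewrite big_ord_recr /= /alive nz expr0n eqn0Ngt an /= mulr0.
under eq_integral do rewrite E.
pose f (i : 'I_n.+1) (x : R) := expR (- ((a i)%:R * x)).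
have mf i : measurable_fun setT (f i).
  by exact: measurable_expRN.
have mset := mset_alive (n%:R * h).
have := @expectation_prod_factor _ _ R P n.+1 (fun i => X (i%:R * h)) (fun i => mX _)
  (alive (n%:R * h)) (P [set w | ((n%:R * h)%:E < zeta w)%E]) (measurable_alive _)
  (fun w => proj1 (andP (alive01 _ w))) (measure_ge0 _ _) _ f mf _.
rewrite /f => ->; last 2 first.
- have Ei (A B : set Omega) w : \1_A w * \1_B w = \1_(A `&` B) w :> R by rewrite indicI.
  move=> B mB.
  under eq_integral do rewrite (prod_indic (fun i : 'I_n.+1 => X (i%:R * h)) B) aliveE Ei.
  under [in RHS]eq_integral do rewrite (prod_indic (fun i : 'I_n.+1 => X (i%:R * h)) B).
  have mcap : measurable (\bigcap_(i in [set: 'I_n.+1]) (X (i%:R * h) @^-1` B i)).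
    apply: fin_bigcap_measurable => // i _.
    by rewrite -[X in measurable X]setTI; exact: mX.
  rewrite !integral_indic ?setIT //; last exact: measurableI.
  have zS : [set w | ((n%:R * h)%:E < zeta w)%E] = zeta @^-1` `](n%:R * h)%:E, +oo[%classic.
    by apply/seteqP; split=> w /=; rewrite in_itv /= andbT.
  rewrite zS; apply: (zX (t := fun i : 'I_n.+1 => i%:R * h)) => //.
  exact: emeasurable_itv.
- by move=> i x; exact: expR_ge0.
rewrite zE // EFinM; congr (_ * _)%E.
transitivity (\int[P]_w (\prod_(l < n) expR (- ((\sum_(l.+1 <= j < n.+1) a j)%:R *
    (X (l.+1%:R * h) w - X (l%:R * h) w))))%:E)%E.
  apply: eq_integral => w _; congr EFin.
  rewrite -!expR_sum; congr expR; rewrite !sumrN; congr (- _); exact: sum_incr.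
have := @expectation_prod _ _ R P n (fun i w => X (i.+1%:R * h) w - X (i%:R * h) w)
  (fun i => measurable_funB (mX _) (mX _)) _
  (fun l x => expR (- ((\sum_(l.+1 <= j < n.+1) a j)%:R * x))) _ _.
move=> ->.
- rewrite -prodEFin; apply: eq_bigr => l _; exact: step_law.
- apply: (iX (t := fun i => i%:R * h)) => [|i]; first by rewrite mul0r.
  by rewrite ler_wpM2r ?(ltW h0) // ler_nat.
- by move=> l; exact: measurable_expRN.
- by move=> l x; exact: expR_ge0.
Qed.

Let phi m := Phi m%:R.

Let integrable_bnd (f : Omega -> R) M : measurable_fun setT f -> (forall w, 0 <= f w <= M) ->
  P.-integrable setT (EFin \o f).
Proof.
move=> mf f01; apply: (@bounded_integrable _ _ _ _ _ M) => // w.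
by have /andP[f0 f1] := f01 w; rewrite ger0_norm.
Qed.

Let prodG n (a : nat -> nat) w := \prod_(j < n.+1) G (j%:R * h) w ^+ a j.

Let mprodG n a : measurable_fun setT (prodG n a).
Proof. by apply: measurable_prod => j _; apply: measurable_funX; exact: measurable_exp_killed. Qed.

Let jh0 (j : nat) : 0 <= j%:R * h. Proof. by rewrite mulr_ge0 // ltW. Qed.

Let prodG01 n a w : 0 <= prodG n a w <= 1.
Proof.
apply/andP; split; first by apply: prodr_ge0 => j _; rewrite exprn_ge0 ?exp_killed_ge0.
apply: prodr_ile1 => j _.
by rewrite exprn_ge0 ?exprn_ile1 ?exp_killed_ge0 ?exp_killed_le1.
Qed.

(** One grid step with exponents 0 and [m]: the killing rate and the law of the increment recombine
    into the exponent [Phi]. *)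
Let rho_psi m : (0 < m)%N -> expR (- (q * h)) * psi m = expR (- (h * phi m)).
Proof.
move=> m0; have h0' := ltW h0.
have := @expectation_grid 1 (fun j => if j == 0%N then 0%N else m) m0.
under eq_integral do rewrite big_ord_recl big_ord1 /= expr0 mul1r mul1r.
rewrite big_ord1 /= big_nat1 /= mul1r.
have := LX h0' (_ : 0 < m%:R); rewrite ltr0n => /(_ m0).
have -> : (\int[P]_w expeR (- (m%:R%:E * killed X zeta h w)) = \int[P]_w (G h w ^+ m)%:E)%E.
  apply: eq_integral => w _; rewrite /killed /G /alive; case: ifP => _ /=.
    by rewrite mul1r -expRM_natl mulrN.
  by rewrite mul0r expr0n eqn0Ngt m0 /= gt0_muley ?lte_fin ?ltr0n.
by move=> -> [].
Qed.

(** The Markov property at time [n h], read on moments: a further step multiplies the [m]-th power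
    by an independent factor of mean [expR (- (h * phi m))]. Both sides are instances of
    [expectation_grid], with [m] placed at [n + 1] or added at [n]. *)
Let grid_step n a m : (0 < m)%N ->
  \int[P]_w (prodG n a w * G (n.+1%:R * h) w ^+ m) =
  expR (- (h * phi m)) * \int[P]_w (prodG n a w * G (n%:R * h) w ^+ m).
Proof.
move=> m0.
pose a1 j := if (j <= n)%N then a j else m.
pose a2 j := if j == n then (a n + m)%N else a j.
have E1 w : prodG n a w * G (n.+1%:R * h) w ^+ m = prodG n.+1 a1 w.
  rewrite /prodG [RHS]big_ord_recr /= {2}/a1 ltnn; congr (_ * _).
  by apply: eq_bigr => j _; rewrite /a1 -ltnS ltn_ord.
have E2 w : prodG n a w * G (n%:R * h) w ^+ m = prodG n a2 w.
  rewrite /prodG !big_ord_recr /= {2}/a2 eqxx exprD mulrA; congr (_ * _ * _).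
  by apply: eq_bigr => j _; rewrite /a2 ltn_eqF.
under eq_Rintegral do rewrite E1; under [in RHS]eq_Rintegral do rewrite E2.
rewrite /Rintegral !expectation_grid /=; last 2 first.
- by rewrite /a2 eqxx addn_gt0 m0 orbT.
- by rewrite /a1 ltnn.
rewrite big_ord_recr /= big_nat1 {2}/a1 ltnn -rho_psi //.
have -> : \prod_(l < n) psi (\sum_(l.+1 <= j < n.+2) a1 j) =
    \prod_(l < n) psi (\sum_(l.+1 <= j < n.+1) a2 j).
  apply: eq_bigr => l _; congr psi.
  rewrite big_nat_recr ?ltnS ?(ltnW (ltn_ord l)) //= {2}/a1 ltnn.
  rewrite [in RHS]big_nat_recr ?ltn_ord //= big_nat_recr ?ltn_ord //=.
  rewrite {2}/a1 leqnn {2}/a2 eqxx -addnA; congr (_ + _)%N.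
  by apply: eq_big_nat => j /andP[_ jn]; rewrite /a1 /a2 (ltnW jn) ltn_eqF.
have -> : q * (n.+1%:R * h) = q * h + q * (n%:R * h) by rewrite -natr1; ring.
by rewrite opprD expRD; ring.
Qed.

Definition riemann N w := \sum_(j < N) h * G (j.+1%:R * h) w.

Let tail n i w := \sum_(j < n) h * G ((i + j).+1%:R * h) w.

Let mtail n i : measurable_fun setT (tail n i).
Proof.
apply: measurable_sum => j; apply: measurable_funM => //; exact: measurable_exp_killed.
Qed.

Let tail_bnd n i w : 0 <= tail n i w <= n%:R * h.
Proof.
apply/andP; split; first by apply: sumr_ge0 => j _; rewrite mulr_ge0 ?exp_killed_ge0 // ltW.
apply: le_trans (_ : \sum_(j < n) h <= _); last by rewrite sumr_const card_ord mulr_natl.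
by apply: ler_sum => j _; rewrite ler_piMr ?(ltW h0) ?exp_killed_le1.
Qed.

(** The first term of [tail] is split off and the power is expanded by the binomial formula. The
    general prefix [prodG] absorbs the powers of that first term, and [grid_step] brings it back one
    time unit: this is the origin of the recursion of [beta]. *)
Let grid_moment n i a m :
  \int[P]_w (prodG i a w * tail n i w ^+ m) =
  beta phi h n m * \int[P]_w (prodG i a w * G (i%:R * h) w ^+ m).
Proof.
elim: n i a m => [|n IH] i a m.
  case: m => [|m] /=; first by rewrite mul1r; apply: eq_Rintegral => w _; rewrite !expr0.
  rewrite mul0r; under eq_Rintegral do rewrite /tail big_ord0 expr0n mulr0.
  by rewrite /Rintegral integral0.
case: m => [|m]; first by rewrite beta0 mul1r; apply: eq_Rintegral => w _; rewrite !expr0.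
set m' := m.+1.
have tailS w : tail n.+1 i w = h * G (i.+1%:R * h) w + tail n i.+1 w.
  rewrite /tail big_ord_recl /= addn0; congr (_ + _); apply: eq_bigr => j _.
  by rewrite /= /bump /= add1n addnS.
pose ak k j := if (j <= i)%N then a j else (m' - k)%N.
have akE k w : prodG i.+1 (ak k) w = prodG i a w * G (i.+1%:R * h) w ^+ (m' - k).
  rewrite /prodG big_ord_recr /= {2}/ak ltnn; congr (_ * _).
  by apply: eq_bigr => j _; rewrite /ak -ltnS ltn_ord.
have E w : prodG i a w * tail n.+1 i w ^+ m' =
    \sum_(k < m'.+1) ('C(m', k)%:R * h ^+ (m' - k)) * (prodG i.+1 (ak k) w * tail n i.+1 w ^+ k).
  rewrite tailS exprDn mulr_sumr; apply: eq_bigr => k _.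
  by rewrite akE exprMn -mulr_natr; ring.
have intk k : P.-integrable setT (EFin \o (fun w => prodG i.+1 (ak k) w * tail n i.+1 w ^+ k)).
  apply: (integrable_bnd (M := (n%:R * h) ^+ k)).
    by apply: measurable_funM => //; exact: measurable_funX.
  move=> w; have /andP[p0 p1] := prodG01 i.+1 (ak k) w; have /andP[t0 t1] := tail_bnd n i.+1 w.
  rewrite mulr_ge0 ?exprn_ge0 //= -[leRHS]mul1r ler_pM ?exprn_ge0 //.
  by rewrite lerXn2r // nnegrE.
under eq_Rintegral do rewrite E.
have [] := @Rintegral_sum _ _ R P setT _ (index_enum 'I_m'.+1)
  (fun k w => ('C(m', k)%:R * h ^+ (m' - k)) * (prodG i.+1 (ak k) w * tail n i.+1 w ^+ k)) measurableT.
  move=> k; exact: (integrableZl measurableT ('C(m', k)%:R * h ^+ (m' - k)) (intk k)).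
move=> _ ->.
rewrite [beta _ _ _ _]/= -mulrA mulr_suml mulr_sumr; apply: eq_bigr => k _.
rewrite RintegralZl // IH.
have -> : \int[P]_w (prodG i.+1 (ak k) w * G (i.+1%:R * h) w ^+ k) =
    \int[P]_w (prodG i a w * G (i.+1%:R * h) w ^+ m').
  by apply: eq_Rintegral => w _; rewrite akE -mulrA -exprD subnK // -ltnS.
by rewrite grid_step //; ring.
Qed.

Lemma riemann_moment N m : (\int[P]_w (riemann N w ^+ m)%:E)%E = (beta phi h N m)%:E.
Proof.
have mR : measurable_fun setT (riemann N) by exact: (mtail N 0).
have bR w : 0 <= riemann N w <= N%:R * h by exact: (tail_bnd N 0).
have -> : (\int[P]_w (riemann N w ^+ m)%:E)%E = (\int[P]_w (riemann N w ^+ m))%:E.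
  rewrite /Rintegral fineK //; apply: integrable_fin_num => //.
  apply: (integrable_bnd (M := (N%:R * h) ^+ m)); first exact: measurable_funX.
  move=> w; have /andP[r0 r1] := bR w; rewrite exprn_ge0 //= lerXn2r // nnegrE //.
congr EFin; have := grid_moment N 0 (fun=> 0%N) m.
have -> : \int[P]_w (prodG 0 (fun=> 0%N) w * tail N 0 w ^+ m) = \int[P]_w (riemann N w ^+ m).
  by apply: eq_Rintegral => w _; rewrite /prodG big_ord1 expr0 mul1r.
move=> ->.
have -> : \int[P]_w (prodG 0 (fun=> 0%N) w * G (0%:R * h) w ^+ m) = 1; last by rewrite mulr1.
case: m => [|m].
  under eq_Rintegral do rewrite /prodG big_ord1 !expr0 mulr1.
  by rewrite Rintegral_cst //= probability_setT mul1r.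
(* At time 0 the path starts from 0, and [zeta > 0] almost surely. *)
transitivity (fine (P [set w | (0%:E < zeta w)%E])); last first.
  by rewrite zE // mulr0 oppr0 expR0.
have <- : (\int[P]_w (\1_[set w | (0%:E < zeta w)%E] w)%:E)%E = P [set w | (0%:E < zeta w)%E].
  by rewrite integral_indic ?setIT //; exact: mset_alive.
rewrite /Rintegral; congr fine.
apply: eq_integral => w _; rewrite /prodG big_ord1 expr0 mul1r mul0r /G X0 oppr0 expR0 mulr1.
by rewrite aliveE indicE; case: (w \in _); rewrite ?expr1n ?expr0n.
Qed.
End moments_on_grid.

Let mesh p : R := 2 ^- p.
Let mesh0 p : 0 < mesh p. Proof. by rewrite invr_gt0 exprn_gt0. Qed.

(* Strictly to the right of [l] even when [l] is dyadic, so that right continuity applies. *)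
Let up p (l : R) : R := mesh p * (Num.truncn (l / mesh p)).+1%:R.

Let up_ge_mesh p l : mesh p <= up p l.
Proof. by rewrite /up ler_peMr ?(ltW (mesh0 p)) // ler1n. Qed.

Let up_gt p l : l < up p l.
Proof. by rewrite /up mulrC -ltr_pdivrMr ?truncnS_gt. Qed.

Let up_le p l : 0 <= l -> up p l <= l + mesh p.
Proof.
move=> l0; rewrite /up -natr1 mulrDr mulr1 lerD2r mulrC -ler_pdivlMr //.
by rewrite truncn_le // divr_ge0 // ltW.
Qed.

Let up_nondecreasing p l l' : l <= l' -> up p l <= up p l'.
Proof.
move=> ll'; rewrite /up ler_wpM2l ?(ltW (mesh0 p)) // ler_nat ltnS.
by apply: le_truncn; rewrite ler_wpM2r // invr_ge0 ltW.
Qed.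

Let up_nonincreasing p l : 0 <= l -> up p.+1 l <= up p l.
Proof.
move=> l0.
have mS : mesh p = 2 * mesh p.+1 by rewrite /mesh exprS invfM mulrA divff // mul1r.
rewrite {2}/up mS [2 * _]mulrC -mulrA {1}/up ler_wpM2l ?(ltW (mesh0 _)) //.
rewrite -natrM ler_nat -(ltr_nat R) (@le_lt_trans _ _ (l / mesh p.+1)) //.
  by rewrite truncn_le // divr_ge0 // ltW.
rewrite natrM -ltr_pdivrMl //.
have -> : 2^-1 * (l / mesh p.+1) = l / (mesh p.+1 * 2) by rewrite invfM; ring.
exact: truncnS_gt.
Qed.

Local Notation I := (expfun (killed X zeta)).

Let stepG p w l := G (up p l) w.

Let measurable_step p w : measurable_fun setT (fun l => stepG p w l).
Proof.
rewrite (_ : (fun l => _) = (fun l => - (- stepG p w l))); last by apply/funext => l; rewrite opprK.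
apply: measurableT_comp => //; apply: nondecreasing_measurable => // l l' ll'.
rewrite lerN2; apply: exp_killed_nonincreasing; last exact: up_nondecreasing.
exact: le_trans (ltW (mesh0 p)) (up_ge_mesh p l).
Qed.

Let step_cvg w l : 0 <= l -> stepG p w l @[p --> \oo] --> G l w.
Proof.
move=> l0.
have mesh_cvg : mesh p @[p --> \oo] --> (0 : R).
  rewrite /mesh; under eq_fun do rewrite -exprVn.
  by apply: cvg_expr; rewrite ger0_norm; lra.
have up_cvg : up p l @[p --> \oo] --> l.
  apply: (squeeze_cvgr _ (cvg_cst l) (_ : l + mesh p @[p --> \oo] --> l)).
    by apply: nearW => p; rewrite (ltW (up_gt p l)) up_le.
  by rewrite -[X in _ --> X]addr0; apply: cvgD => //; exact: cvg_cst.
have Xcvg : X (up p l) w @[p --> \oo] --> X l w.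
  by move: (rcX (w := w) l0) => /cvg_at_rightP; apply; split => // p; exact: up_gt.
rewrite /stepG /G /alive; have [lz|lz] := ltP (l%:E) (zeta w).
  have : \forall p \near \oo, ((up p l)%:E < zeta w)%E.
    move: lz; case: (zeta w) => [z||]; last by [].
      rewrite lte_fin => lz; near=> p; rewrite lte_fin.
      by near: p; apply: (cvgr_lt l) => //.
    by move=> _; apply: nearW => p; rewrite ltry.
  move=> near_alive.
  have h : expR (- X (up p l) w) @[p --> \oo] --> 1 * expR (- X l w).
    rewrite mul1r; apply: (@continuous_cvg _ _ _ _ _ _ expR); first exact: continuous_expR.
    exact: cvgN.
  apply: cvg_trans h; apply: near_eq_cvg.
  by apply: filterS near_alive => p ->; rewrite mul1r.
apply: cvg_near_cst; apply: nearW => p.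
have -> : ((up p l)%:E < zeta w)%E = false.
  by apply/negbTE; rewrite -leNgt (le_trans lz) // lee_fin ltW // up_gt.
by rewrite !mul0r.
Unshelve. all: by end_near. Qed.

Let measurable_path w : measurable_fun (`[0%R, +oo[%classic : set R) (fun l => (G l w)%:E).
Proof.
apply: (emeasurable_fun_cvg (fun p l => (stepG p w l)%:E)) => [p|l].
  by apply/measurable_EFinP; apply: measurable_funTS; exact: measurable_step.
rewrite /= in_itv /= andbT => l0; apply: cvg_EFin; last exact: step_cvg.
exact: nearW.
Qed.

Let expfunE w : I w = (\int[lebesgue_measure]_(l in `[0%R, +oo[) (G l w)%:E)%E.
Proof. by apply: eq_integral => l _; rewrite expeR_killed. Qed.

Let riemann_integral p N w :
  (\int[lebesgue_measure]_(l in `[0%R, (N%:R * mesh p)%R[) (stepG p w l)%:E = (riemann (mesh p) N w)%:E)%E.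
Proof.
elim: N => [|N IH]; first by rewrite mul0r set_itvco0 integral_set0 /riemann big_ord0.
have NS : N%:R * mesh p < N.+1%:R * mesh p by rewrite ltr_pM2r // ltr_nat.
have N0 : 0 <= N%:R * mesh p by rewrite mulr_ge0 // ltW.
have -> : `[0, N.+1%:R * mesh p[%classic = `[0, N%:R * mesh p[%classic `|` `[N%:R * mesh p, N.+1%:R * mesh p[%classic.
  by rewrite -itv_bndbnd_setU // bnd_simp // ltW.
rewrite ge0_integral_setU //=.
- rewrite IH /riemann big_ord_recr /= EFinD; congr (_ + _)%E.
  transitivity (\int[lebesgue_measure]_(l in `[(N%:R * mesh p)%R, (N.+1%:R * mesh p)%R[) (G (N.+1%:R * mesh p)%R w)%:E)%E.
    apply: eq_integral => l /set_mem /=; rewrite in_itv /= => /andP[Nl lN]; congr EFin.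
    rewrite /stepG /up mulrC; congr (G (_%:R * _) w); congr S.
    have l0 : 0 <= l by rewrite (le_trans N0).
    apply/eqP; rewrite truncn_eq ?divr_ge0 ?(ltW (mesh0 p)) //.
    by rewrite ler_pdivlMr // Nl ltr_pdivrMr.
  rewrite integral_cst //= lebesgue_measure_itv /= lte_fin NS -EFinB -EFinM; congr EFin.
  by rewrite -natr1; ring.
- by apply/measurable_EFinP; apply: measurable_funTS; exact: measurable_step.
- by move=> l _; rewrite lee_fin exp_killed_ge0.
- rewrite /disj_set; apply/eqP/seteqP; split => l //=; rewrite !in_itv /= => -[/andP[_ h1] /andP[h2 _]].
  by have := lt_le_trans h1 h2; rewrite ltxx.
Qed.

Let riemann_le p N w : ((riemann (mesh p) N w)%:E <= I w)%E.
Proof.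
rewrite -riemann_integral expfunE.
apply: (@le_trans _ _ (\int[lebesgue_measure]_(l in `[0%R, +oo[) (stepG p w l)%:E)%E).
  apply: ge0_subset_integral => //.
  - by apply/measurable_EFinP; apply: measurable_funTS; exact: measurable_step.
  - by move=> l _; rewrite lee_fin exp_killed_ge0.
  - by move=> l /=; rewrite !in_itv /= andbT => /andP[].
apply: ge0_le_integral => //.
- by move=> l _; rewrite lee_fin exp_killed_ge0.
- by apply/measurable_EFinP; apply: measurable_funTS; exact: measurable_step.
- exact: measurable_path.
- move=> l; rewrite /= in_itv /= andbT => l0; rewrite lee_fin.
  by apply: exp_killed_nonincreasing => //; rewrite ltW // up_gt.
Qed.

(** [4 ^ p] steps of mesh [2 ^ - p] cover [[0, 2 ^ p[]: mesh and horizon pass to the limit together,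
    and the step functions increase with [p]. *)
Let S p w := riemann (mesh p) (4 ^ p) w.

Let S_cvg w : (S p w)%:E @[p --> \oo] --> I w.
Proof.
pose g p l : \bar R := (\1_(`[0%R, 2 ^+ p[%classic) l * stepG p w l)%:E.
have Nmesh p : (4 ^ p)%:R * mesh p = 2 ^+ p.
  by rewrite /mesh natrX -[4%:R]/((2 * 2)%:R) natrM exprMn mulfK // gt_eqF // exprn_gt0.
have mg p : measurable_fun setT (g p).
  by apply/measurable_EFinP; apply: measurable_funM => //; exact: measurable_step.
have g0 p l : (0 <= g p l)%E by rewrite lee_fin mulr_ge0 // ?exp_killed_ge0 // indicE.
have SE p : (S p w)%:E = (\int[lebesgue_measure]_(l in `[0%R, +oo[) g p l)%E.
  rewrite /S -riemann_integral Nmesh.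
  rewrite [LHS]integral_mkcond [RHS]integral_mkcond; apply: eq_integral => l _.
  rewrite !patchE /g indicE.
  have [/set_mem /=|] := boolP (l \in `[0, +oo[%classic); last first.
    move=> h; rewrite ifF //; apply/negbTE; apply: contra h => /set_mem /=.
    by rewrite in_itv /= => /andP[l0 _]; apply/mem_set; rewrite /= in_itv /= l0.
  by rewrite in_itv /= andbT => l0; case: ifP => _; rewrite ?mul1r ?mul0r.
rewrite expfunE.
have -> : (\int[lebesgue_measure]_(l in `[0%R, +oo[) (G l w)%:E =
    \int[lebesgue_measure]_(l in `[0%R, +oo[) (limn (g ^~ l)))%E.
  apply: eq_integral => l /set_mem /=; rewrite in_itv /= andbT => l0; apply/esym/cvg_lim => //.
  apply: cvg_trans (_ : (stepG p w l)%:E @[p --> \oo] --> _).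
    apply: near_eq_cvg; near=> p; rewrite /g indicE mem_set ?mul1r //= in_itv /= l0 /=.
    near: p; exists (Num.truncn l).+1 => // p /= lp.
    rewrite (lt_le_trans (truncnS_gt l)) // -natrX ler_nat (leq_trans lp) //.
    exact: ltnW (ltn_expl _ _).
  by apply: cvg_EFin; [exact: nearW|exact: step_cvg].
under eq_cvg do rewrite SE.
apply: cvg_monotone_convergence => //.
- by move=> p; apply: measurable_funTS; exact: mg.
- move=> l; rewrite /= in_itv /= andbT => l0; apply/nondecreasing_seqP => p.
  rewrite lee_fin !indicE ler_pM ?exp_killed_ge0 //; last first.
    apply: exp_killed_nonincreasing; last exact: up_nonincreasing.
    exact: le_trans (ltW (mesh0 _)) (up_ge_mesh _ l).
  rewrite ler_nat; case: (boolP (l \in _)) => // /set_mem /=; rewrite in_itv /= => /andP[_ lp].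
  rewrite mem_set //= in_itv /= l0 (lt_le_trans lp) // ler_weXn2l //; lra.
Unshelve. all: by end_near. Qed.

Lemma measurable_expfun : measurable_fun setT I.
Proof.
apply: (emeasurable_fun_cvg (fun p w => (S p w)%:E)) => [p|w _]; last exact: S_cvg.
apply/measurable_EFinP; apply: measurable_sum => j; apply: measurable_funM => //.
exact: measurable_exp_killed.
Qed.

Let mS p : measurable_fun setT (S p).
Proof.
apply: measurable_sum => j; apply: measurable_funM => //.
exact: measurable_exp_killed.
Qed.

Let riemann_ge0 p N w : 0 <= riemann (mesh p) N w.
Proof. by apply: sumr_ge0 => j _; rewrite mulr_ge0 ?exp_killed_ge0 // ltW. Qed.

Hypothesis Phi_gt0 : forall m : nat, 0 < Phi m.+1%:R.
Let phi m := Phi m%:R.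
Let M := exp_moment phi.

Let expfun_ge0 w : (0 <= I w)%E.
Proof. by rewrite expfunE; apply: integral_ge0 => l _; rewrite lee_fin exp_killed_ge0. Qed.

Let expfun_integral_le : (\int[P]_w I w <= (M 1)%:E)%E.
Proof.
have [l [_ bl lM]] := @beta_limits R phi Phi_gt0.
apply: (@fatou_le _ _ _ P (fun p w => (S p w)%:E) _ (fun p => l p 1%N)) => //.
- by move=> p; apply/measurable_EFinP.
- exact: measurable_expfun.
- by move=> p w; rewrite lee_fin riemann_ge0.
- by apply: aeW => w; exact: S_cvg.
- move=> p; have -> : (\int[P]_w (S p w)%:E = (beta phi (mesh p) (4 ^ p) 1%N)%:E)%E := riemann_moment (mesh0 p) (4 ^ p) 1.
  by rewrite lee_fin; exact: bl.
Qed.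

Let expfun_fin : {ae P, forall w, I w \is a fin_num}.
Proof.
have : P.-integrable setT I.
  apply/integrableP; split; first exact: measurable_expfun.
  rewrite (eq_integral I) => [|w _]; last by rewrite gee0_abs.
  exact: le_lt_trans expfun_integral_le (ltry _).
by move=> /(integrable_ae measurableT); apply: filterS => w; exact.
Qed.

Let expfun_gt0 : {ae P, forall w, (0 < I w)%E}.
Proof.
have mz0 : measurable [set w | (0%:E < zeta w)%E] by exact: mset_alive.
have : {ae P, forall w, (0%:E < zeta w)%E}.
  exists (~` [set w | (0%:E < zeta w)%E]); split => //; first exact: measurableC.
  by rewrite probability_setC // zE // mulr0 oppr0 expR0 subee.
apply: filterS => w zw.
have [p pz] : exists p, ((mesh p)%:E < zeta w)%E.
  have mesh_cvg : mesh p @[p --> \oo] --> (0 : R).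
    rewrite /mesh; under eq_fun do rewrite -exprVn.
    by apply: cvg_expr; rewrite ger0_norm; lra.
  move: zw; case: (zeta w) => [z| |] //; last by exists 0%N; rewrite ltry.
  rewrite lte_fin => z0; have := cvgr_lt _ mesh_cvg z z0.
  by move=> [p _ /(_ p (leqnn p))] /= h; exists p; rewrite lte_fin.
apply: lt_le_trans (riemann_le p 1 w).
rewrite lte_fin /riemann big_ord1 mul1r mulr_gt0 // /G /alive pz mul1r; exact: expR_gt0.
Qed.

Lemma expfun_gt0_fin : P [set w | (0 < I w < +oo)%E] = 1%E.
Proof.
have : {ae P, forall w, (0 < I w < +oo)%E}.
  apply: filterS2 expfun_gt0 expfun_fin => w I0 If.
  by rewrite I0 /= ltey_eq If.
have mA : measurable [set w | (0 < I w < +oo)%E].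
  rewrite (_ : [set w | _] = setT `&` I @^-1` `]0%E, +oo%E[%classic).
    by apply: measurable_expfun => //; exact: emeasurable_itv.
  by rewrite setTI; apply/seteqP; split=> w /=; rewrite in_itv.
move=> aeI.
rewrite -[X in P X]setCK probability_setC; last exact: measurableC.
have -> : P (~` [set w | (0 < I w < +oo)%E]) = 0%E.
  by apply/negligibleP => //; exact: measurableC.
by rewrite sube0.
Qed.

Lemma measurable_fine_expfun : measurable_fun setT (fun w => fine (I w)).
Proof. by apply: measurableT_comp => //; exact: measurable_expfun. Qed.

(** Fatou's lemma bounds the moment by the limit of those of the Riemann sums. Conversely these sums
    evaluate a nonincreasing path to the right of each time, so they never exceed the integral. *)
Lemma expfun_moment m : (\int[P]_w (fine (I w) ^+ m)%:E = (M m)%:E)%E.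
Proof.
have [l [lb bl lM]] := @beta_limits R phi Phi_gt0.
have fI0 w : 0 <= fine (I w) by exact: fine_ge0.
apply/eqP; rewrite eq_le; apply/andP; split.
  pose u p w := Num.min (S p w) (fine (I w)).
  have u0 p w : 0 <= u p w by rewrite le_min riemann_ge0 fI0.
  apply: (@fatou_le _ _ _ P (fun p w => (u p w ^+ m)%:E) _ (fun p => l p m)) => //.
  - move=> p; apply/measurable_EFinP; apply: measurable_funX.
    by apply: measurable_minr => //; exact: measurable_fine_expfun.
  - apply/measurable_EFinP; apply: measurable_funX; exact: measurable_fine_expfun.
  - by move=> p w; rewrite lee_fin exprn_ge0.
  - by move=> w; rewrite lee_fin exprn_ge0.
  - apply: filterS expfun_fin => w If; apply: cvg_EFin; first exact: nearW.
    change (u p w ^+ m @[p --> \oo] --> fine (I w) ^+ m).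
    have Sw : S p w @[p --> \oo] --> fine (I w).
      by have := @S_cvg w; rewrite -{1}(fineK If) => /fine_cvg.
    have uS : u ^~ w = S ^~ w.
      apply/funext => p; apply/min_idPl.
      by have := riemann_le p (4 ^ p) w; rewrite -{1}(fineK If) lee_fin.
    rewrite (_ : (fun p => u p w ^+ m) = (fun p => S p w ^+ m)); last first.
      by apply/funext => p; rewrite -[u p w]/(u ^~ w p) uS.
    exact: cvg_exprn.
  - move=> p; apply: le_trans (_ : (beta phi (mesh p) (4 ^ p) m)%:E <= _)%E; last first.
      by rewrite lee_fin; exact: bl.
    rewrite -(riemann_moment (mesh0 p)); apply: ge0_le_integral => //.
    + by move=> w _; rewrite lee_fin exprn_ge0.
    + apply/measurable_EFinP; apply: measurable_funX.
      by apply: measurable_minr => //; exact: measurable_fine_expfun.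
    + by apply/measurable_EFinP; apply: measurable_funX; exact: (mS p).
    + move=> w _; rewrite lee_fin lerXn2r ?nnegrE ?riemann_ge0 //.
      by rewrite /u ge_min lexx.
have mRm p N : measurable_fun setT (fun w => (riemann (mesh p) N w ^+ m)%:E).
  apply/measurable_EFinP; apply: measurable_funX; apply: measurable_sum => j.
  apply: measurable_funM => //; exact: measurable_exp_killed.
have le p N : ((beta phi (mesh p) N m)%:E <= \int[P]_w (fine (I w) ^+ m)%:E)%E.
  rewrite -(riemann_moment (mesh0 p)); apply: ae_ge0_le_integral => //.
  - by move=> w _; rewrite lee_fin exprn_ge0 // riemann_ge0.
  - by move=> w _; rewrite lee_fin exprn_ge0.
  - apply/measurable_EFinP; apply: measurable_funX; exact: measurable_fine_expfun.
  - apply: filterS expfun_fin => w If _; rewrite lee_fin lerXn2r ?nnegrE ?riemann_ge0 //.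
    by have := riemann_le p N w; rewrite -{1}(fineK If) lee_fin.
have le1 p : ((l p m)%:E <= \int[P]_w (fine (I w) ^+ m)%:E)%E.
  have /cvg_lim <- // : (beta phi (mesh p) N m)%:E @[N --> \oo] --> (l p m)%:E.
    by apply: cvg_EFin; [exact: nearW|exact: lb].
  apply: lime_le; last exact: nearW.
  by apply/cvg_ex; exists (l p m)%:E; apply: cvg_EFin; [exact: nearW|exact: lb].
have /cvg_lim <- // : (l p m)%:E @[p --> \oo] --> (M m)%:E.
  by apply: cvg_EFin; [exact: nearW|exact: lM].
apply: lime_le; last exact: nearW.
by apply/cvg_ex; exists (M m)%:E; apply: cvg_EFin; [exact: nearW|exact: lM].
Qed.
End exponential_functional.

(** * Differentiability of the exponent and second differences of the moments *)

Section bernstein_exponent.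
Context (R : realType) (d : measure_display) (Omega : measurableType d)
  (P : probability Omega R) (X : R -> Omega -> R) (zeta : Omega -> \bar R) (q : R) (Phi : R -> R).
Hypothesis sX : subordinator P X.
Hypothesis kX : killing_time P X zeta q.
Hypothesis LX : forall l s, 0 <= l -> 0 < s ->
  (\int[P]_w expeR (- (s%:E * killed X zeta l w)) = (expR (- (l * Phi s)))%:E)%E.
Hypothesis Phi_neq0 : exists s, 0 < s /\ Phi s != 0.

Let mX t : measurable_fun setT (X t). Proof. by have [[]] := sX. Qed.
Let X0 w : 0 <= X 1 w.
Proof. by have [[X0 _] + _ _ _] := sX => /(_ w 0 1 (lexx _) ler01); rewrite X0. Qed.

Let L s w := alive zeta 1 w * expR (- (s * X 1 w)).

Let mL s : measurable_fun setT (L s).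
Proof.
apply: measurable_funM; first exact: (measurable_alive kX).
by apply: measurableT_comp (measurable_expRN s) _.
Qed.

Let L01 s w : 0 <= s -> 0 <= L s w <= 1.
Proof.
move=> s0; have /andP[a0 a1] := alive01 zeta 1 w.
rewrite mulr_ge0 ?expR_ge0 //= mulr_ile1 ?expR_ge0 //.
by rewrite -[leRHS]expR0 ler_expR oppr_le0 mulr_ge0.
Qed.

Let iL s : 0 <= s -> P.-integrable setT (EFin \o L s).
Proof.
move=> s0; apply: (@bounded_integrable _ _ _ _ _ 1) => // w.
by have /andP[l0 l1] := L01 w s0; rewrite ger0_norm.
Qed.

Let LE s : 0 < s -> \int[P]_w L s w = expR (- Phi s).
Proof.
move=> s0; have := LX ler01 s0; rewrite mul1r => h.
rewrite /Rintegral -[RHS]/(fine (expR (- Phi s))%:E) -h; congr fine.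
apply: eq_integral => w _; rewrite /killed /L /alive; case: ifP => _ /=.
  by rewrite mul1r.
by rewrite mul0r gt0_muley ?lte_fin.
Qed.

Lemma le_exponent s t : 0 < s -> s <= t -> Phi s <= Phi t.
Proof.
move=> s0 st; have t0 := lt_le_trans s0 st.
rewrite -lerN2 -ler_expR -!LE //; apply: (le_Rintegral measurableT (iL (ltW t0)) (iL (ltW s0))).
move=> w _; rewrite /L ler_wpM2l //; first by have /andP[] := alive01 zeta 1 w.
by rewrite ler_expR lerN2 ler_wpM2r.
Qed.

Let exponent_ge0 s : 0 < s -> 0 <= Phi s.
Proof.
move=> s0; rewrite -oppr_le0 -ler_expR expR0 -LE //.
have <- : \int[P]_w (1 : R) = 1 by rewrite Rintegral_cst //= probability_setT mul1r.
apply: (le_Rintegral measurableT (iL (ltW s0))).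
  by apply: (@bounded_integrable _ _ _ _ _ 1) => // w; rewrite normr1.
by move=> w _; have /andP[] := L01 w (ltW s0).
Qed.

(** The variance of [L s] is nonnegative, and [L s ^+ 2] is [L (2 * s)] because the killing factor
    is 0 or 1. *)
Let exponent_double s : 0 < s -> Phi (2 * s) <= 2 * Phi s.
Proof.
move=> s0; have s20 : 0 < 2 * s by rewrite mulr_gt0.
pose m := expR (- Phi s).
have : 0 <= \int[P]_w ((L (2 * s) w - (2 * m) * L s w) + m ^+ 2).
  apply: Rintegral_ge0 => w _; have /andP[l0 _] := L01 w (ltW s0).
  rewrite (_ : _ + _ = (L s w - m) ^+ 2 + (L (2 * s) w - L s w ^+ 2)); last by ring.
  rewrite addr_ge0 ?sqr_ge0 // subr_ge0 /L exprMn -expRM_natl.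
  have -> : 2 * - (s * X 1 w) = - (2 * s * X 1 w) by ring.
  by rewrite ler_wpM2r ?expR_ge0 // /alive; case: ifP; rewrite ?expr1n ?expr0n.
have i1 := iL (ltW s20).
have i2 : P.-integrable setT (EFin \o (fun w => (2 * m) * L s w)).
  exact: (integrableZl measurableT (2 * m) (iL (ltW s0))).
have i3 : P.-integrable setT (EFin \o (fun=> m ^+ 2 : R)).
  by apply: (@bounded_integrable _ _ _ _ _ (m ^+ 2)) => // w; rewrite ger0_norm ?sqr_ge0.
rewrite RintegralD //; last exact: (integrableB measurableT i1 i2).
rewrite RintegralB // RintegralZl //; last exact: (iL (ltW s0)).
rewrite Rintegral_cst //= probability_setT mulr1 !LE // -/m.
rewrite (_ : _ + _ = expR (- Phi (2 * s)) - m ^+ 2); last by ring.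
rewrite subr_ge0 /m -expRM_natl ler_expR; lra.
Qed.

(** The hypothesis gives one point [s1] with [Phi s1 > 0]. Monotonicity and doubling carry this down
    to every [s]: [Phi s1 <= Phi (2 ^+ n * s) <= 2 ^+ n * Phi s] for large [n]. *)
Lemma exponent_gt0 s : 0 < s -> 0 < Phi s.
Proof.
move=> s0; have [s1 [s10 Ps1]] := Phi_neq0.
have Ps10 : 0 < Phi s1 by rewrite lt_neqAle eq_sym Ps1 exponent_ge0.
have dbl n : Phi (2 ^+ n * s) <= 2 ^+ n * Phi s.
  elim: n => [|n IH]; first by rewrite !mul1r.
  rewrite !exprS -!mulrA; apply: le_trans (exponent_double _) _.
    by rewrite mulr_gt0 // exprn_gt0.
  by rewrite ler_pM2l.
pose n := (Num.truncn (s1 / s)).+1.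
have s1n : s1 <= 2 ^+ n * s.
  rewrite -ler_pdivrMr // ltW // (lt_le_trans (truncnS_gt _)) //.
  by rewrite -natrX ler_nat ltnW // ltn_expl.
have := lt_le_trans Ps10 (le_trans (le_exponent s10 s1n) (dbl n)).
by rewrite pmulr_rgt0 // exprn_gt0.
Qed.

(** Differentiation under the expectation on []s / 2, s + 1[], where [x * expR (- (u * x)) <= 1 / u]
    with [u = s / 2] provides a constant dominating function; then [Phi] is minus the logarithm of
    the result. *)
Lemma derivable_exponent s : 0 < s -> derivable Phi s 1.
Proof.
move=> s0; pose u := s / 2; pose v := s + 1.
have u0 : 0 < u by rewrite divr_gt0.
have us : `]u, v[%classic s by rewrite /= in_itv /= /u /v; lra.
have dL (t : R) w : is_derive t (1 : R) (fun t : R => L t w) (- (X 1 w * L t w)).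
  rewrite /L; apply: is_derive_eq.
  rewrite scaler0 add0r /GRing.scale /= mulr1; ring.
have dLE (t : R) w : partial1of2 L t w = - (X 1 w * L t w).
  by rewrite partial1of2E; apply: derive_val.
have bnd x : 0 <= x -> x * expR (- (u * x)) <= u^-1.
  move=> x0; rewrite -ler_pdivlMr ?expR_gt0 // expRN invrK -ler_pdivrMl ?invr_gt0 // invrK.
  by apply: le_trans (expR_ge1Dx _); rewrite lerDr.
have dI : derivable (fun t => \int[P]_w L t w) s 1.
  apply: (@derivable_under_integral R _ _ P L setT measurableT s u v us _ _ (fun=> u^-1)) => //.
  - move=> t /=; rewrite in_itv /= => /andP[ut _]; apply: iL.
    by rewrite ltW // (lt_trans u0).
  - by move=> w; rewrite invr_ge0 ltW.
  - by apply: (@bounded_integrable _ _ _ _ _ u^-1) => // w; rewrite ger0_norm // invr_ge0 ltW.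
  - move=> t w /=; rewrite in_itv /= => /andP[ut _] _; rewrite dLE normrN ger0_norm; last first.
      by rewrite mulr_ge0 //; have /andP[] := L01 w (ltW (lt_trans u0 ut)).
    apply: le_trans (bnd _ (X0 w)); rewrite ler_wpM2l //.
    rewrite -[leRHS]mul1r ler_pM ?expR_ge0 //; try by have /andP[] := alive01 zeta 1 w.
    by rewrite ler_expR lerN2 ler_wpM2r // ltW.
have PE : {near s, (fun t => - ln (\int[P]_w L t w)) =1 Phi}.
  have : \forall t \near s, 0 < t by exists s => //= t; rewrite /ball_ /= ltr_norml => /andP[]; lra.
  by apply: filterS => t t0; rewrite LE // expRK opprK.
apply: (@near_eq_derivable R R R _ Phi s 1 PE).
apply: derivableN; apply: diff_derivable; apply: differentiable_comp.
  exact/derivable1_diffP.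
apply/derivable1_diffP; apply: ex_derive; apply: is_derive1_ln.
by rewrite LE // expR_gt0.
Qed.
End bernstein_exponent.

Lemma measurable_invr (R : realType) : measurable_fun setT (@GRing.inv R).
Proof.
rewrite -(classical_sets.setUv [set (0 : R)]); apply/measurable_funU => //; [exact: measurableC|split; first exact: measurable_fun_set1].
apply: open_continuous_measurable_fun; first by rewrite openC; exact: closed_eq.
by move=> x /set_mem /= /eqP x0; exact: inv_continuous.
Qed.

(** * Frullani integrals *)

Section frullani.
Context (R : realType).
Local Notation D := (`[0%R, +oo[%classic : set R).

(* [frullani s t x] is (exp(-sx) - exp(-tx)) / x, continuously extended at 0. *)
Definition frullani (s t x : R) : R :=
  if x == 0 then t - s else (expR (- (s * x)) - expR (- (t * x))) / x.

Lemma measurable_frullani s t : measurable_fun setT (frullani s t).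
Proof.
apply: measurable_fun_ifT => //; first exact: measurable_fun_eqr.
apply: measurable_funM; last exact: measurable_invr.
by apply: measurable_funB; exact: measurable_expRN.
Qed.

(** Both bounds come from [1 + y <= expR y], for [y = (t - s) * x] and for its opposite. *)
Lemma frullani_bounds s t x : s <= t -> 0 <= x ->
  (t - s) * expR (- (t * x)) <= frullani s t x <= (t - s) * expR (- (s * x)).
Proof.
move=> st; rewrite le_eqVlt /frullani => /predU1P[<-|x0].
  by rewrite eqxx !mulr0 oppr0 expR0 mulr1 lexx.
rewrite gt_eqF // ler_pdivlMr // ler_pdivrMr //.
have e1 : 1 + (t - s) * x <= expR ((t - s) * x) by exact: expR_ge1Dx.
have e2 : 1 - (t - s) * x <= expR (- ((t - s) * x)) by exact: expR_ge1Dx.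
have Es : expR (- (s * x)) = expR (- (t * x)) * expR ((t - s) * x) by rewrite -expRD; congr expR; ring.
have Et : expR (- (t * x)) = expR (- (s * x)) * expR (- ((t - s) * x)) by rewrite -expRD; congr expR; ring.
have s0 := expR_gt0 (- (s * x)); have t0 := expR_gt0 (- (t * x)).
apply/andP; split.
  by rewrite Es; nra.
rewrite {1}Et; nra.
Qed.

Lemma frullani_shift m s t x : frullani (m + s) (m + t) x = expR (- (m * x)) * frullani s t x.
Proof.
rewrite /frullani; case: ifPn => [/eqP ->|x0]; first by rewrite mulr0 oppr0 expR0; ring.
have E r : expR (- ((m + r) * x)) = expR (- (m * x)) * expR (- (r * x)).
  by rewrite -expRD; congr expR; ring.
by rewrite !E -mulrBr mulrA.
Qed.

Lemma frullaniD s t u x : frullani s u x = frullani s t x + frullani t u x.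
Proof. by rewrite /frullani; case: ifP => _; [ring|rewrite -mulrDl; congr (_ / _); ring]. Qed.

Context (mu : {measure set (measurableTypeR R) -> \bar R}) (F L : R -> R).
Hypothesis dF : forall s : R, 0 < s -> is_derive s (1 : R) F (L s).
Hypothesis muL : forall s, 0 < s -> (\int[mu]_(x in D) (expR (- (s * x)))%:E)%E = (L s)%:E.

Let mD : measurable (D : set (measurableTypeR R)). Proof. exact: measurable_itv. Qed.

Lemma integrable_expRN s : 0 < s -> mu.-integrable D (fun x => (expR (- (s * x)))%:E).
Proof.
move=> s0; apply/integrableP; split.
  by apply/measurable_EFinP; apply: measurable_funTS; exact: measurable_expRN.
rewrite [ltLHS](_ : _ = (L s)%:E) ?ltry // -muL //.
by apply: eq_integral => x _; rewrite gee0_abs // lee_fin expR_ge0.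
Qed.

Lemma integrable_frullani s t : 0 < s -> s <= t -> mu.-integrable D (EFin \o frullani s t).
Proof.
move=> s0 st; have h := integrableZl mD (t - s) (integrable_expRN s0).
apply: le_integrable h => //.
  by apply/measurable_EFinP; apply: measurable_funTS; exact: measurable_frullani.
move=> x /=; rewrite in_itv /= andbT => x0; rewrite lee_fin.
have /andP[f0 f1] := frullani_bounds st x0.
have ts : 0 <= t - s by rewrite subr_ge0.
rewrite !ger0_norm ?mulr_ge0 ?expR_ge0 //.
by apply: le_trans f0; rewrite mulr_ge0 // expR_ge0.
Qed.

Let Rint s : 0 < s -> \int[mu]_(x in D) (expR (- (s * x))) = L s.
Proof. by move=> s0; rewrite /Rintegral muL. Qed.

Let L_nonincreasing s t : 0 < s -> s <= t -> L t <= L s.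
Proof.
move=> s0 st; have t0 := lt_le_trans s0 st.
rewrite -!Rint //; apply: le_Rintegral => //; [exact: integrable_expRN|exact: integrable_expRN|].
move=> x /=; rewrite in_itv /= andbT => x0.
by rewrite ler_expR lerN2 ler_wpM2r.
Qed.

Let H s t := \int[mu]_(x in D) frullani s t x - (F t - F s).

Let H_bound s t : 0 < s -> s <= t -> `|H s t| <= (t - s) * (L s - L t).
Proof.
move=> s0 st; have t0 := lt_le_trans s0 st.
have iF := integrable_frullani s0 st.
have is_ := integrable_expRN s0; have it_ := integrable_expRN t0.
have h1 : (t - s) * L t <= \int[mu]_(x in D) frullani s t x.
  rewrite -Rint // -RintegralZl //; apply: le_Rintegral => //.
    exact: (integrableZl mD (t - s) it_).
  by move=> x /=; rewrite in_itv /= andbT => x0; have /andP[] := frullani_bounds st x0.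
have h2 : \int[mu]_(x in D) frullani s t x <= (t - s) * L s.
  rewrite -Rint // -RintegralZl //; apply: le_Rintegral => //.
    exact: (integrableZl mD (t - s) is_).
  by move=> x /=; rewrite in_itv /= andbT => x0; have /andP[] := frullani_bounds st x0.
have [c /[!in_itv]/= /andP[sc ct] FE] : exists2 c, c \in `[s, t] & F t - F s = L c * (t - s).
  apply: MVT_segment => // [x /[!in_itv]/= /andP[sx _]|].
    by apply: dF; exact: lt_trans s0 sx.
  apply: derivable_within_continuous => x /[!in_itv]/= /andP[sx _].
  by have [] := dF (lt_le_trans s0 sx).
have c0 := lt_le_trans s0 sc.
have ts : 0 <= t - s by rewrite subr_ge0.
have h3 : (t - s) * L t <= F t - F s by rewrite FE mulrC ler_wpM2r // L_nonincreasing.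
have h4 : F t - F s <= (t - s) * L s by rewrite FE mulrC ler_wpM2l // L_nonincreasing.
rewrite /H ler_norml mulrBr; lra.
Qed.

Let H_add s t u : 0 < s -> s <= t -> t <= u -> H s u = H s t + H t u.
Proof.
move=> s0 st tu; have t0 := lt_le_trans s0 st.
have i1 := integrable_frullani s0 st; have i2 := integrable_frullani t0 tu.
rewrite /H (_ : \int[mu]_(x in D) frullani s u x =
  \int[mu]_(x in D) frullani s t x + \int[mu]_(x in D) frullani t u x); first by ring.
by rewrite -RintegralD //; apply: eq_Rintegral => x _; exact: frullaniD.
Qed.

Let H_subdivide s e n : 0 < s -> 0 <= e -> `|H s (s + n%:R * e)| <= e * (L s - L (s + n%:R * e)).
Proof.
move=> s0 e0; elim: n => [|n IH].
  rewrite mul0r addr0 subrr mulr0; have := H_bound s0 (lexx s).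
  by rewrite !subrr mul0r.
have ne : 0 <= n%:R * e by rewrite mulr_ge0.
have E : s + n.+1%:R * e = s + n%:R * e + e by rewrite -natr1; ring.
have s0' : 0 < s + n%:R * e by rewrite ltr_wpDr.
rewrite E (@H_add _ (s + n%:R * e)) ?lerDl //.
apply: le_trans (ler_normD _ _) _.
have := @H_bound (s + n%:R * e) (s + n%:R * e + e) s0'; rewrite lerDl => /(_ e0).
rewrite (_ : s + n%:R * e + e - (s + n%:R * e) = e); last by ring.
move: IH; rewrite !mulrBr; lra.
Qed.

(** Both sides are additive over adjacent intervals and, on [[s, t]], lie between [(t - s) * L t]
    and [(t - s) * L s]. Over [n] equal pieces the errors telescope to [(t - s) * (L s - L t) / n],
    so no exchange of integrals is involved. *)
Lemma integral_frullani s t : 0 < s -> s <= t -> \int[mu]_(x in D) frullani s t x = F t - F s.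
Proof.
move=> s0 st; apply/eqP; rewrite -subr_eq0 -/(H s t) -normr_le0.
have bnd n : `|H s t| <= ((t - s) * (L s - L t)) / n.+1%:R.
  have := @H_subdivide s ((t - s) / n.+1%:R) n.+1 s0.
  rewrite divr_ge0 ?subr_ge0 // => /(_ isT).
  rewrite [n.+1%:R * _]mulrC divfK ?pnatr_eq0 // [s + _]addrC subrK.
  by move/le_trans; apply; rewrite mulrAC.
have cv : ((t - s) * (L s - L t)) / n.+1%:R @[n --> \oo] --> (0 : R).
  rewrite -[X in _ --> X](mulr0 ((t - s) * (L s - L t))).
  by apply: cvgM; [exact: cvg_cst|exact: cvg_harmonic].
rewrite -(cvg_lim (@Rhausdorff R) cv); apply: limr_ge.
  by apply/cvg_ex; eexists; exact: cv.
exact: nearW.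
Qed.
End frullani.

(** * Second differences of the logarithms of the moments *)

Section second_difference.
Context (R : realType).
Local Notation D := (`[0%R, +oo[%classic : set R).
Let leb : {measure set (measurableTypeR R) -> \bar R} := @lebesgue_measure R.
Variables (Phi : R -> R) (kappa : {measure set (measurableTypeR R) -> \bar R}).
Hypothesis Phi_gt0 : forall s, 0 < s -> 0 < Phi s.
Hypothesis dPhi : forall s, 0 < s -> derivable Phi s 1.
Hypothesis kappa0 : kappa `]-oo, 0%R[%classic = 0%E.
Hypothesis kappaL : forall s, 0 < s ->
     (\int[kappa]_x (expR (- (s * x)))%:E)%E = (derive1 Phi s / Phi s)%:E.

Let mD : measurable (D : set (measurableTypeR R)). Proof. exact: measurable_itv. Qed.

Lemma lebesgue_laplace s : 0 < s -> (\int[leb]_(x in D) (expR (- (s * x)))%:E)%E = (s^-1)%:E.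
Proof.
move=> s0.
have h : (\int[leb]_(x in D) (s * expR (- s * x))%:E = 1)%E.
  rewrite -[RHS](integral_exponential_pdf s0) [LHS]integral_mkcond.
  by apply: eq_integral => x _; rewrite /exponential_pdf !patchE; case: ifP.
have -> : (\int[leb]_(x in D) (expR (- (s * x)))%:E =
   s^-1%:E * \int[leb]_(x in D) (s * expR (- s * x))%:E)%E.
  rewrite -ge0_integralZl_EFin //.
  - by apply: eq_integral => x _; rewrite -EFinM mulrA mulVf ?gt_eqF // mul1r mulNr.
  - by move=> x _; rewrite lee_fin mulr_ge0 ?expR_ge0 // ltW.
  - apply/measurable_EFinP; apply: measurable_funTS; apply: measurable_funM => //.
    by under eq_fun do rewrite mulNr; exact: measurable_expRN.
  - by rewrite invr_ge0 ltW.
by rewrite h mule1.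
Qed.

Lemma kappa_laplace s : 0 < s ->
  (\int[kappa]_(x in D) (expR (- (s * x)))%:E)%E = (derive1 Phi s / Phi s)%:E.
Proof.
move=> s0; rewrite -kappaL //.
have mE := measurable_expRN s.
rewrite [in RHS](_ : [set: _] = setT `\` `]-oo, 0%R[%classic `|` `]-oo, 0%R[%classic); last by rewrite classical_sets.setUC classical_sets.setDUK.
rewrite ge0_integral_setU //=; last 3 first.
- exact: measurableD.
- by apply/measurable_EFinP; exact: measurable_funTS.
- by apply/disj_setPS => x [[]].
rewrite [X in (_ + X)%E](_ : _ = 0%E) ?adde0; last first.
  by apply: null_set_integral => //; apply/measurable_EFinP; exact: measurable_funTS.
by rewrite classical_sets.setTD setCitvl.
Qed.

Let F s := ln (Phi s).

Let dF (s : R) : 0 < s -> is_derive s (1 : R) F (derive1 Phi s / Phi s).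
Proof.
move=> s0; have dP : is_derive s (1 : R) Phi (derive1 Phi s).
  by rewrite derive1E; apply/derivableP; exact: dPhi.
rewrite mulrC.
exact: (is_derive1_comp (is_derive1_ln (Phi_gt0 s0)) dP).
Qed.

Let dln (s : R) : 0 < s -> is_derive s (1 : R) (@ln R) s^-1.
Proof. exact: is_derive1_ln. Qed.

Lemma kappa_frullani s t : 0 < s -> s <= t ->
  \int[kappa]_(x in D) frullani s t x = ln (Phi t) - ln (Phi s).
Proof. exact: (integral_frullani dF kappa_laplace). Qed.

Lemma lebesgue_frullani s t : 0 < s -> s <= t -> \int[leb]_(x in D) frullani s t x = ln t - ln s.
Proof. exact: (integral_frullani dln lebesgue_laplace). Qed.

Lemma kappa_integrable_frullani s t : 0 < s -> s <= t -> kappa.-integrable D (EFin \o frullani s t).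
Proof. exact: (integrable_frullani kappa_laplace). Qed.

Lemma lebesgue_integrable_frullani s t : 0 < s -> s <= t -> leb.-integrable D (EFin \o frullani s t).
Proof. exact: (integrable_frullani lebesgue_laplace). Qed.

Let M := exp_moment (fun m => Phi m%:R).

Lemma exp_moment_gt0 m : 0 < M m.
Proof. by apply: prodr_gt0 => j _; rewrite divr_gt0 // Phi_gt0. Qed.

Lemma exp_moment_step m : ln (M m.+1) - ln (M m) = ln m.+1%:R - ln (Phi m.+1%:R).
Proof.
have P0 : 0 < Phi m.+1%:R by exact: Phi_gt0.
have r0 : 0 < m.+1%:R / Phi m.+1%:R by exact: divr_gt0.
rewrite /M /exp_moment big_ord_recr /= lnM ?posrE ?exp_moment_gt0 // ln_div ?posrE //.
by rewrite addrC addKr.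
Qed.

Definition moment_diff m : R := ln (M m) - 2 * ln (M m.+1) + ln (M m.+2).

Lemma moment_diffE m : moment_diff m =
  \int[leb]_(x in D) frullani m.+1%:R m.+2%:R x - \int[kappa]_(x in D) frullani m.+1%:R m.+2%:R x.
Proof.
have m1 : m.+1%:R <= m.+2%:R :> R by rewrite ler_nat.
rewrite lebesgue_frullani // kappa_frullani //.
have := exp_moment_step m; have := exp_moment_step m.+1; rewrite /moment_diff; lra.
Qed.

Let frullaniE m (x : R) : frullani m.+1%:R m.+2%:R x = expR (- x) ^+ m * frullani 1 2 x.
Proof.
have -> : (m.+1%:R : R) = m%:R + 1 by rewrite natr1.
have -> : (m.+2%:R : R) = m%:R + 2 by rewrite -natrD addn2.
by rewrite frullani_shift -expRM_natl mulrN.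
Qed.

Let horner_sum (mu : {measure set (measurableTypeR R) -> \bar R}) (p : {poly R}) :
  (forall m, mu.-integrable D (EFin \o frullani m.+1%:R m.+2%:R)) ->
  mu.-integrable D (EFin \o (fun x => p.[expR (- x)] * frullani 1 2 x)) /\
  \int[mu]_(x in D) (p.[expR (- x)] * frullani 1 2 x) =
  \sum_(i < size p) p`_i * \int[mu]_(x in D) frullani i.+1%:R i.+2%:R x.
Proof.
move=> im.
have E : (fun x : R => p.[expR (- x)] * frullani 1 2 x) =
    (fun x : R => \sum_(i < size p) p`_i * frullani i.+1%:R i.+2%:R x).
  apply/funext => x; rewrite horner_coef mulr_suml; apply: eq_bigr => i _.
  by rewrite frullaniE mulrA.
have [h1 h2] := @Rintegral_sum _ _ R mu D _ (index_enum 'I_(size p))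
   (fun i x => p`_i * frullani i.+1%:R i.+2%:R x) mD (fun i => integrableZl mD p`_i (im i)).
rewrite E; split => //; rewrite h2; apply: eq_bigr => i _.
by rewrite RintegralZl //; exact: im.
Qed.

Lemma moment_diff_poly (p : {poly R}) :
  [/\ leb.-integrable D (EFin \o (fun x => p.[expR (- x)] * frullani 1 2 x)),
  kappa.-integrable D (EFin \o (fun x => p.[expR (- x)] * frullani 1 2 x)) &
  \sum_(i < size p) p`_i * moment_diff i =
  \int[leb]_(x in D) (p.[expR (- x)] * frullani 1 2 x) -
  \int[kappa]_(x in D) (p.[expR (- x)] * frullani 1 2 x)].
Proof.
have mm m : m.+1%:R <= m.+2%:R :> R by rewrite ler_nat.
have [l1 l2] := @horner_sum leb p (fun m => lebesgue_integrable_frullani (ltr0Sn _ _) (mm m)).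
have [k1 k2] := @horner_sum kappa p (fun m => kappa_integrable_frullani (ltr0Sn _ _) (mm m)).
split => //.
rewrite l2 k2 -sumrB; apply: eq_bigr => i _.
by rewrite moment_diffE mulrBr.
Qed.
End second_difference.

(** * Infinite divisibility implies [kappa <= dx] *)

Lemma same_law_integral (R : realType) d1 (T1 : measurableType d1) (P1 : probability T1 R)
  d2 (T2 : measurableType d2) (P2 : probability T2 R) d3 (E : measurableType d3)
  (X1 : T1 -> E) (X2 : T2 -> E) (g : E -> \bar R) :
  measurable_fun setT X1 -> measurable_fun setT X2 ->
  (forall B, measurable B -> P1 (X1 @^-1` B) = P2 (X2 @^-1` B)) ->
  measurable_fun setT g -> (forall x, (0 <= g x)%E) ->
  (\int[P1]_w g (X1 w) = \int[P2]_w g (X2 w))%E.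
Proof.
move=> mX1 mX2 X12 mg g0.
pose Y1 : {mfun T1 >-> E} := mfun_Sub (mem_set mX1).
pose Y2 : {mfun T2 >-> E} := mfun_Sub (mem_set mX2).
transitivity (\int[pushforward P1 Y1]_x g x)%E; first by rewrite ge0_integral_pushforward.
transitivity (\int[pushforward P2 Y2]_x g x)%E; last by rewrite ge0_integral_pushforward.
by apply: eq_measure_integral => B mB _; exact: X12.
Qed.

Lemma mult_inf_div_root (R : realType) d (Omega : measurableType d) (P : probability Omega R)
    (Y : Omega -> \bar R) (M : nat -> R) (n : nat) :
  mult_inf_div P Y -> measurable_fun setT Y ->
  (forall m, 0 < M m) -> (forall m, (\int[P]_w (fine (Y w) ^+ m)%:E = (M m)%:E)%E) ->
  (forall w, (0 <= Y w)%E) -> (2 <= n)%N ->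
  exists (d' : measure_display) (Omega' : measurableType d') (P' : probability Omega' R) (Z : Omega' -> R),
    [/\ measurable_fun setT Z, forall w, 0 < Z w &
     forall m, (\int[P']_w (Z w ^+ m)%:E = (expR (ln (M m) / n%:R))%:E)%E].
Proof.
move=> [_ idY] mY M0 mom Y0 n2.
have [d' [W1 [P' [Z [mZ Z0 iZ sZ pZ]]]]] := idY n n2.
have n0 : (0 < n)%N by exact: ltn_trans n2.
pose i0 := Ordinal n0; exists d', W1, P', (Z i0); split => // m.
have mX (i : 'I_n) : measurable_fun setT (fun x : R => x ^+ m) by exact: measurable_funX.
have Zi i : (\int[P']_w (Z i w ^+ m)%:E = \int[P']_w (Z i0 w ^+ m)%:E)%E.
  pose g x : \bar R := (`|x ^+ m|)%:E.
  have mg : measurable_fun setT g.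
    by apply/measurable_EFinP; apply: measurableT_comp => //; exact: measurable_funX.
  have g0 x : (0 <= g x)%E by rewrite lee_fin.
  have gE j : (\int[P']_w (Z j w ^+ m)%:E = \int[P']_w g (Z j w))%E.
    by apply: eq_integral => w _; rewrite /g ger0_norm // exprn_ge0 // ltW.
  by rewrite !gE; exact: same_law_integral (mZ i) (mZ i0) (sZ i i0) mg g0.
have EM : (\prod_(i < n) \int[P']_w (Z i0 w ^+ m)%:E = (M m)%:E)%E.
  (* [expectation_prod] takes functions that are nonnegative on the whole line, whence the absolute
     value. *)
  transitivity (\prod_(i < n) \int[P']_w (`|Z i w| ^+ m)%:E)%E.
    apply: eq_bigr => i _; rewrite -(Zi i); apply: eq_integral => w _.
    by rewrite gtr0_norm.
  have <- := @expectation_prod _ _ R P' n Z mZ iZ (fun _ x => `|x| ^+ m) _ _.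
  - rewrite -mom.
    pose g (y : \bar R) : \bar R := (`|fine y| ^+ m)%:E.
    have mg : measurable_fun setT g.
      by apply/measurable_EFinP; apply: measurable_funX; do 2 apply: measurableT_comp => //.
    have g0 y : (0 <= g y)%E by rewrite lee_fin exprn_ge0.
    have mpZ : measurable_fun setT (fun w => (\prod_(i < n) Z i w)%:E).
      by apply/measurable_EFinP; exact: measurable_prod.
    have := same_law_integral mpZ mY pZ mg g0.
    rewrite /g => E.
    transitivity (\int[P']_w (`|fine (\prod_(i < n) Z i w)%:E| ^+ m)%:E)%E.
      by apply: eq_integral => w _; rewrite /= normr_prod prodrXl.
    by rewrite E; apply: eq_integral => w _; rewrite ger0_norm // fine_ge0.
  - by move=> i; apply: measurable_funX; exact: normr_measurable.
  - by move=> i x; rewrite exprn_ge0.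
have e0 : (0 <= \int[P']_w (Z i0 w ^+ m)%:E)%E.
  by apply: integral_ge0 => w _; rewrite lee_fin exprn_ge0 // ltW.
(* An infinite moment of one factor would make the product infinite, since [n > 0]. *)
move: EM e0; case: (\int[P']_w _)%E => [e| |] //; last first.
  move=> EM _; exfalso; move: EM.
  have -> : (\prod_(i < n) +oo = +oo :> \bar R)%E; last by [].
  clear -n0; case: n n0 => // k _; elim: k => [|k IH]; first by rewrite big_ord_recl big_ord0 mule1.
  by rewrite big_ord_recl IH mulyy.
rewrite prodEFin prodr_const card_ord => -[EM]; rewrite lee_fin => e0.
have e1 : 0 < e.
  rewrite lt_neqAle e0 andbT eq_sym; apply/eqP => e0'; move: (M0 m).
  by rewrite -EM e0' expr0n gtn_eqF //= ltxx.
congr EFin; rewrite -EM lnXn // -[ln e *+ n]mulr_natr mulfK ?pnatr_eq0 -?lt0n //.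
by rewrite lnK // posrE.
Qed.

(** The limit of [n (M ^ (1 / n) - 1)], with [a = ln M]. The index starts at 2 because the
    definition of divisibility provides roots of order at least 2. *)
Lemma expR_root_cvg (R : realType) (a : R) :
  n.+2%:R * (expR (a / n.+2%:R) - 1) @[n --> \oo] --> a.
Proof.
have inv : n.+2%:R^-1 @[n --> \oo] --> (0 : R) by have := @cvg_harmonic R; rewrite -(cvg_shiftn 1); under eq_fun do rewrite addn1.
have c1 : a * expR (a / n.+2%:R) @[n --> \oo] --> a.
  rewrite -[X in _ --> X]mulr1 -[in X in _ --> X]expR0; apply: cvgM; first exact: cvg_cst.
  apply: (@continuous_cvg _ _ _ _ _ _ expR); first exact: continuous_expR.
  by rewrite -[X in _ --> X](mulr0 a); apply: cvgM => //; exact: cvg_cst.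
apply: (squeeze_cvgr _ (cvg_cst a) c1); apply: nearW => n.
have n0 : 0 < n.+2%:R :> R by [].
rewrite -{1 4}[a](divfK (lt0r_neq0 n0)) [_ * n.+2%:R]mulrC -mulrA.
rewrite !ler_pM2l //; move: (a / n.+2%:R) => x.
have e1 := expR_ge1Dx x; have e2 := expR_ge1Dx (- x); have e0 := expR_gt0 x.
have e3 : expR x * expR (- x) = 1 by rewrite -expRD subrr expR0.
apply/andP; split; first lra.
by have := ler_wpM2l (ltW e0) e2; rewrite mulrDr e3; lra.
Qed.

Lemma second_difference_moments (R : realType) d (T : measurableType d) (P : probability T R) (Z : T -> R)
    (r : nat -> R) (p : {poly R}) :
  measurable_fun setT Z -> (forall w, 0 < Z w) -> (forall m, (\int[P]_w (Z w ^+ m)%:E = (r m)%:E)%E) ->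
  \int[P]_w (p.[Z w] * (1 - Z w) ^+ 2) = \sum_(i < size p) p`_i * (r i - 2 * r i.+1 + r i.+2).
Proof.
move=> mZ Z0 rE.
have iZ m : P.-integrable setT (EFin \o (fun w => Z w ^+ m)).
  apply/integrableP; split; first by apply/measurable_EFinP; exact: measurable_funX.
  rewrite [ltLHS](_ : _ = (r m)%:E) ?ltry // -rE; apply: eq_integral => w _.
  by rewrite gee0_abs // lee_fin exprn_ge0 // ltW.
have i2 m : P.-integrable setT (EFin \o (fun w => 2 * Z w ^+ m)).
  exact: (integrableZl measurableT 2 (iZ m)).
have iB m : P.-integrable setT (EFin \o (fun w => Z w ^+ m - 2 * Z w ^+ m.+1)).
  exact: (integrableB measurableT (iZ m) (i2 m.+1)).
have iD m : P.-integrable setT (EFin \o (fun w => Z w ^+ m - 2 * Z w ^+ m.+1 + Z w ^+ m.+2)).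
  exact: (integrableD measurableT (iB m) (iZ m.+2)).
have E w : p.[Z w] * (1 - Z w) ^+ 2 =
    \sum_(i < size p) p`_i * (Z w ^+ i - 2 * Z w ^+ i.+1 + Z w ^+ i.+2).
  rewrite horner_coef mulr_suml; apply: eq_bigr => i _.
  by rewrite !exprS; ring.
under eq_Rintegral do rewrite E.
have [_ ->] := @Rintegral_sum _ _ R P setT _ (index_enum 'I_(size p))
  (fun i w => p`_i * (Z w ^+ i - 2 * Z w ^+ i.+1 + Z w ^+ i.+2))
  measurableT (fun i => integrableZl measurableT p`_i (iD i)).
apply: eq_bigr => i _; rewrite RintegralZl; [|by []|exact: (iD i)].
rewrite RintegralD; [|by []|exact: (iB i)|exact: (iZ i.+2)].
rewrite RintegralB; [|by []|exact: (iZ i)|exact: (i2 i.+1)].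
rewrite RintegralZl; [|by []|exact: (iZ i.+1)].
by rewrite /Rintegral !rE.
Qed.

Section necessity.
Context (R : realType) (d : measure_display) (Omega : measurableType d) (P : probability Omega R)
  (Y : Omega -> \bar R).
Local Notation D := (`[0%R, +oo[%classic : set R).
Let leb : {measure set (measurableTypeR R) -> \bar R} := @lebesgue_measure R.
Variables (Phi : R -> R) (kappa : {measure set (measurableTypeR R) -> \bar R}).
Hypothesis Phi_gt0 : forall s, 0 < s -> 0 < Phi s.
Hypothesis dPhi : forall s, 0 < s -> derivable Phi s 1.
Hypothesis kappa0 : kappa `]-oo, 0%R[%classic = 0%E.
Hypothesis kappaL : forall s, 0 < s ->
     (\int[kappa]_x (expR (- (s * x)))%:E)%E = (derive1 Phi s / Phi s)%:E.
Let M := exp_moment (fun m => Phi m%:R).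
Hypothesis mY : measurable_fun setT Y.
Hypothesis Y0 : forall w, (0 <= Y w)%E.
Hypothesis YM : forall m, (\int[P]_w (fine (Y w) ^+ m)%:E = (M m)%:E)%E.
Hypothesis idY : mult_inf_div P Y.

Let moment_diff_sqr_ge0 (p : {poly R}) :
  0 <= \sum_(i < size (p ^+ 2)) (p ^+ 2)`_i * moment_diff Phi i.
Proof.
pose r n m := expR (ln (M m) / n.+2%:R).
pose c n m := n.+2%:R * (r n m - 1).
have cE m : c n m @[n --> \oo] --> ln (M m) by exact: expR_root_cvg.
have cv : \sum_(i < size (p ^+ 2)) (p ^+ 2)`_i * (c n i - 2 * c n i.+1 + c n i.+2) @[n --> \oo] -->
    \sum_(i < size (p ^+ 2)) (p ^+ 2)`_i * moment_diff Phi i.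
  apply: cvgn_sum => i; apply: cvgM; first exact: cvg_cst.
  by apply: cvgD => //; apply: cvgB => //; apply: cvgM => //; exact: cvg_cst.
rewrite -(cvg_lim (@Rhausdorff R) cv); apply: limr_ge; first by apply/cvg_ex; eexists; exact: cv.
apply: nearW => n.
have [d' [W1 [P' [Z [mZ Z0 ZM]]]]] := mult_inf_div_root idY mY (exp_moment_gt0 Phi_gt0) YM Y0 (isT : (2 <= n.+2)%N).
(* The constant -1 in [c] cancels in a second difference. *)
have -> : \sum_(i < size (p ^+ 2)) (p ^+ 2)`_i * (c n i - 2 * c n i.+1 + c n i.+2) =
    n.+2%:R * \sum_(i < size (p ^+ 2)) (p ^+ 2)`_i * (r n i - 2 * r n i.+1 + r n i.+2).
  by rewrite mulr_sumr; apply: eq_bigr => i _; rewrite /c; ring.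
rewrite -(second_difference_moments (p ^+ 2) mZ Z0 ZM) mulr_ge0 // Rintegral_ge0 // => w _.
by rewrite horner_exp mulr_ge0 // sqr_ge0.
Qed.

Let h x : R := frullani 1 2 x.

Let h_bounds x : 0 <= x -> expR (- (2 * x)) <= h x <= expR (- x).
Proof.
move=> x0; have := @frullani_bounds R 1 2 x _ x0; rewrite ler1n => /(_ isT).
by rewrite (_ : 2 - 1 = 1 :> R) ?mul1r //; lra.
Qed.

Let mD : measurable (D : set (measurableTypeR R)). Proof. exact: measurable_itv. Qed.

Let integral_sqr_le (p : {poly R}) :
  (\int[kappa]_(x in D) (p.[expR (- x)] ^+ 2 * h x)%:E <= \int[leb]_(x in D) (p.[expR (- x)] ^+ 2 * h x)%:E)%E.
Proof.
have [i1 i2 E] := moment_diff_poly Phi_gt0 dPhi kappa0 kappaL (p ^+ 2).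
have := moment_diff_sqr_ge0 p; rewrite E subr_ge0 /Rintegral => le.
under eq_integral do rewrite -horner_exp.
under [leRHS]eq_integral do rewrite -horner_exp.
rewrite -[leLHS]fineK; last exact: integrable_fin_num i2.
rewrite -[leRHS]fineK; last exact: integrable_fin_num i1.
by rewrite lee_fin.
Qed.

Let mpoly (p : {poly R}) : measurable_fun setT (fun x : R => p.[expR (- x)]).
Proof.
under eq_fun do rewrite horner_coef.
apply: measurable_sum => i; apply: measurable_funM => //; apply: measurable_funX.
by apply: measurableT_comp.
Qed.

Let mh : measurable_fun setT h. Proof. exact: measurable_frullani. Qed.

Let msqr (p : {poly R}) : measurable_fun setT (fun x : R => (p.[expR (- x)] ^+ 2 * h x)%:E).
Proof. by apply/measurable_EFinP; apply: measurable_funM => //; apply: measurable_funX. Qed.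

(** An atom at 0 is detected by [p = 'X ^+ n]: the integrand [expR (- x) ^+ (2 * n) * h x] equals 1
    at 0, while its Lebesgue integral is at most [1 / (2 * n + 1)]. *)
Let kappa_pt0 : kappa [set 0] = 0%E.
Proof.
have le n : (kappa [set 0%R] <= ((2 * n).+1%:R^-1)%:E)%E.
  apply: (@le_trans _ _ (\int[kappa]_(x in D) (('X ^+ n : {poly R}).[expR (- x)] ^+ 2 * h x)%:E)%E).
    have -> : kappa [set 0%R] = (\int[kappa]_(x in [set 0%R]) (('X ^+ n : {poly R}).[expR (- x)] ^+ 2 * h x)%:E)%E.
      rewrite -[LHS]mul1e -integral_cst //; apply: eq_integral => x /set_mem /= ->.
      by rewrite hornerXn oppr0 expR0 !expr1n mul1r /h /frullani eqxx; congr EFin; lra.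
    apply: ge0_subset_integral => //.
    - by apply: measurable_funTS; exact: msqr.
    - move=> x /=; rewrite in_itv /= andbT => x0; rewrite lee_fin mulr_ge0 ?sqr_ge0 //.
      by have /andP[+ _] := h_bounds x0; apply: le_trans; exact: expR_ge0.
    - by move=> x /= ->; rewrite in_itv /= lexx.
  apply: le_trans (integral_sqr_le _) _.
  rewrite -(lebesgue_laplace (ltr0Sn R (2 * n))); apply: ge0_le_integral => //.
  - move=> x /=; rewrite in_itv /= andbT => x0; rewrite lee_fin mulr_ge0 ?sqr_ge0 //.
    by have /andP[+ _] := h_bounds x0; apply: le_trans; exact: expR_ge0.
  - by apply: measurable_funTS; exact: msqr.
  - by apply/measurable_EFinP; apply: measurable_funTS; exact: measurable_expRN.
  - move=> x /=; rewrite in_itv /= andbT => x0; rewrite lee_fin hornerXn -exprM -expRM_natl.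
    have /andP[h0 h1] := h_bounds x0.
    have -> : - ((2 * n).+1%:R * x) = (n * 2)%N%:R * - x + - x by rewrite -natr1 !natrM; ring.
    by rewrite expRD ler_wpM2l ?expR_ge0.
apply/eqP; rewrite eq_le measure_ge0 andbT.
have cv : (2 * n).+1%:R^-1 @[n --> \oo] --> (0 : R).
  apply: (squeeze_cvgr _ (cvg_cst 0) (@cvg_harmonic R)); apply: nearW => n.
  by rewrite invr_ge0 ler0n /= lef_pV2 ?posrE // ler_nat ltnS leq_pmull.
have cvE : (((2 * n).+1%:R^-1)%:E)%E @[n --> \oo] --> (0%E : \bar R).
  by apply: cvg_EFin; [exact: nearW|exact: cv].
rewrite -(cvg_lim (@ereal_hausdorff R) cvE); apply: lime_ge; last exact: nearW.
by apply/cvg_ex; exists 0%E; exact: cvE.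
Qed.

Section interval.
Variables a b : R.
Hypotheses (a0 : 0 <= a) (ab : a < b).

(* With [z = exp (- x)], [test z ^+ 2] is the inverse of [h x] on the open interval. *)
Let test (z : R) : R := if (expR (- b) < z) && (z < expR (- a)) then Num.sqrt (- ln z / (z - z ^+ 2)) else 0.

Let testE x : test (expR (- x)) = if (a < x) && (x < b) then Num.sqrt (h x)^-1 else 0.
Proof.
rewrite /test !ltr_expR !ltrN2 andbC; case: ifP => // /andP[ax _].
have x0 : x != 0 by rewrite gt_eqF // (le_lt_trans a0).
rewrite expRK opprK /h /frullani (negbTE x0) invf_div; congr (Num.sqrt (_ / (expR _ - _))).
  by rewrite mul1r.
by rewrite -expRM_natl mulrN.
Qed.

(** On the interval [h x >= expR (- (2 * b))], and [test] is the square root of the inverse of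
    [h]. *)
Let test_bnd z : `|test z| <= expR b.
Proof.
rewrite /test; case: ifPn => [/andP[bz za]|_]; last by rewrite normr0 expR_ge0.
have zp : 0 < z by exact: lt_trans (expR_gt0 _) bz.
have -> : z = expR (- (- ln z)) by rewrite opprK lnK.
have : test (expR (- (- ln z))) = test z by rewrite opprK lnK.
set x := - ln z.
have ax : (a < x) && (x < b).
  rewrite /x ltrNr ltrNl -(ltr_expR (ln z)) -(ltr_expR _ (ln z)) lnK ?posrE //.
  by rewrite za bz.
rewrite testE ax /test -/x => _.
have x0 : 0 < x by have /andP[+ _] := ax; exact: le_lt_trans.
have h1 : expR (- (2 * b)) <= h x.
  have /andP[+ _] := h_bounds (ltW x0); apply: le_trans.
  by rewrite ler_expR lerN2 ler_pM2l // ltW //; case/andP: ax.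
have -> : - ln (expR (- x)) / (expR (- x) - expR (- x) ^+ 2) = (h x)^-1.
  rewrite expRK opprK /h /frullani gt_eqF // invf_div; congr (_ / (expR _ - _)); rewrite ?mul1r //.
  by rewrite -expRM_natl mulrN.
rewrite ger0_norm ?sqrtr_ge0 // -[expR b]ger0_norm ?expR_ge0 // -sqrtr_sqr ler_wsqrtr //.
rewrite -expRM_natl -[_ * b]opprK expRN lef_pV2 ?posrE ?expR_gt0 //.
exact: lt_le_trans (expR_gt0 _) h1.
Qed.

Let test_cont x : 0 <= x -> x != a -> x != b -> {for expR (- x), continuous test}.
Proof.
move=> x0 xa xb.
have ez : 0 < expR (- x) by exact: expR_gt0.
have [/andP[ax xb']|axb] := boolP ((a < x) && (x < b)).
  have x0' : 0 < x by exact: le_lt_trans ax.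
  have nz : \forall z \near expR (- x), Num.sqrt (- ln z / (z - z ^+ 2)) = test z.
    have : \forall z \near expR (- x), z \in `]expR (- b), expR (- a)[.
      by apply: near_in_itvoo; rewrite in_itv /= !ltr_expR !ltrN2 ax xb'.
    by apply: filterS => z; rewrite in_itv /= /test => ->.
  have tx : test (expR (- x)) = Num.sqrt (- ln (expR (- x)) / (expR (- x) - expR (- x) ^+ 2)).
    by rewrite /test !ltr_expR !ltrN2 ax xb'.
  suff : Num.sqrt (- ln z / (z - z ^+ 2)) @[z --> expR (- x)] --> test (expR (- x)).
    by apply: cvg_trans; exact: near_eq_cvg nz.
  rewrite tx.
  apply: (@continuous_cvg _ _ _ _ _ _ Num.sqrt); first exact: sqrt_continuous.
  apply: cvgM.
    apply: cvgN; exact: (continuous_ln ez).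
  apply: cvgV; last by apply: cvgB => //; exact: exprn_continuous.
  rewrite subr_eq0 -expRM_natl gt_eqF // ltr_expR; lra.
have nz : \forall z \near expR (- x), 0 = test z.
  have [xlt|ax] := ltP x a.
    have : \forall z \near expR (- x), z \in `]expR (- a), expR (- x) + 1[.
      by apply: near_in_itvoo; rewrite in_itv /= ltr_expR ltrN2 xlt ltrDl /=.
    apply: filterS => z; rewrite in_itv /= => /andP[za _]; by rewrite /test [z < _]ltNge (ltW za) andbF.
  have bx : b < x.
    by rewrite lt_neqAle eq_sym xb leNgt; apply: contra axb => ->; rewrite lt_neqAle eq_sym xa ax.
  have : \forall z \near expR (- x), z \in `]expR (- x) - 1, expR (- b)[.
    by apply: near_in_itvoo; rewrite in_itv /= ltr_expR ltrN2 bx andbT; lra.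
  apply: filterS => z; rewrite in_itv /= => /andP[_ zb]; by rewrite /test [_ < z]ltNge (ltW zb).
change (test z @[z --> expR (- x)] --> test (expR (- x))).
rewrite testE (negbTE axb).
by apply: cvg_trans (near_eq_cvg nz) _; exact: cvg_cst.
Qed.

Let B n := bernstein n.+1 (fun k => test (k%:R / n.+1%:R)).
Let J := `]a, b[%classic : set R.

Let B_cvg x : 0 <= x -> x != a -> x != b ->
  (B n).[expR (- x)] ^+ 2 * h x @[n --> \oo] --> (\1_J x : R).
Proof.
move=> x0 xa xb.
have z01 : 0 <= expR (- x) <= 1 by rewrite expR_ge0 -[leRHS]expR0 ler_expR oppr_le0.
have c : (B n).[expR (- x)] @[n --> \oo] --> test (expR (- x)).
  exact: (bernstein_cvg z01 test_bnd (test_cont x0 xa xb)).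
have -> : \1_J x = test (expR (- x)) ^+ 2 * h x.
  rewrite indicE testE; case: ifPn => axb.
    have /andP[h0 _] := h_bounds x0.
    have hx : 0 < h x by exact: lt_le_trans (expR_gt0 _) h0.
    by rewrite sqr_sqrtr ?invr_ge0 ?(ltW hx) // mulVf ?gt_eqF // mem_set //= in_itv /= axb.
  by rewrite memNset ?expr0n ?mul0r // /J /= in_itv /=; exact/negP.
by apply: cvgM; [exact: cvg_exprn|exact: cvg_cst].
Qed.

Let BM n x : 0 <= x -> (B n).[expR (- x)] ^+ 2 * h x <= expR b ^+ 2 * expR (- x).
Proof.
move=> x0; have /andP[h0 h1] := h_bounds x0.
have z01 : 0 <= expR (- x) <= 1 by rewrite expR_ge0 -[leRHS]expR0 ler_expR oppr_le0.
rewrite ler_pM ?sqr_ge0 //; first exact: le_trans (expR_ge0 _) h0.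
rewrite -[leLHS]ger0_norm ?sqr_ge0 // normrX lerXn2r ?nnegrE ?expR_ge0 //.
by apply: bernstein_bounded => // k; exact: test_bnd.
Qed.

Let sqr_ge0' n x : 0 <= x -> 0 <= (B n).[expR (- x)] ^+ 2 * h x.
Proof.
by move=> x0; have /andP[h0 _] := h_bounds x0; rewrite mulr_ge0 ?sqr_ge0 // (le_trans (expR_ge0 _) h0).
Qed.

Let ab_null : {ae leb, forall x, x != a /\ x != b}.
Proof.
have pt (c : R) : {ae leb, forall x, x != c}.
  exists [set c]; split; [exact: measurable_set1|exact: lebesgue_measure_set1|].
  by move=> x /= /negP; rewrite negbK => /eqP.
apply: negligibleS (negligibleU (pt a) (pt b)) => x /= nx.
by apply: contrapT => /not_orP[/contrapT xa /contrapT xb]; exact: nx.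
Qed.

Let mJ : measurable (J : set (measurableTypeR R)). Proof. exact: measurable_itv. Qed.

Let lebesgue_cvg :
  (fun n => \int[leb]_(x in D) ((B n).[expR (- x)] ^+ 2 * h x)%:E)%E @ \oo --> (b - a)%:E.
Proof.
have -> : (b - a)%:E = (\int[leb]_(x in D) (\1_J x : R)%:E)%E.
  rewrite integral_indic; [|exact: mD|exact: mJ].
  have -> : J `&` D = J.
    apply: setIidl => x /=; rewrite !in_itv /= andbT => /andP[ax _].
    exact: le_trans a0 (ltW ax).
  have E : lebesgue_measure (J : set R) = (b - a)%:E by rewrite lebesgue_measure_itv /= lte_fin ab EFinB.
  exact/esym/E.
have [] := @dominated_convergence _ _ _ leb D mD (fun n x => ((B n).[expR (- x)] ^+ 2 * h x)%:E)
   (fun x => (\1_J x : R)%:E) (fun x => (expR b ^+ 2 * expR (- x))%:E).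
- by move=> n; apply: measurable_funTS; exact: msqr.
- by apply: measurable_funTS; apply/measurable_EFinP; exact: measurable_indic.
- apply: negligibleS ab_null => x /= + [xa xb]; apply; rewrite in_itv /= andbT => x0.
  by apply: cvg_EFin; [exact: nearW|exact: B_cvg].
- have := integrableZl mD (expR b ^+ 2) (@integrable_expRN R leb _ (@lebesgue_laplace R) 1 ltr01).
  apply: eq_integrable => // x _; by rewrite mul1r.
- apply: aeW => x n /=; rewrite in_itv /= andbT => x0.
  by rewrite lee_fin ger0_norm ?sqr_ge0' // BM.
by move=> _ _.
Qed.

(** Dominated convergence on the Lebesgue side, Fatou's lemma on the side of [kappa]. The limit is
    not known at [a] and [b]: these points are null for Lebesgue measure, and the indicator of the
    open interval removes them before Fatou's lemma is applied. *)
Lemma kappa_open_itv : (kappa J <= (b - a)%:E)%E.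
Proof.
pose c n := fine (\int[leb]_(x in D) ((B n).[expR (- x)] ^+ 2 * h x)%:E)%E.
have cE n : (\int[leb]_(x in D) ((B n).[expR (- x)] ^+ 2 * h x)%:E = (c n)%:E)%E.
  rewrite /c fineK //; have [i1 _ _] := moment_diff_poly Phi_gt0 dPhi kappa0 kappaL (B n ^+ 2).
  have := integrable_fin_num mD i1.
  by congr (_ \is a fin_num); apply: eq_integral => x _; rewrite /= horner_exp.
have cv : c n @[n --> \oo] --> b - a by exact: (fine_cvg lebesgue_cvg).
have -> : kappa J = (\int[kappa]_x (\1_J x : R)%:E)%E by rewrite integral_indic ?setIT.
apply: (@fatou_le _ _ _ kappa (fun n x => (\1_J x * ((B n).[expR (- x)] ^+ 2 * h x))%:E) _ c) => //.
- move=> n; apply/measurable_EFinP; apply: measurable_funM; first exact: measurable_indic.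
  by apply/measurable_EFinP; exact: msqr.
- by apply/measurable_EFinP; exact: measurable_indic.
- move=> n x; rewrite lee_fin indicE; case: (boolP (x \in J)); rewrite ?mul0r // mul1r => /set_mem.
  by rewrite /J /= in_itv /= => /andP[ax _]; apply: sqr_ge0'; exact: le_trans a0 (ltW ax).
- apply: aeW => x; apply: cvg_EFin; first exact: nearW.
  rewrite /= indicE; case: (boolP (x \in J)); last first.
    by move=> _; apply: cvg_near_cst; apply: nearW => n /=; rewrite mul0r.
  move=> xJ; have := set_mem xJ; rewrite /J /= in_itv /= => /andP[ax xb].
  have := @B_cvg x (le_trans a0 (ltW ax)); rewrite gt_eqF // lt_eqF // => /(_ isT isT).
  rewrite indicE xJ; apply: cvg_trans; apply: near_eq_cvg; apply: nearW => n /=; by rewrite mul1r.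
- move=> n; rewrite -cE; apply: le_trans (integral_sqr_le _).
  rewrite [leRHS]integral_mkcond; apply: ge0_le_integral => //.
  + move=> x _; rewrite lee_fin indicE; case: (boolP (x \in J)); rewrite ?mul0r // mul1r => /set_mem.
    by rewrite /J /= in_itv /= => /andP[ax _]; apply: sqr_ge0'; exact: le_trans a0 (ltW ax).
  + apply/measurable_EFinP; apply: measurable_funM; first exact: measurable_indic.
    by apply/measurable_EFinP; exact: msqr.
  + by apply/measurable_restrict => //; apply: measurable_funTS; exact: msqr.
  + move=> x _; rewrite patchE indicE; case: (boolP (x \in J)).
      move=> /set_mem; rewrite /J /= in_itv /= => /andP[ax _].
      by rewrite mem_set ?mul1r //= in_itv /= (le_trans a0 (ltW ax)).
    move=> _; rewrite mul0r; case: ifPn => // /set_mem /=; rewrite in_itv /= andbT => x0.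
    by rewrite lee_fin sqr_ge0'.
Qed.
End interval.

(** An interval reaching below 0 is cut there: [kappa] vanishes on the negative half-line and has no
    atom at 0. *)
Let kappa_itv (a b : R) : a < b -> (kappa `]a, b[%classic <= (b - a)%:E)%E.
Proof.
move=> ab; have [a0|a0] := leP 0 a; first exact: kappa_open_itv.
have m1 (i : interval R) : measurable ([set` i] : set (measurableTypeR R)) by exact: measurable_itv.
have m0 : measurable ([set 0] : set (measurableTypeR R)) by exact: measurable_set1.
have : `]a, b[ `<=` `]-oo, 0[ `|` ([set 0] `|` `]0, Num.max 0 b[).
  move=> x /=; rewrite !in_itv /= => /andP[_ xb].
  have [x0|x0|->] := ltgtP x 0; [by left|right; right|by right; left].
  by rewrite lt_max xb orbT.
have mU : measurable ([set 0] `|` `]0, Num.max 0 b[%classic : set (measurableTypeR R)) by exact: measurableU.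
move=> /(le_measure kappa (mem_set (m1 _)) (mem_set (measurableU _ _ (m1 `]-oo, 0[) mU))) le.
apply: le_trans le _.
apply: le_trans (measureU2 _ (m1 _) mU) _.
rewrite [X in (X + _)%E](_ : _ = 0%E) ?add0e; last exact: kappa0.
apply: le_trans (measureU2 _ m0 (m1 _)) _.
rewrite [X in (X + _)%E](_ : _ = 0%E) ?add0e; last exact: kappa_pt0.
have [b0|b0] := leP b 0; last first.
  apply: le_trans (kappa_open_itv (lexx 0) b0) _; rewrite lee_fin; lra.
by rewrite set_itvoo0 measure0 lee_fin subr_ge0 ltW.
Qed.

(** Lebesgue measure is the infimum of total lengths over countable covers by open intervals, so the
    bound on intervals extends by subadditivity of [kappa]. *)
Lemma kappa_le_lebesgue (A : set (measurableTypeR R)) : measurable A -> (kappa A <= lebesgue_measure A)%E.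
Proof.
move=> mA.
have -> : @lebesgue_measure R A = ((@wlength R idfun)^* A)%mu by [].
rewrite outer_measure_open_itv_cover; apply: le_ereal_inf_tmp => _ [F [Fitv AF] <-].
have mF k : measurable (F k : set (measurableTypeR R)).
  by have [[x y] /= ->] := Fitv k; exact: measurable_itv.
apply: le_trans (@measure_sigma_subadditive _ _ _ kappa A F mF mA AF) _.
apply: lee_nneseries => k _; first by [].
have [[x y] /= ->] := Fitv k; have [xy|yx] := ltP x y.
  by rewrite wlength_itv /= lte_fin xy -EFinB; exact: kappa_itv.
by rewrite set_itv_ge ?measure0 ?wlength0 // bnd_simp -leNgt.
Qed.
End necessity.

(** * Infinitely divisible laws as limits of sums *)

Section characteristic_function.
Context (R : realType).

(** Complex values turn independent sums into products, and the comparison with the limit into one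
    estimate on powers. *)
Definition charf d (T : measurableType d) (P : probability T R) (X : T -> R) (u : R) : R[i] :=
  Complex (\int[P]_w cos (u * X w)) (\int[P]_w sin (u * X w)).

Lemma measurable_cosX d (T : measurableType d) (X : T -> R) u :
  measurable_fun setT X -> measurable_fun setT (fun w => cos (u * X w)).
Proof.
move=> mX; apply: measurableT_comp; last exact: measurable_funM.
by apply: continuous_measurable_fun; exact: continuous_cos.
Qed.

Lemma measurable_sinX d (T : measurableType d) (X : T -> R) u :
  measurable_fun setT X -> measurable_fun setT (fun w => sin (u * X w)).
Proof.
move=> mX; apply: measurableT_comp; last exact: measurable_funM.
by apply: continuous_measurable_fun; exact: continuous_sin.
Qed.

Lemma norm_cos_le1 (x : R) : `|cos x| <= 1.
Proof. by rewrite ler_norml cos_le1 cos_geN1. Qed.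

Lemma norm_sin_le1 (x : R) : `|sin x| <= 1.
Proof. by rewrite ler_norml sin_le1 sin_geN1. Qed.

Lemma integrable_cosX d (T : measurableType d) (P : probability T R) (X : T -> R) u :
  measurable_fun setT X -> P.-integrable setT (EFin \o (fun w => cos (u * X w))).
Proof.
move=> mX; apply: (@bounded_integrable _ _ _ _ _ 1); first exact: measurable_cosX.
by move=> w; exact: norm_cos_le1.
Qed.

Lemma integrable_sinX d (T : measurableType d) (P : probability T R) (X : T -> R) u :
  measurable_fun setT X -> P.-integrable setT (EFin \o (fun w => sin (u * X w))).
Proof.
move=> mX; apply: (@bounded_integrable _ _ _ _ _ 1); first exact: measurable_sinX.
by move=> w; exact: norm_sin_le1.
Qed.

(* Integrate [a cos + b sin <= (a^2 + b^2 + 1) / 2] with (a, b) the value of [charf]. *)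
Lemma charf_norm_le1 d (T : measurableType d) (P : probability T R) (X : T -> R) u :
  measurable_fun setT X -> `|charf P X u| <= 1.
Proof.
move=> mX; set a := \int[P]_w cos (u * X w); set b := \int[P]_w sin (u * X w).
have ic := integrable_cosX P u mX; have is_ := integrable_sinX P u mX.
have iac : P.-integrable setT (EFin \o (fun w => a * cos (u * X w))).
  exact: (integrableZl measurableT a ic).
have ibs : P.-integrable setT (EFin \o (fun w => b * sin (u * X w))).
  exact: (integrableZl measurableT b is_).
pose c := (a ^+ 2 + b ^+ 2 + 1) / 2.
have icst : P.-integrable setT (EFin \o (fun=> c : R)).
  by apply: (@bounded_integrable _ _ _ _ _ `|c|).
have : a ^+ 2 + b ^+ 2 <= c.
  have {1}-> : a ^+ 2 + b ^+ 2 = \int[P]_w (a * cos (u * X w) + b * sin (u * X w)).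
    by rewrite RintegralD // RintegralZl // RintegralZl // !expr2.
  have -> : c = \int[P]_w c by rewrite Rintegral_cst //= probability_setT mulr1.
  apply: (le_Rintegral measurableT (integrableD measurableT iac ibs) icst) => w _.
  have := cos2Dsin2 (u * X w); have := sqr_ge0 (a - cos (u * X w)); have := sqr_ge0 (b - sin (u * X w)).
  by rewrite !sqrrB /c; lra.
rewrite /c => ab.
rewrite normc_def /= -/a -/b -[1]/(1%:C)%C lecR -sqrtr1 ler_wsqrtr //; lra.
Qed.

Section product.
Context d1 (T1 : measurableType d1) (P1 : probability T1 R) d2 (T2 : measurableType d2)
  (P2 : probability T2 R).

Lemma bounded_fubini (F : T1 * T2 -> R) : measurable_fun setT F -> (forall z, `|F z| <= 1) ->
  \int[(P1 \x P2)%E]_z F z = \int[P1]_x (\int[P2]_y F (x, y)).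
Proof.
move=> mF F1.
have iF : (P1 \x P2)%E.-integrable setT (EFin \o F).
  exact: (@bounded_integrable _ _ _ (P1 \x P2)%E F 1).
rewrite /Rintegral -integral12_prod_meas1 //; congr fine.
apply: eq_integral => x _; rewrite /fubini_F fineK //.
apply: integrable_fin_num => //; apply: (@bounded_integrable _ _ _ _ _ 1) => //.
by apply: measurableT_comp mF _; exact: measurable_pair1.
Qed.

Lemma charf_prod (X1 : T1 -> R) (X2 : T2 -> R) u :
  measurable_fun setT X1 -> measurable_fun setT X2 ->
  charf (P1 \x P2)%E (fun z => X1 z.1 + X2 z.2) u = charf P1 X1 u * charf P2 X2 u.
Proof.
move=> m1 m2.
have m12 : measurable_fun setT (fun z : T1 * T2 => X1 z.1 + X2 z.2).
  apply: measurable_funD; first exact: measurableT_comp measurable_fst.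
  exact: measurableT_comp measurable_snd.
have c1 := integrable_cosX P1 u m1; have s1 := integrable_sinX P1 u m1.
have c2 := integrable_cosX P2 u m2; have s2 := integrable_sinX P2 u m2.
set a := \int[P2]_w cos (u * X2 w); set b := \int[P2]_w sin (u * X2 w).
have ic (r : R) : P2.-integrable setT (EFin \o (fun y => r * cos (u * X2 y))).
  exact: (integrableZl measurableT r c2).
have is_ (r : R) : P2.-integrable setT (EFin \o (fun y => r * sin (u * X2 y))).
  exact: (integrableZl measurableT r s2).
have jc (r : R) : P1.-integrable setT (EFin \o (fun y => cos (u * X1 y) * r)).
  exact: (integrableZr measurableT r c1).
have js (r : R) : P1.-integrable setT (EFin \o (fun y => sin (u * X1 y) * r)).
  exact: (integrableZr measurableT r s1).
rewrite /charf -/a -/b; apply/eqP; rewrite eq_complex /=; apply/andP; split; apply/eqP.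
  rewrite bounded_fubini; [|exact: measurable_cosX|by move=> z; exact: norm_cos_le1].
  transitivity (\int[P1]_x (cos (u * X1 x) * a - sin (u * X1 x) * b)).
    apply: eq_Rintegral => x _.
    under eq_Rintegral do rewrite mulrDr cosD /=.
    rewrite RintegralB; [|by []|exact: ic|exact: is_].
    by rewrite RintegralZl // RintegralZl.
  rewrite RintegralB; [|by []|exact: jc|exact: js].
  by rewrite RintegralZr // RintegralZr.
rewrite bounded_fubini; [|exact: measurable_sinX|by move=> z; exact: norm_sin_le1].
transitivity (\int[P1]_x (sin (u * X1 x) * a + cos (u * X1 x) * b)).
  apply: eq_Rintegral => x _.
  under eq_Rintegral do rewrite mulrDr sinD /=.
  rewrite RintegralD; [|by []|exact: ic|exact: is_].
  by rewrite RintegralZl // RintegralZl.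
rewrite RintegralD; [|by []|exact: js|exact: jc].
by rewrite RintegralZr // RintegralZr // addrC.
Qed.
End product.

(** One more factor [T] is adjoined at each step. The copies are indexed by [nat], so that their
    type does not depend on [n]; indices past the last copy are fillers. *)
Lemma iid_copies d (T : measurableType d) (P : probability T R) (Q : T -> R) n :
  measurable_fun setT Q ->
  exists d' (T' : measurableType d') (P' : probability T' R) (Z : nat -> T' -> R),
    [/\ forall i, measurable_fun setT (Z i),
        indep_RVs P' (fun i : 'I_n => Z i),
        forall (i : 'I_n) (B : set R), measurable B -> P' (Z i @^-1` B) = P (Q @^-1` B) &
        forall u, charf P' (fun w => \sum_(i < n) Z i w) u = charf P Q u ^+ n].
Proof.
move=> mQ; elim: n => [|n [d1 [T1 [P1 [Z [mZ iZ lZ cZ]]]]]].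
  exists d, T, P, (fun=> cst 0); split => //; last 2 first.
  - by move=> [].
  - move=> u; rewrite /charf expr0.
    under eq_Rintegral do rewrite big_ord0 mulr0 cos0.
    under [X in (_ +i* X)%C]eq_Rintegral do rewrite big_ord0 mulr0 sin0.
    by rewrite !Rintegral_cst //= probability_setT mulr1 mul0r.
  - move=> B _; rewrite big_ord0 (_ : \bigcap_(i in _) _ = setT) ?probability_setT //.
    by apply/seteqP; split => // w _ [].
pose Z2 i (z : T1 * T) := if (i < n)%N then Z i z.1 else Q z.2.
have mpre (T0 : measurableType _) (V : T0 -> R) : measurable_fun setT V ->
    forall B : set R, measurable B -> measurable (V @^-1` B).
  by move=> mV B mB; rewrite -[X in measurable X]setTI; exact: mV.
pose PP : probability (T1 * T)%type R := (P1 \x P)%E.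
have PPE (A1 : set T1) (A2 : set T) : measurable A1 -> measurable A2 ->
    PP (A1 `*` A2) = (P1 A1 * P A2)%E by exact: product_measure1E.
exists _, (T1 * T)%type, PP, Z2; split.
- move=> i; rewrite /Z2; case: (i < n)%N.
    exact: measurableT_comp (mZ i) measurable_fst.
  exact: measurableT_comp mQ measurable_snd.
- move=> B mB.
  have -> : \bigcap_(i in [set: 'I_n.+1]) (Z2 i @^-1` B i) =
      (\bigcap_(i in [set: 'I_n]) (Z i @^-1` B (widen_ord (leqnSn n) i))) `*` (Q @^-1` B ord_max).
    apply/seteqP; split => [[x y] /= h|[x y] /= [h1 h2] i _].
      split; last by have := h ord_max I; rewrite /Z2 /= ltnn.
      by move=> i _ /=; have := h (widen_ord (leqnSn n) i) I; rewrite /Z2 /= ltn_ord.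
    rewrite /Z2 /=; case: ifPn => [ilt|].
      have := h1 (Ordinal ilt) I; rewrite /= (_ : widen_ord _ _ = i) //; exact: val_inj.
    by rewrite -leqNgt => ni; rewrite (_ : i = ord_max) //; apply: val_inj; apply/eqP; rewrite eqn_leq ni -ltnS ltn_ord.
  rewrite PPE; last 2 first.
  - by apply: fin_bigcap_measurable => // i _; apply: mpre.
  - exact: mpre.
  rewrite iZ // big_ord_recr /=; congr (_ * _)%E.
    apply: eq_bigr => i _.
    have -> : Z2 i @^-1` B (widen_ord (leqnSn n) i) = (Z i @^-1` B (widen_ord (leqnSn n) i)) `*` setT.
      by apply/seteqP; split => [[x y]|[x y] []]; rewrite /= /Z2 /= ltn_ord.
    by rewrite PPE //; [rewrite probability_setT mule1|exact: mpre].
  have -> : Z2 n @^-1` B ord_max = setT `*` (Q @^-1` B ord_max).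
    by apply/seteqP; split => [[x y]|[x y] []]; rewrite /= /Z2 /= ltnn.
  by rewrite PPE //; [rewrite probability_setT mul1e|exact: mpre].
- move=> i B mB; have [ilt|ni] := ltnP i n.
    have -> : Z2 i @^-1` B = (Z i @^-1` B) `*` setT.
      by apply/seteqP; split => [[x y]|[x y] []]; rewrite /= /Z2 /= ilt.
    rewrite PPE //; [rewrite probability_setT mule1|exact: mpre].
    exact: (lZ (Ordinal ilt)).
  have -> : Z2 i @^-1` B = setT `*` (Q @^-1` B).
    by apply/seteqP; split => [[x y]|[x y] []]; rewrite /= /Z2 /= ltnNge ni.
  by rewrite PPE //; [rewrite probability_setT mul1e|exact: mpre].
- move=> u; rewrite exprSr -cZ -charf_prod //; last exact: measurable_sum.
  congr charf; apply/funext => -[x y]; rewrite big_ord_recr /= {2}/Z2 /= ltnn; congr (_ + _).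
  by apply: eq_bigr => i _; rewrite /Z2 ltn_ord.
Qed.
End characteristic_function.

Lemma complex_pow_sub (R : realType) (a b : R[i]) n : `|a| <= 1 -> `|b| <= 1 ->
  `|a ^+ n - b ^+ n| <= n%:R * `|a - b|.
Proof.
move=> a1 b1; rewrite subrXX normrM mulrC ler_wpM2r //.
apply: le_trans (ler_norm_sum _ _ _) _.
apply: le_trans (_ : \sum_(i < n) (1 : R[i]) <= _); last by rewrite sumr_const card_ord.
by apply: ler_sum => i _; rewrite normrM !normrX mulr_ile1 ?exprn_ge0 ?exprn_ile1.
Qed.

(** * Second-order estimates for sine, cosine and exponential *)

Section trigonometric_bounds.
Context (R : realType).
Implicit Types x y : R.

Lemma norm_sin_le x : `|sin x| <= `|x|.
Proof.
wlog x0 : x / 0 <= x.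
  move=> h; have [|x0] := leP 0 x; first exact: h.
  by have := h (- x); rewrite oppr_ge0 ltW // sinN !normrN; apply.
have [c _] := @MVT_segment R sin cos 0 x x0 (fun z _ => is_derive_sin z) (continuous_subspaceT (@continuous_sin R)).
by rewrite sin0 !subr0 => ->; rewrite normrM ler_piMl // norm_cos_le1.
Qed.

Let cosB1_MVT x : exists2 c, `|c| <= `|x| & `|cos x - 1| = `|sin c| * `|x|.
Proof.
wlog x0 : x / 0 <= x.
  move=> h; have [|x0] := leP 0 x; first exact: h.
  by have := h (- x); rewrite oppr_ge0 ltW // cosN !normrN; apply.
have [c /[!in_itv]/= /andP[c0 cx]] := @MVT_segment R cos (fun z => - sin z) 0 x x0
  (fun z _ => is_derive_cos z) (continuous_subspaceT (@continuous_cos R)).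
rewrite cos0 !subr0 => ->; exists c; first by rewrite !ger0_norm.
by rewrite normrM normrN.
Qed.

Lemma norm_cosB1_le_norm x : `|cos x - 1| <= `|x|.
Proof. by have [c _ ->] := cosB1_MVT x; rewrite ler_piMl // norm_sin_le1. Qed.

Lemma norm_cosB1_le x : `|cos x - 1| <= x ^+ 2.
Proof.
have [c cx ->] := cosB1_MVT x.
rewrite -[leRHS]real_normK ?num_real // expr2 ler_wpM2r //.
exact: le_trans (norm_sin_le c) cx.
Qed.

Lemma norm_sinB_le x : `|sin x - x| <= x ^+ 2.
Proof.
have -> : x ^+ 2 = `|x| ^+ 2 by rewrite real_normK ?num_real.
wlog x0 : x / 0 <= x.
  move=> h; have [|x0] := leP 0 x; first exact: h.
  by have := h (- x); rewrite oppr_ge0 ltW // sinN -opprD !normrN; apply.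
have dS (z : R) : z \in `]0, x[ -> is_derive z (1 : R) (fun z : R => sin z - z) (cos z - 1).
  by move=> _; exact: is_deriveB.
have [c /[!in_itv]/= /andP[c0 cx]] := @MVT_segment R (fun z => sin z - z) (fun z => cos z - 1) 0 x x0
  dS (continuous_subspaceT (fun z => cvgB (@continuous_sin R z) cvg_id)).
rewrite sin0 !subr0 => ->; rewrite normrM expr2 ler_wpM2r //.
by apply: le_trans (norm_cosB1_le_norm c) _; rewrite !ger0_norm.
Qed.

Lemma expRN_bounds x : 0 <= x -> 0 <= expR (- x) - 1 + x <= x ^+ 2.
Proof.
move=> x0; have h1 := expR_ge1Dx (- x); have h2 := expR_ge1Dx x; have h0 := expR_gt0 (- x).
have h3 : expR x * expR (- x) = 1 by rewrite -expRD subrr expR0.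
apply/andP; split; first by lra.
have h4 : (1 + x) * expR (- x) <= 1 by rewrite -[leRHS]h3 ler_wpM2r // ltW.
have x10 : 0 < 1 + x by lra.
rewrite -(ler_pM2l x10); nra.
Qed.

(** [1 + x + iy] is the first-order expansion of [exp (x + iy)]. Since [x <= 0] keeps [expR x] at
    most 1, the error is quadratic with an absolute constant. *)
Lemma one_step_error x y : x <= 0 ->
  `|(1 + x) - expR x * cos y| + `|y - expR x * sin y| <= 3 * (x ^+ 2 + y ^+ 2).
Proof.
move=> x0; have ex0 := expR_ge0 x.
have ex1 : expR x <= 1 by rewrite -[leRHS]expR0 ler_expR.
have /andP[e1 e2] : 0 <= expR x - 1 - x <= x ^+ 2.
  by have := @expRN_bounds (- x); rewrite oppr_ge0 opprK sqrrN; exact.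
have hc := norm_cosB1_le y; have hs := norm_sinB_le y.
have h1 : `|(1 + x) - expR x * cos y| <= x ^+ 2 + y ^+ 2.
  have -> : 1 + x - expR x * cos y = - (expR x - 1 - x) - expR x * (cos y - 1) by ring.
  apply: le_trans (ler_normB _ _) _; rewrite normrN ger0_norm // normrM (ger0_norm ex0) // lerD //.
  by apply: le_trans hc; rewrite ler_piMl.
have h2 : `|y - expR x * sin y| <= y ^+ 2 + `|x| * `|y|.
  have -> : y - expR x * sin y = - (expR x * (sin y - y)) + (1 - expR x) * y by ring.
  apply: le_trans (ler_normD _ _) _; rewrite normrN !normrM lerD //.
    by rewrite (ger0_norm ex0) //; apply: le_trans hs; rewrite ler_piMl.
  rewrite ler_wpM2r // ger0_norm ?subr_ge0 // ler0_norm //.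
  by have := expR_ge1Dx x; lra.
have h3 : `|x| * `|y| <= x ^+ 2 + y ^+ 2.
  rewrite -[x ^+ 2]real_normK ?num_real // -[y ^+ 2]real_normK ?num_real //.
  have := sqr_ge0 (`|x| - `|y|); have := normr_ge0 x; have := normr_ge0 y; nra.
have := sqr_ge0 x; have := sqr_ge0 y; lra.
Qed.
End trigonometric_bounds.

Section complex_exponential.
Context (R : realType).

Definition cexp (x y : R) : R[i] := Complex (expR x * cos y) (expR x * sin y).

Lemma cexpD x y x' y' : cexp (x + x') (y + y') = cexp x y * cexp x' y'.
Proof.
by apply/eqP; rewrite eq_complex /= expRD cosD sinD; apply/andP; split; apply/eqP; ring.
Qed.

Lemma cexpX x y n : cexp (n%:R * x) (n%:R * y) = cexp x y ^+ n.
Proof.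
elim: n => [|n IH]; first by rewrite !mul0r /cexp expR0 cos0 sin0 mulr1 mulr0.
by rewrite exprSr -IH -cexpD -!natr1 !mulrDl !mul1r.
Qed.

Lemma cexp_norm x y : `|cexp x y| = (expR x)%:C%C.
Proof.
rewrite normc_def /=; congr (_%:C)%C.
have -> : (expR x * cos y) ^+ 2 + (expR x * sin y) ^+ 2 = expR x ^+ 2.
  by rewrite !exprMn -mulrDr cos2Dsin2 mulr1.
by rewrite sqrtr_sqr ger0_norm ?expR_ge0.
Qed.

Lemma complex_norm_le (z : R[i]) : `|z| <= (`|Re z| + `|Im z|)%:C%C.
Proof.
case: z => a b; rewrite normc_def /= lecR.
rewrite -[leRHS]ger0_norm ?addr_ge0 // -sqrtr_sqr ler_wsqrtr //.
rewrite sqrrD !real_normK ?num_real //; have := mulr_ge0 (normr_ge0 a) (normr_ge0 b); lra.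
Qed.

(** Both bases lie in the unit disc, so the distance between the [N]-th powers is at most [N] times
    the distance between the bases, itself of order [1 / N ^ 2]. *)
Lemma cexp_approx (N : nat) (x y : R) : (0 < N)%N -> x <= 0 ->
  `|(Complex (1 + x / N%:R) (y / N%:R) : R[i])| <= 1 ->
  `|(Complex (1 + x / N%:R) (y / N%:R) : R[i]) ^+ N - cexp x y| <= (3 * (x ^+ 2 + y ^+ 2) / N%:R)%:C%C.
Proof.
move=> N0 x0 z1; have NR : 0 < N%:R :> R by rewrite ltr0n.
have Nn : N%:R != 0 :> R by rewrite gt_eqF.
have xN : x / N%:R <= 0 by rewrite ler_pdivrMr // mul0r.
have {1}-> : cexp x y = cexp (x / N%:R) (y / N%:R) ^+ N by rewrite -cexpX ![N%:R * _]mulrC !divfK.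
apply: le_trans (complex_pow_sub N z1 _) _.
  by rewrite cexp_norm -[leRHS]/(1%:C)%C lecR -[leRHS]expR0 ler_expR.
have -> : (3 * (x ^+ 2 + y ^+ 2) / N%:R)%:C%C = N%:R * (3 * ((x / N%:R) ^+ 2 + (y / N%:R) ^+ 2))%:C%C :> R[i].
  have -> : (N%:R : R[i]) = (N%:R)%:C%C by rewrite rmorph_nat.
  rewrite -rmorphM /=; congr (_%:C)%C; rewrite !expr_div_n; field.
  by rewrite Nn.
rewrite ler_wpM2l //; apply: le_trans (complex_norm_le _) _; rewrite lecR /=.
exact: one_step_error.
Qed.
End complex_exponential.

(** * Sums of independent steps with a given jump density *)

Section compound_law.
Context (R : realType).
Let leb : {measure set (measurableTypeR R) -> \bar R} := @lebesgue_measure R.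
Variables (g : R -> R) (N : nat).
Hypotheses (mg : measurable_fun setT g) (g0 : forall x, 0 <= g x) (N0 : (0 < N)%N).
Hypothesis ig : leb.-integrable setT (EFin \o g).
Hypothesis gN : \int[leb]_x g x <= N%:R.

Let NR : 0 < N%:R :> R. Proof. by rewrite ltr0n. Qed.
Let lam := \int[leb]_x g x.

Let lamE : (\int[leb]_x (g x)%:E = lam%:E)%E.
Proof. by rewrite /lam /Rintegral fineK //; exact: integrable_fin_num ig. Qed.

Let r0 : 0 <= 1 - lam / N%:R.
Proof. by rewrite subr_ge0 ler_pdivrMr // mul1r. Qed.

Let gn x := g x / N%:R.
Let mgn : measurable_fun setT gn. Proof. exact: measurable_funM. Qed.
Let gn0 x : 0 <= gn x. Proof. by rewrite divr_ge0. Qed.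

(** A step stays at 0 with probability [1 - lam / N] and otherwise jumps, with density [g / N]. The
    sum of [N] such steps imitates a compound Poisson variable with Levy density [g]. *)
Let step : {measure set (measurableTypeR R) -> \bar R} :=
  @measure_add _ (measurableTypeR R) R
    (@mscale _ (measurableTypeR R) R (NngNum r0) (@dirac _ (measurableTypeR R) 0 R))
    (@density _ (measurableTypeR R) R leb gn mgn gn0).

Let step_integral (F : R -> R) : measurable_fun setT F -> (forall x, 0 <= F x) ->
  (\int[step]_x (F x)%:E = ((1 - lam / N%:R) * F 0)%:E + N%:R^-1%:E * \int[leb]_x (F x * g x)%:E)%E.
Proof.
move=> mF F0.
have mFE : measurable_fun setT (fun x => (F x)%:E : \bar R) by exact/measurable_EFinP.
rewrite [LHS]ge0_integral_measure_add; [|by []|by move=> x _; rewrite lee_fin|exact: mFE].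
congr (_ + _)%E.
  rewrite EFinM; transitivity ((1 - lam / N%:R)%:E * \int[@dirac _ (measurableTypeR R) 0%R R]_x (F x)%:E)%E.
    by apply: ge0_integral_mscale => // x _; rewrite lee_fin.
  congr (_ * _)%E.
  transitivity (@dirac _ (measurableTypeR R) 0%R R setT * (F 0)%:E)%E; first exact: integral_dirac.
  by rewrite diracT mul1e.
rewrite integral_density // -ge0_integralZl_EFin //.
- by apply: eq_integral => x _; rewrite -!EFinM /gn; congr EFin; ring.
- by move=> x _; rewrite lee_fin mulr_ge0.
- by apply/measurable_EFinP; exact: measurable_funM.
Qed.

Lemma compound_step : exists rho : probability (measurableTypeR R) R, forall F : R -> R,
  measurable_fun setT F -> (forall x, 0 <= F x) ->
  leb.-integrable setT (EFin \o (fun x => F x * g x)) ->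
  (\int[rho]_x (F x)%:E = (F 0 + (\int[leb]_x ((F x - F 0) * g x)) / N%:R)%:E)%E.
Proof.
have step1 : step setT = 1%E.
  have := @step_integral (cst 1) (measurable_cst _) (fun _ => ler01).
  have -> : (\int[step]_x (cst 1 x)%:E = step setT)%E by rewrite -[RHS]mul1e -integral_cst.
  move=> ->; under eq_integral do rewrite mul1r.
  rewrite lamE mulr1 -EFinM -EFinD; congr EFin.
  by rewrite [_^-1 * _]mulrC subrK.
pose rho : probability (measurableTypeR R) R :=
  HB.pack (Measure.sort step) (Measure_isProbability.Build _ _ _ step step1).
exists rho => F mF F0 iF.
rewrite (_ : (\int[rho]_x _ = \int[step]_x (F x)%:E)%E) // step_integral //.
have iF0 : leb.-integrable setT (EFin \o (fun x => F 0 * g x)).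
  exact: (integrableZl measurableT (F 0) ig).
have -> : \int[leb]_x ((F x - F 0) * g x) = \int[leb]_x (F x * g x) - F 0 * lam.
  under eq_Rintegral do rewrite mulrBl.
  by rewrite RintegralB // RintegralZl.
have -> : (\int[leb]_x (F x * g x)%:E = (\int[leb]_x (F x * g x))%:E)%E.
  by rewrite /Rintegral fineK //; exact: integrable_fin_num iF.
by rewrite -EFinM -EFinD; congr EFin; ring.
Qed.
End compound_law.

Lemma charf_shift (R : realType) d (T : measurableType d) (P : probability T R) (X : T -> R) (b u : R) :
  measurable_fun setT X -> charf P (fun w => b + X w) u = cexp 0 (u * b) * charf P X u.
Proof.
move=> mX.
have ic (r : R) : P.-integrable setT (EFin \o (fun w => r * cos (u * X w))).
  exact: (integrableZl measurableT r (integrable_cosX P u mX)).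
have is_ (r : R) : P.-integrable setT (EFin \o (fun w => r * sin (u * X w))).
  exact: (integrableZl measurableT r (integrable_sinX P u mX)).
have jc := integrable_cosX P u mX; have js := integrable_sinX P u mX.
apply/eqP; rewrite eq_complex /= expR0 !mul1r; apply/andP; split; apply/eqP.
  under eq_Rintegral do rewrite mulrDr cosD.
  rewrite RintegralB; [|by []|exact: ic|exact: is_].
  by rewrite RintegralZl // RintegralZl.
under eq_Rintegral do rewrite mulrDr sinD.
rewrite RintegralD; [|by []|exact: ic|exact: is_].
by rewrite RintegralZl // RintegralZl // addrC.
Qed.

Section compound_sum.
Context (R : realType).
Let leb : {measure set (measurableTypeR R) -> \bar R} := @lebesgue_measure R.
Variables (g : R -> R) (N : nat) (b : R).
Hypotheses (mg : measurable_fun setT g) (g0 : forall x, 0 <= g x) (N0 : (0 < N)%N).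
Hypothesis gneg : forall x, x <= 0 -> g x = 0.
Hypothesis ig : leb.-integrable setT (EFin \o g).
Hypothesis gN : \int[leb]_x g x <= N%:R.

Let integrable_bounded_mul (F : R -> R) K : measurable_fun setT F -> (forall x, 0 < x -> `|F x| <= K) ->
  leb.-integrable setT (EFin \o (fun x => F x * g x)).
Proof.
move=> mF FK; apply: le_integrable (integrableZl measurableT K ig) => //.
  by apply/measurable_EFinP; exact: measurable_funM.
move=> x _ /=; rewrite lee_fin !normrM (ger0_norm (g0 x)).
have [x0|x0] := leP x 0; first by rewrite gneg // !mulr0.
by rewrite ler_wpM2r // (le_trans (FK x x0)) // ler_norm.
Qed.

(** The steps enter with a minus sign, as the jumps of the logarithm are negative; moments of the
    exponential and the characteristic function are exact [N]-th powers. *)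
Lemma compound_sum : exists nu : probability (measurableTypeR R) R,
  (forall m : nat, (\int[nu]_x (expR (m%:R * x))%:E =
    (expR (m%:R * b) * (1 + (\int[leb]_x ((expR (- (m%:R * x)) - 1) * g x)) / N%:R) ^+ N)%:E)%E) /\
  (forall u, charf nu id u = cexp 0 (u * b) *
    (Complex (1 + (\int[leb]_x ((cos (u * x) - 1) * g x)) / N%:R)
       ((- \int[leb]_x (sin (u * x) * g x)) / N%:R)) ^+ N).
Proof.
have [rho rhoE] := compound_step mg g0 N0 ig gN.
have mN : measurable_fun setT (fun x : R => - x) by exact: measurableT_comp.
have [d' [T' [P' [Z [mZ iZ lZ cZ]]]]] := iid_copies rho N mN.
pose Y w := b + \sum_(i < N) Z i w.
have mS : measurable_fun setT (fun w => \sum_(i < N) Z i w) by exact: measurable_sum.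
have mY : measurable_fun setT Y by exact: measurable_funD.
pose YR : {mfun T' >-> (measurableTypeR R)} :=
  @mfun_Sub _ _ T' (measurableTypeR R) Y (mem_set mY).
exists (distribution P' YR); split.
- move=> m.
  have mE : measurable_fun setT (fun x : R => expR (m%:R * x)) by do 2 apply: measurableT_comp => //.
  have mE' : measurable_fun setT (fun x : measurableTypeR R => (expR (m%:R * x))%:E : \bar R) by exact/measurable_EFinP.
  rewrite /distribution ge0_integral_pushforward //.
  have EY w : (expR (m%:R * Y w))%:E = ((expR (m%:R * b))%:E * (\prod_(i < N) expR (m%:R * Z i w))%:E)%E.
    by rewrite -EFinM -expR_sum -expRD; congr EFin; congr expR; rewrite mulrDr mulr_sumr.
  transitivity (\int[P']_w (expR (m%:R * Y w))%:E)%E; first by [].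
  under eq_integral do rewrite EY.
  rewrite ge0_integralZl_EFin //; last 2 first.
  + by move=> w _; rewrite lee_fin prodr_ge0 // => i _; exact: expR_ge0.
  + apply/measurable_EFinP; apply: measurable_prod => i _.
    exact: (measurableT_comp mE (mZ i)).
  rewrite (@expectation_prod _ _ R P' N _ (fun i => mZ i) iZ (fun _ x => expR (m%:R * x))) //.
  rewrite EFinM; congr (_ * _)%E.
  transitivity (\prod_(i < N) (1 + (\int[leb]_x ((expR (- (m%:R * x)) - 1) * g x)) / N%:R)%:E)%E; last first.
    by rewrite prodEFin prodr_const card_ord.
  apply: eq_bigr => i _.
  have Z1 : (\int[P']_w (expR (m%:R * Z i w))%:E = \int[rho]_x (expR (m%:R * - x))%:E)%E.
    apply: (@same_law_integral _ _ _ P' _ _ rho _ _ (Z i) (fun x => - x) (fun x => (expR (m%:R * x))%:E)) => //.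
    exact: lZ.
  rewrite Z1 rhoE //.
  + by rewrite oppr0 mulr0 expR0; under eq_Rintegral do rewrite mulrN.
  + exact: measurableT_comp mE mN.
  + apply: (integrable_bounded_mul (K := 1)); first exact: measurableT_comp mE mN.
    move=> x x0; rewrite ger0_norm ?expR_ge0 // -[leRHS]expR0 ler_expR mulrN oppr_le0.
    by rewrite mulr_ge0 // ltW.
- move=> u.
  have -> : charf (distribution P' YR) id u = charf P' Y u.
    apply/eqP; rewrite eq_complex /= /Rintegral; apply/andP; split; apply/eqP; congr fine.
      rewrite /distribution integral_pushforward //.
      + by apply/measurable_EFinP; exact: measurable_cosX.
      + exact: integrable_cosX.
    rewrite /distribution integral_pushforward //.
    + by apply/measurable_EFinP; exact: measurable_sinX.
    + exact: integrable_sinX.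
  rewrite charf_shift // cZ; congr (_ * _ ^+ _).
  have mc := measurable_cosX u (@measurable_id _ (measurableTypeR R) setT).
  have ms := measurable_sinX u (@measurable_id _ (measurableTypeR R) setT).
  have ic : leb.-integrable setT (EFin \o (fun x => cos (u * x) * g x)).
    by apply: (integrable_bounded_mul (K := 1)) => // x _; exact: norm_cos_le1.
  have is_ : leb.-integrable setT (EFin \o (fun x => sin (u * x) * g x)).
    by apply: (integrable_bounded_mul (K := 1)) => // x _; exact: norm_sin_le1.
  have jc := integrable_cosX rho u mN; have js := integrable_sinX rho u mN.
  have i1 : rho.-integrable setT (EFin \o (fun=> 1 : R)).
    by apply: (@bounded_integrable _ _ _ _ _ 1) => // w; rewrite normr1.
  apply/eqP; rewrite eq_complex /=; apply/andP; split; apply/eqP.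
    (* [rhoE] applies to nonnegative functions, hence the shift by 1 here and for the sine. *)
    have q1 : measurable_fun setT (fun x : R => 1 + cos (u * x)) by exact: measurable_funD.
    have q2 (x : R) : 0 <= 1 + cos (u * x) by have := cos_geN1 (u * x); lra.
    have q3 : leb.-integrable setT (EFin \o (fun x => (1 + cos (u * x)) * g x)).
      under eq_fun do rewrite mulrDl mul1r.
      exact: (integrableD measurableT ig ic).
    have := rhoE (fun x => 1 + cos (u * x)) q1 q2 q3.
    have -> : (\int[rho]_x (1 + cos (u * x))%:E = (1 + \int[rho]_x cos (u * - x))%:E)%E.
      under eq_integral do rewrite -[cos _]cosN -mulrN.
      rewrite -[LHS]fineK; last exact: (integrable_fin_num _ (integrableD measurableT i1 jc)).
      by rewrite -[fine _]/(\int[rho]_x (1 + cos (u * - x))) RintegralD // Rintegral_cst //= probability_setT mulr1.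
    rewrite mulr0 cos0 => -[].
    have -> : \int[leb]_x ((1 + cos (u * x) - (1 + 1)) * g x) = \int[leb]_x ((cos (u * x) - 1) * g x).
      by apply: eq_Rintegral => x _; congr (_ * _); ring.
    lra.
  have q1 : measurable_fun setT (fun x : R => 1 - sin (u * x)) by exact: measurable_funB.
  have q2 (x : R) : 0 <= 1 - sin (u * x) by have := sin_le1 (u * x); lra.
  have q3 : leb.-integrable setT (EFin \o (fun x => (1 - sin (u * x)) * g x)).
    under eq_fun do rewrite mulrBl mul1r.
    exact: (integrableB measurableT ig is_).
  have := rhoE (fun x => 1 - sin (u * x)) q1 q2 q3.
  have -> : (\int[rho]_x (1 - sin (u * x))%:E = (1 + \int[rho]_x sin (u * - x))%:E)%E.
    under eq_integral do rewrite -[- sin _]sinN -mulrN.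
    rewrite -[LHS]fineK; last exact: (integrable_fin_num _ (integrableD measurableT i1 js)).
    by rewrite -[fine _]/(\int[rho]_x (1 + sin (u * - x))) RintegralD // Rintegral_cst //= probability_setT mulr1.
  rewrite mulr0 sin0 subr0 => -[].
  have -> : \int[leb]_x ((1 - sin (u * x) - 1) * g x) = - \int[leb]_x (sin (u * x) * g x).
    transitivity (\int[leb]_x (-1 * (sin (u * x) * g x))).
      by apply: eq_Rintegral => x _; ring.
    by rewrite RintegralZl // mulN1r.
  lra.
Qed.
End compound_sum.

Lemma normc_ge_Im (R : realType) (z : R[i]) : `|complex.Im z|%:C%C <= `|z|.
Proof.
case: z => a b; rewrite normc_def /= lecR -sqrtr_sqr ler_wsqrtr // lerDr; exact: sqr_ge0.
Qed.

(** With [t = z / N] in [[-1/2, 0]], the lower bound is [1 + t >= expR (t - 2 * t ^+ 2)]. It follows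
    from [(1 + t) * (1 - t + 2 * t ^+ 2) - 1 = t ^+ 2 * (1 + 2 * t) >= 0]. *)
Lemma expR_pow_bounds (R : realType) (N : nat) (z : R) : (0 < N)%N -> z <= 0 -> - (N%:R / 2) <= z ->
  expR (z - 2 * z ^+ 2 / N%:R) <= (1 + z / N%:R) ^+ N <= expR z.
Proof.
move=> N0 z0 zN; have NR : 0 < N%:R :> R by rewrite ltr0n.
have Nn : N%:R != 0 :> R by rewrite gt_eqF.
set t := z / N%:R.
have t0 : t <= 0 by rewrite ler_pdivrMr // mul0r.
have t1 : - 2^-1 <= t by rewrite ler_pdivlMr //; lra.
have t1' : 0 <= 1 + t by lra.
have -> : z - 2 * z ^+ 2 / N%:R = N%:R * (t - 2 * t ^+ 2) by rewrite /t; field.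
have -> : z = N%:R * t by rewrite /t mulrC divfK.
rewrite !expRM_natl; apply/andP; split; last first.
  by rewrite lerXn2r ?nnegrE ?expR_ge0 // expR_ge1Dx.
rewrite lerXn2r ?nnegrE ?expR_ge0 //.
rewrite -[t - _]opprK expRN -[leRHS]invrK lef_pV2 ?posrE ?expR_gt0 ?invr_gt0 //; last by lra.
apply: le_trans (expR_ge1Dx _); rewrite -[leLHS]mul1r ler_pdivrMr; last by lra.
rewrite -subr_ge0 (_ : _ - _ = t ^+ 2 * (1 + 2 * t)); last by ring.
by rewrite mulr_ge0 ?sqr_ge0 //; lra.
Qed.

(** The compensator [1 - expR (- x)] makes this quadratic at 0, and identically 0 for [m = 0] and
    [m = 1]. *)
Definition compensated_exp (R : realType) (m : nat) (x : R) : R :=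
  expR (- (m%:R * x)) - 1 + m%:R * (1 - expR (- x)).

(** Imaginary part of the exponent for a jump [- x], with the same compensator as [compensated_exp],
    so that one drift serves moments and characteristic function. *)
Definition compensated_sin (R : realType) (u x : R) : R := u * (1 - expR (- x)) - sin (u * x).

(** * Truncation of the small jumps *)

Section levy_approximation.
Context (R : realType).
Let leb : {measure set (measurableTypeR R) -> \bar R} := @lebesgue_measure R.
Variables (f : R -> R) (beta : R).
Hypotheses (mf : measurable_fun setT f) (f0 : forall x, 0 <= f x).
Hypothesis fneg : forall x, x <= 0 -> f x = 0.
Hypothesis fquad : forall x, 0 < x -> x ^+ 2 * f x <= expR (- (2^-1 * x)).

Let mquad : measurable_fun setT (fun x : R => x ^+ 2 * f x).
Proof. by apply: measurable_funM => //; exact: measurable_funX. Qed.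

Let quad_ge0 x : 0 <= x ^+ 2 * f x. Proof. by rewrite mulr_ge0 ?sqr_ge0. Qed.

Let half_gt0 : 0 < 2^-1 :> R. Proof. by rewrite invr_gt0. Qed.

Local Notation D := (`[0%R, +oo[%classic : set R).

Let quad_le x : 0 <= x -> x ^+ 2 * f x <= expR (- (2^-1 * x)).
Proof.
by rewrite le_eqVlt => /predU1P[<-|]; [rewrite fneg // mulr0 expR_ge0|exact: fquad].
Qed.

Let quadE x : x ^+ 2 * f x = if x \in D then x ^+ 2 * f x else 0.
Proof.
case: ifPn => // xD; rewrite fneg ?mulr0 // ltW // ltNge; apply: contra xD => x0.
by apply/mem_set; rewrite /= in_itv /= x0.
Qed.

Let iquad : leb.-integrable setT (EFin \o (fun x => x ^+ 2 * f x)).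
Proof.
have : leb.-integrable D (EFin \o (fun x => x ^+ 2 * f x)).
  apply: le_integrable (@integrable_expRN R leb _ (@lebesgue_laplace R) 2^-1 half_gt0) => //.
    by apply: measurable_funTS; exact/measurable_EFinP.
  move=> x /=; rewrite in_itv /= andbT => x0; rewrite lee_fin !ger0_norm ?expR_ge0 //.
  exact: quad_le.
rewrite integrable_mkcond //; apply: eq_integrable => // x _.
by rewrite patchE /= [in RHS]quadE; case: ifP.
Qed.

Let quad_mass : \int[leb]_x (x ^+ 2 * f x) <= 2.
Proof.
have -> : \int[leb]_x (x ^+ 2 * f x) = \int[leb]_(x in D) (x ^+ 2 * f x).
  rewrite /Rintegral [in RHS]integral_mkcond; congr fine; apply: eq_integral => x _.
  by rewrite patchE [in LHS]quadE; case: ifP.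
have e2 : \int[leb]_(x in D) expR (- (2^-1 * x)) = 2.
  by rewrite /Rintegral (lebesgue_laplace half_gt0) /= invrK.
rewrite -[leRHS]e2; apply: le_Rintegral => //.
- by rewrite integrable_mkcond //; apply: eq_integrable iquad => // x _; rewrite patchE /= [in LHS]quadE; case: ifP.
- exact: (@integrable_expRN R leb _ (@lebesgue_laplace R)).
- by move=> x /=; rewrite in_itv /= andbT => x0; exact: quad_le.
Qed.

Lemma integrable_quad (F : R -> R) K : measurable_fun setT F -> (forall x, 0 < x -> `|F x| <= K * x ^+ 2) ->
  leb.-integrable setT (EFin \o (fun x => F x * f x)).
Proof.
move=> mF FK; apply: le_integrable (integrableZl measurableT K iquad) => //.
  by apply/measurable_EFinP; exact: measurable_funM.
move=> x _ /=; rewrite lee_fin; have [x0|x0] := leP x 0; first by rewrite fneg // !mulr0.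
rewrite normrM (ger0_norm (f0 x)) mulrA normrM (ger0_norm (f0 x)) ler_wpM2r //.
by rewrite (le_trans (FK x x0)) // ler_norm.
Qed.

Let trunc (p : nat) x := if p.+1%:R^-1 < x then f x else 0.

Let mtrunc p : measurable_fun setT (trunc p).
Proof. by apply: measurable_fun_ifT => //; exact: measurable_fun_ltr. Qed.

Let trunc0 p x : 0 <= trunc p x. Proof. by rewrite /trunc; case: ifP. Qed.

Let trunc_le p x : trunc p x <= f x. Proof. by rewrite /trunc; case: ifP. Qed.

Let truncneg p x : x <= 0 -> trunc p x = 0.
Proof. by rewrite /trunc => x0; case: ifP => // _; exact: fneg. Qed.

(** Beyond the cut-off [((p + 1) * x) ^+ 2] is at least 1, so the finite quadratic mass of [f]
    controls the truncated mass. *)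
Let trunc_quad p x : trunc p x <= p.+1%:R ^+ 2 * (x ^+ 2 * f x).
Proof.
rewrite /trunc; case: ifP => [px|_]; last by rewrite mulr_ge0 ?sqr_ge0.
have px1 : 1 <= p.+1%:R * x by rewrite mulrC -ler_pdivrMr // div1r ltW.
rewrite mulrA -exprMn ler_peMl // -[leLHS](expr1n R 2) lerXn2r // nnegrE ?ler01 //.
exact: le_trans ler01 px1.
Qed.

Let itrunc p : leb.-integrable setT (EFin \o trunc p).
Proof.
apply: le_integrable (integrableZl measurableT (p.+1%:R ^+ 2) iquad) => //.
  by apply/measurable_EFinP; exact: mtrunc.
move=> x _ /=; rewrite lee_fin !ger0_norm ?trunc_quad //.
by rewrite mulr_ge0 ?sqr_ge0.
Qed.

Let mass p : \int[leb]_x trunc p x <= 2 * p.+1%:R ^+ 2.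
Proof.
apply: (@le_trans _ _ (\int[leb]_x (p.+1%:R ^+ 2 * (x ^+ 2 * f x)))).
  apply: (le_Rintegral measurableT (itrunc p)) => [|x _]; last exact: trunc_quad.
  exact: (integrableZl measurableT (p.+1%:R ^+ 2) iquad).
by rewrite RintegralZl // mulrC ler_wpM2r ?sqr_ge0.
Qed.

Let imul p (F : R -> R) K : measurable_fun setT F -> (forall x, 0 < x -> `|F x| <= K) ->
  leb.-integrable setT (EFin \o (fun x => F x * trunc p x)).
Proof.
move=> mF FK; apply: le_integrable (integrableZl measurableT K (itrunc p)) => //.
  by apply/measurable_EFinP; apply: measurable_funM => //; exact: mtrunc.
move=> x _ /=; rewrite lee_fin !normrM (ger0_norm (trunc0 p x)).
have [x0|x0] := leP x 0; first by rewrite truncneg // !mulr0.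
by rewrite ler_wpM2r // (le_trans (FK x x0)) // ler_norm.
Qed.

Let trunc_bound p (F : R -> R) K : measurable_fun setT F -> (forall x, 0 < x -> `|F x| <= K) -> 0 <= K ->
  `|\int[leb]_x (F x * trunc p x)| <= K * (2 * p.+1%:R ^+ 2).
Proof.
move=> mF FK K0; have iF := imul p mF FK.
have ik : leb.-integrable setT (EFin \o (fun x => K * trunc p x)).
  exact: (integrableZl measurableT K (itrunc p)).
have ik' : leb.-integrable setT (EFin \o (fun x => - K * trunc p x)).
  exact: (integrableZl measurableT (- K) (itrunc p)).
have FKx x : - (K * trunc p x) <= F x * trunc p x <= K * trunc p x.
  rewrite -ler_norml normrM (ger0_norm (trunc0 p x)).
  have [x0|x0] := leP x 0; first by rewrite truncneg // !mulr0.
  by rewrite ler_wpM2r // FK.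
have h1 : \int[leb]_x (F x * trunc p x) <= K * \int[leb]_x trunc p x.
  rewrite -RintegralZl //; apply: (le_Rintegral measurableT iF ik) => x _.
  by have /andP[] := FKx x.
have h2 : - K * \int[leb]_x trunc p x <= \int[leb]_x (F x * trunc p x).
  rewrite -RintegralZl //; apply: (le_Rintegral measurableT ik' iF) => x _.
  by rewrite mulNr; have /andP[] := FKx x.
have h3 := ler_wpM2l K0 (mass p).
by rewrite ler_norml; apply/andP; split; lra.
Qed.

Let quad_cvg (F : R -> R) K : measurable_fun setT F -> (forall x, 0 < x -> `|F x| <= K * x ^+ 2) ->
  \int[leb]_x (F x * trunc p x) @[p --> \oo] --> \int[leb]_x (F x * f x).
Proof.
move=> mF FK.
have iK := integrableZl measurableT `|K| iquad.
have [] := @dominated_convergence _ _ _ leb setT measurableT (fun p x => (F x * trunc p x)%:E)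
  (fun x => (F x * f x)%:E) (fun x => (`|K| * (x ^+ 2 * f x))%:E).
- by move=> p; apply/measurable_EFinP; apply: measurable_funM => //; exact: mtrunc.
- by apply/measurable_EFinP; exact: measurable_funM.
- apply: aeW => x _; apply: cvg_EFin; first exact: nearW.
  have [x0|x0] := leP x 0.
    apply: cvg_near_cst; apply: nearW => p /=; by rewrite truncneg // fneg.
  apply: cvg_near_cst; near=> p; rewrite /= /trunc ifT //.
  near: p; exact: (cvgr_lt (0 : R) (@cvg_harmonic R)).
- exact: iK.
- apply: aeW => x p _; rewrite lee_fin normrM (ger0_norm (trunc0 p x)).
  have [x0|x0] := leP x 0; first by rewrite truncneg // fneg // !mulr0.
  rewrite mulrA ler_pM //; apply: le_trans (FK x x0) _.
  by rewrite ler_wpM2r ?sqr_ge0 // ler_norm.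
move=> iF _ cv; apply: (fine_cvg _ : _ --> _).
by rewrite /Rintegral fineK //; exact: integrable_fin_num iF.
Unshelve. all: by end_near. Qed.

Local Notation Psi := (@compensated_exp R).
Local Notation Theta := (@compensated_sin R).

Let mexp (a : R) : measurable_fun setT (fun x : R => expR (- (a * x))).
Proof. exact: measurable_expRN. Qed.

Let mexp1 : measurable_fun setT (fun x : R => 1 - expR (- x)).
Proof. by apply: measurable_funB => //; apply: measurableT_comp. Qed.

Let mPsi m : measurable_fun setT (Psi m).
Proof. by apply: measurable_funD; [exact: measurable_funB|exact: measurable_funM]. Qed.

Let msin (u : R) : measurable_fun setT (fun x : R => sin (u * x)).
Proof. by apply: measurable_sinX. Qed.

Let mcos (u : R) : measurable_fun setT (fun x : R => cos (u * x) - 1).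
Proof. by apply: measurable_funB => //; apply: measurable_cosX. Qed.

Let mTheta u : measurable_fun setT (Theta u).
Proof. by apply: measurable_funB => //; exact: measurable_funM. Qed.

Lemma compensated_exp_quad m x : 0 < x -> `|Psi m x| <= (m%:R + m%:R ^+ 2) * x ^+ 2.
Proof.
move=> x0; have mx : 0 <= m%:R * x by rewrite mulr_ge0 // ltW.
have /andP[h1 h2] := expRN_bounds mx; have /andP[h3 h4] := expRN_bounds (ltW x0).
have -> : Psi m x = (expR (- (m%:R * x)) - 1 + m%:R * x) - m%:R * (expR (- x) - 1 + x) by rewrite /compensated_exp; ring.
have h5 := ler_wpM2l (ler0n R m) h3; have h6 := ler_wpM2l (ler0n R m) h4.
rewrite exprMn in h2; rewrite mulr0 in h5; rewrite ler_norml mulrDl.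
have h7 : 0 <= m%:R * x ^+ 2 by rewrite mulr_ge0 ?sqr_ge0.
have h8 : 0 <= m%:R ^+ 2 * x ^+ 2 by rewrite mulr_ge0 ?sqr_ge0.
by apply/andP; split; lra.
Qed.

Lemma compensated_sin_quad u x : 0 < x -> `|Theta u x| <= (`|u| + u ^+ 2) * x ^+ 2.
Proof.
move=> x0; have /andP[h3 h4] := expRN_bounds (ltW x0).
have -> : Theta u x = - (u * (expR (- x) - 1 + x)) - (sin (u * x) - u * x) by rewrite /compensated_sin; ring.
apply: le_trans (ler_normB _ _) _; rewrite normrN normrM mulrDl lerD //.
  by rewrite ler_wpM2l // ger0_norm.
by rewrite -exprMn norm_sinB_le.
Qed.

Lemma cos_quad (u x : R) : `|cos (u * x) - 1| <= u ^+ 2 * x ^+ 2.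
Proof. by rewrite -exprMn norm_cosB1_le. Qed.

Let nonpos p (F : R -> R) K : measurable_fun setT F -> (forall x, 0 < x -> `|F x| <= K) ->
  (forall x, 0 < x -> F x <= 0) -> \int[leb]_x (F x * trunc p x) <= 0.
Proof.
move=> mF FK F0.
have i0 : leb.-integrable setT (EFin \o (fun=> 0 : R)) by exact: integrable0.
have <- : \int[leb]_x (0 : R) = 0 by rewrite Rintegral_cst // mul0r.
apply: (le_Rintegral measurableT (imul p mF FK) i0) => x _.
have [x0|x0] := leP x 0; first by rewrite truncneg // mulr0.
by rewrite mulr_le0_ge0 // F0.
Qed.

(** The integrals against [trunc p] are of order [(p + 1) ^ 2], so the quadratic errors of order
    [(p + 1) ^ 4 / N] vanish like [1 / (p + 1)]. The factor 4 ensures that [z] stays above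
    [- N / 2], as [expR_pow_bounds] requires. *)
Let N p := (4 * p.+1 ^ 5)%N.
(** This drift may diverge with [p]; only its sums with the uncompensated integrals converge, as in
    [drift] and [phase]. *)
Let bp p := beta + \int[leb]_x ((1 - expR (- x)) * trunc p x).

Let NE p : (N p)%:R = 4 * p.+1%:R ^+ 5 :> R. Proof. by rewrite /N natrM natrX. Qed.
Let P1 p : 1 <= p.+1%:R :> R. Proof. by rewrite ler1n. Qed.
Let N0 p : (0 < N p)%N. Proof. by rewrite muln_gt0 /= expn_gt0. Qed.

Let P25 p : p.+1%:R ^+ 2 <= p.+1%:R ^+ 5 :> R. Proof. by rewrite ler_weXn2l. Qed.

Let massN p : \int[leb]_x trunc p x <= (N p)%:R.
Proof.
by apply: le_trans (mass p) _; rewrite NE; have := P25 p; have := sqr_ge0 (p.+1%:R : R); lra.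
Qed.

Let divN p (x c : R) : 0 <= c -> x <= c * p.+1%:R ^+ 4 -> x / (N p)%:R <= c / p.+1%:R.
Proof.
move=> c0 xc; rewrite NE ler_pdivrMr; last by rewrite mulr_gt0 // exprn_gt0.
have -> : c / p.+1%:R * (4 * p.+1%:R ^+ 5) = 4 * (c * p.+1%:R ^+ 4) by field.
have y0 : 0 <= c * p.+1%:R ^+ 4 by rewrite mulr_ge0 // exprn_ge0.
by move: xc y0; move: (c * _) => y; lra.
Qed.

Let sqr_bound p (x c : R) : 0 <= c -> `|x| <= c * (2 * p.+1%:R ^+ 2) -> x ^+ 2 <= 4 * c ^+ 2 * p.+1%:R ^+ 4.
Proof.
move=> c0 xc; rewrite -[leLHS]real_normK ?num_real //.
have -> : 4 * c ^+ 2 * p.+1%:R ^+ 4 = (c * (2 * p.+1%:R ^+ 2)) ^+ 2 :> R by ring.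
by rewrite lerXn2r ?nnegrE // !mulr_ge0 // sqr_ge0.
Qed.

Let z m p := \int[leb]_x ((expR (- (m%:R * x)) - 1) * trunc p x).

Let expB1_norm m x : 0 < x -> `|expR (- (m%:R * x)) - 1| <= 1 /\ expR (- (m%:R * x)) - 1 <= 0 :> R.
Proof.
move=> x0; have e0 := expR_gt0 (- (m%:R * x)).
have e1 : expR (- (m%:R * x)) <= 1.
  by rewrite -[leRHS]expR0 ler_expR oppr_le0 mulr_ge0 // ltW.
by split; [rewrite ler_norml; apply/andP; split; lra|lra].
Qed.

Let mexpB m : measurable_fun setT (fun x : R => expR (- (m%:R * x)) - 1).
Proof. exact: measurable_funB. Qed.

Let drift m p : m%:R * bp p + z m p = m%:R * beta + \int[leb]_x (Psi m x * trunc p x).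
Proof.
have i1 := imul p (mexpB m) (fun x x0 => (expB1_norm m x0).1).
have i2 : leb.-integrable setT (EFin \o (fun x => (1 - expR (- x)) * trunc p x)).
  apply: (imul p (K := 1)) => // x x0; have [] := expB1_norm 1 x0.
  by rewrite mul1r distrC.
have i3 : leb.-integrable setT (EFin \o (fun x => m%:R * ((1 - expR (- x)) * trunc p x))).
  exact: (integrableZl measurableT m%:R i2).
have -> : \int[leb]_x (Psi m x * trunc p x) = z m p + m%:R * \int[leb]_x ((1 - expR (- x)) * trunc p x).
  rewrite /z -RintegralZl // -RintegralD //.
  by apply: eq_Rintegral => x _; rewrite /compensated_exp; ring.
by rewrite /bp; ring.
Qed.

Let moment_bounds m p : expR (m%:R * beta + \int[leb]_x (Psi m x * trunc p x) - 8 / p.+1%:R) <=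
  expR (m%:R * bp p) * (1 + z m p / (N p)%:R) ^+ N p <=
  expR (m%:R * beta + \int[leb]_x (Psi m x * trunc p x)).
Proof.
rewrite -drift.
have zb : `|z m p| <= 1 * (2 * p.+1%:R ^+ 2).
  exact: (trunc_bound p (mexpB m) (fun x x0 => (expB1_norm m x0).1) ler01).
have z0 : z m p <= 0 by exact: (nonpos p (mexpB m) (fun x x0 => (expB1_norm m x0).1) (fun x x0 => (expB1_norm m x0).2)).
have zN : - ((N p)%:R / 2) <= z m p.
  rewrite NE; move: zb; rewrite ler_norml => /andP[zb _]; have := P25 p; lra.
have /andP[h1 h2] := expR_pow_bounds (N0 p) z0 zN.
apply/andP; split; last by rewrite expRD ler_wpM2l ?expR_ge0.
apply: le_trans (_ : expR (m%:R * bp p + (z m p - 2 * z m p ^+ 2 / (N p)%:R)) <= _).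
  (* From [|z| <= 2 (p + 1) ^ 2] comes [2 * z ^+ 2 <= 8 (p + 1) ^ 4], the source of the 8. *)
  rewrite ler_expR -addrA lerD2l lerD2l lerN2; apply: divN => //.
  by have := sqr_bound ler01 zb; lra.
by rewrite expRD ler_wpM2l // expR_ge0.
Qed.

Let c8 : 8 / p.+1%:R @[p --> \oo] --> (0 : R).
Proof. by rewrite -[X in _ --> X](mulr0 8); apply: cvgM; [exact: cvg_cst|exact: cvg_harmonic]. Qed.

Let moment_cvg m : expR (m%:R * bp p) * (1 + z m p / (N p)%:R) ^+ N p @[p --> \oo] -->
  expR (m%:R * beta + \int[leb]_x (Psi m x * f x)).
Proof.
have c1 : m%:R * beta + \int[leb]_x (Psi m x * trunc p x) @[p --> \oo] --> m%:R * beta + \int[leb]_x (Psi m x * f x).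
  by apply: cvgD; [exact: cvg_cst|exact: (quad_cvg (mPsi m) (@compensated_exp_quad m))].
apply: (squeeze_cvgr (f := fun p => expR (m%:R * beta + \int[leb]_x (Psi m x * trunc p x) - 8 / p.+1%:R))
  (h := fun p => expR (m%:R * beta + \int[leb]_x (Psi m x * trunc p x)))).
- by apply: nearW => p; exact: moment_bounds.
- apply: (@continuous_cvg _ _ _ _ _ _ expR); first exact: continuous_expR.
  by rewrite -[X in _ --> X]subr0; apply: cvgB; [exact: c1|exact: c8].
- by apply: (@continuous_cvg _ _ _ _ _ _ expR); [exact: continuous_expR|exact: c1].
Qed.

Let A u p := \int[leb]_x ((cos (u * x) - 1) * trunc p x).
Let S u p := \int[leb]_x (sin (u * x) * trunc p x).

Let cosB1_norm u x : `|cos (u * x) - 1| <= 2 /\ cos (u * x) - 1 <= 0 :> R.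
Proof.
have h1 := cos_le1 (u * x); have h2 := cos_geN1 (u * x).
by split; [rewrite ler_norml; apply/andP; split; lra|lra].
Qed.

Let phase u p : u * bp p - S u p = u * beta + \int[leb]_x (Theta u x * trunc p x).
Proof.
have i1 : leb.-integrable setT (EFin \o (fun x => sin (u * x) * trunc p x)).
  by apply: (imul p (K := 1)) => // x _; exact: norm_sin_le1.
have i2 : leb.-integrable setT (EFin \o (fun x => (1 - expR (- x)) * trunc p x)).
  apply: (imul p (K := 1)) => // x x0; have [] := expB1_norm 1 x0.
  by rewrite mul1r distrC.
have i3 : leb.-integrable setT (EFin \o (fun x => u * ((1 - expR (- x)) * trunc p x))).
  exact: (integrableZl measurableT u i2).
have -> : \int[leb]_x (Theta u x * trunc p x) = u * \int[leb]_x ((1 - expR (- x)) * trunc p x) - S u p.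
  rewrite /S -RintegralZl // -RintegralB //.
  by apply: eq_Rintegral => x _; rewrite /compensated_sin; ring.
by rewrite /bp; ring.
Qed.

Let charf_bound (nu : probability (measurableTypeR R) R) u p :
  charf nu id u = cexp 0 (u * bp p) * (Complex (1 + A u p / (N p)%:R) ((- S u p) / (N p)%:R)) ^+ N p ->
  `|charf nu id u - cexp (A u p) (u * beta + \int[leb]_x (Theta u x * trunc p x))| <= (60 / p.+1%:R)%:C%C.
Proof.
move=> chE.
have n1 : `|charf nu id u| <= 1 by exact: charf_norm_le1.
have A0 : A u p <= 0.
  exact: (nonpos p (mcos u) (fun x _ => (cosB1_norm u x).1) (fun x _ => (cosB1_norm u x).2)).
have Ab : `|A u p| <= 2 * (2 * p.+1%:R ^+ 2).
  exact: (trunc_bound p (mcos u) (fun x _ => (cosB1_norm u x).1) (ler0n _ 2)).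
have Sb : `|S u p| <= 1 * (2 * p.+1%:R ^+ 2).
  exact: (trunc_bound p (msin u) (fun x _ => norm_sin_le1 _) ler01).
have c1 y : `|cexp 0 y| = 1 :> R[i] by rewrite cexp_norm expR0.
(* Up to a factor of modulus 1, the [N]-th power of this number is a characteristic function, so the
   number itself lies in the unit disc. *)
have w1 : `|(Complex (1 + A u p / (N p)%:R) ((- S u p) / (N p)%:R) : R[i])| <= 1.
  by move: n1; rewrite chE normrM c1 mul1r normrX expr_le1.
have := cexp_approx (N0 p) A0 w1; rewrite sqrrN chE -phase => h.
have -> : cexp (A u p) (u * bp p - S u p) = cexp 0 (u * bp p) * cexp (A u p) (- S u p).
  by rewrite -cexpD add0r.
rewrite -mulrBr normrM c1 mul1r; apply: le_trans h _; rewrite lecR; apply: divN => //.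
(* [|A| <= 4 (p + 1) ^ 2] and [|S| <= 2 (p + 1) ^ 2] give [3 * (16 + 4) = 60]. *)
have := sqr_bound (ler0n _ 2) Ab; have := sqr_bound ler01 Sb; lra.
Qed.

Let target u p := cexp (A u p) (u * beta + \int[leb]_x (Theta u x * trunc p x)).

Let A_cvg u : A u p @[p --> \oo] --> \int[leb]_x ((cos (u * x) - 1) * f x).
Proof. exact: (quad_cvg (mcos u) (fun x _ => cos_quad u x)). Qed.

Let B_cvg u : u * beta + \int[leb]_x (Theta u x * trunc p x) @[p --> \oo] -->
  u * beta + \int[leb]_x (Theta u x * f x).
Proof. by apply: cvgD; [exact: cvg_cst|exact: (quad_cvg (mTheta u) (@compensated_sin_quad u))]. Qed.

Let squeeze_close (v w : nat -> R) (l : R) : (forall p, `|v p - w p| <= 60 / p.+1%:R) ->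
  w p @[p --> \oo] --> l -> v p @[p --> \oo] --> l.
Proof.
move=> vw wl.
have c60 : 60 / p.+1%:R @[p --> \oo] --> (0 : R).
  by rewrite -[X in _ --> X](mulr0 60); apply: cvgM; [exact: cvg_cst|exact: cvg_harmonic].
apply: (squeeze_cvgr (f := fun p => w p - 60 / p.+1%:R) (h := fun p => w p + 60 / p.+1%:R)).
- by apply: nearW => p; have := vw p; rewrite ler_norml; move: (60 / _) => e /andP[h1 h2]; apply/andP; split; lra.
- by rewrite -[X in _ --> X]subr0; apply: cvgB.
- by rewrite -[X in _ --> X]addr0; apply: cvgD.
Qed.

(** The first clause is the uniform bound that Helly selection consumes. It holds without error
    term, because [(1 + z / N) ^ N <= expR z] and the compensated exponent vanishes for [m = 1]. *)
Lemma levy_approximation : exists nu : nat -> probability (measurableTypeR R) R,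
  [/\ forall p, (\int[nu p]_x (expR x)%:E <= (expR beta)%:E)%E,
      forall m, exists a : nat -> R, (forall p, (\int[nu p]_x (expR (m%:R * x))%:E = (a p)%:E)%E) /\
        (a p @[p --> \oo] --> expR (m%:R * beta + \int[leb]_x (Psi m x * f x))) &
      forall u, let A := \int[leb]_x ((cos (u * x) - 1) * f x) in
        let B := u * beta + \int[leb]_x (Theta u x * f x) in
        (\int[nu p]_x cos (u * x) @[p --> \oo] --> expR A * cos B) /\
        (\int[nu p]_x sin (u * x) @[p --> \oo] --> expR A * sin B)].
Proof.
have [nu nuP] := choice (fun p => compound_sum (bp p) (mtrunc p) (trunc0 p) (N0 p) (@truncneg p) (itrunc p) (massN p)).
have close u p := charf_bound ((nuP p).2 u).
exists nu; split.
- move=> p; have := (nuP p).1 1%N; under eq_integral do rewrite mul1r.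
  move=> ->; rewrite lee_fin; have /andP[_] := moment_bounds 1 p; move/le_trans; apply.
  rewrite ler_expR mul1r gerDl (_ : \int[leb]_x _ = 0) //.
  transitivity (\int[leb]_x (0 : R)); last by rewrite Rintegral_cst // mul0r.
  by apply: eq_Rintegral => x _; rewrite /compensated_exp !mul1r; ring.
- move=> m; exists (fun p => expR (m%:R * bp p) * (1 + z m p / (N p)%:R) ^+ N p); split; last exact: moment_cvg.
  by move=> p; exact: (nuP p).1.
- move=> u; split.
    apply: (squeeze_close (w := fun p => expR (A u p) * cos (u * beta + \int[leb]_x (Theta u x * trunc p x)))).
      move=> p; rewrite -lecR; apply: le_trans (close u p).
      exact: (normc_ge_Re (charf (nu p) id u - target u p)).
    apply: cvgM.
      by apply: (@continuous_cvg _ _ _ _ _ _ expR); [exact: continuous_expR|exact: A_cvg].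
    by apply: (@continuous_cvg _ _ _ _ _ _ cos); [exact: continuous_cos|exact: B_cvg].
  apply: (squeeze_close (w := fun p => expR (A u p) * sin (u * beta + \int[leb]_x (Theta u x * trunc p x)))).
    move=> p; rewrite -lecR; apply: le_trans (close u p).
    exact: (normc_ge_Im (charf (nu p) id u - target u p)).
  apply: cvgM.
    by apply: (@continuous_cvg _ _ _ _ _ _ expR); [exact: continuous_expR|exact: A_cvg].
  by apply: (@continuous_cvg _ _ _ _ _ _ sin); [exact: continuous_sin|exact: B_cvg].
Qed.
End levy_approximation.

Lemma same_law_Rintegral (R : realType) d1 (T1 : measurableType d1) (P1 : probability T1 R)
  d2 (T2 : measurableType d2) (P2 : probability T2 R) d3 (E : measurableType d3)
  (X1 : T1 -> E) (X2 : T2 -> E) (g : E -> R) :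
  measurable_fun setT X1 -> measurable_fun setT X2 ->
  (forall B, measurable B -> P1 (X1 @^-1` B) = P2 (X2 @^-1` B)) ->
  measurable_fun setT g -> (forall x, `|g x| <= 1) ->
  \int[P1]_w g (X1 w) = \int[P2]_w g (X2 w).
Proof.
move=> mX1 mX2 X12 mg g1.
have key d (T : measurableType d) (P : probability T R) (X : T -> E) : measurable_fun setT X ->
    (\int[P]_w (1 + g (X w))%:E = (1 + \int[P]_w g (X w))%:E)%E.
  move=> mX; have mgX : measurable_fun setT (fun w => g (X w)) by exact: measurableT_comp mg mX.
  have i1 : P.-integrable setT (EFin \o (fun=> 1 : R)).
    by apply: (@bounded_integrable _ _ _ _ _ 1) => // w; rewrite normr1.
  have i2 : P.-integrable setT (EFin \o (fun w => g (X w))).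
    exact: (@bounded_integrable _ _ _ _ _ 1).
  rewrite -[LHS]fineK; last exact: (integrable_fin_num _ (integrableD measurableT i1 i2)).
  rewrite -[fine _]/(\int[P]_w (1 + g (X w))) RintegralD // Rintegral_cst //=.
  by rewrite probability_setT mulr1.
have mg1 : measurable_fun setT (fun x => (1 + g x)%:E : \bar R).
  by apply/measurable_EFinP; exact: measurable_funD.
have g10 x : (0 <= (1 + g x)%:E :> \bar R)%E.
  by rewrite lee_fin; have := g1 x; rewrite ler_norml => /andP[]; lra.
have := same_law_integral mX1 mX2 X12 mg1 g10.
by rewrite !key // => -[] /addrI.
Qed.

(** Either [e * x >= 1], and the first term suffices, or [x < 1 / e], and the second does. It serves
    as uniform integrability of the [m]-th powers. *)
Lemma pow_le_interpolation (R : realType) (m : nat) (e x : R) : 0 < e -> 0 <= x -> x ^+ m <= e * x ^+ m.+1 + e ^- m.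
Proof.
move=> e0 x0; have em : 0 <= e ^- m by rewrite invr_ge0 exprn_ge0 // ltW.
have [ex|ex] := leP 1 (e * x).
  by rewrite exprS mulrA -[leLHS]mul1r ler_wpDr // ler_wpM2r // exprn_ge0.
apply: le_trans (_ : e ^- m <= _); last first.
  by rewrite lerDr mulr_ge0 ?exprn_ge0 // ltW.
rewrite -exprVn lerXn2r ?nnegrE ?invr_ge0 ?(ltW e0) //.
by rewrite -[leRHS]mul1r ler_pdivlMr // mulrC ltW.
Qed.

(** * Passage to the limit in moments and trigonometric integrals *)

Section limit_of_laws.
Context (R : realType) d (T : measurableType d) (P : probability T R) (Q_ : nat -> T -> R) (Q : T -> R).
Hypotheses (mQ_ : forall n, measurable_fun setT (Q_ n)) (mQ : measurable_fun setT Q).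
Hypotheses (Q_0 : forall n w, 0 <= Q_ n w) (Q0 : forall w, 0 <= Q w).
Hypothesis Qcvg : {ae P, forall w, Q_ n w @[n --> \oo] --> Q w}.

(** Fatou's lemma gives one inequality. Applied to the nonnegative function
    [dl * x ^+ m.+1 + dl ^- m - x ^+ m], it gives the other up to [dl * e m.+1]. *)
Lemma moments_limit (a : nat -> nat -> R) (e : nat -> R) :
  (forall m, 0 < e m) -> (forall m n, (\int[P]_w (Q_ n w ^+ m)%:E = (a m n)%:E)%E) ->
  (forall m, a m n @[n --> \oo] --> e m) ->
  forall m, (\int[P]_w (Q w ^+ m)%:E = (e m)%:E)%E.
Proof.
move=> e_gt0 Q_E ae.
have up m : (\int[P]_w (Q w ^+ m)%:E <= (e m)%:E)%E.
  have bE := Q_E m; have bcvg := ae m; set b := a m in bE bcvg.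
  apply: (@fatou_le _ _ _ P (fun n w => (Q_ n w ^+ m)%:E) _ b) => //.
  - by move=> n; apply/measurable_EFinP; exact: measurable_funX.
  - by apply/measurable_EFinP; exact: measurable_funX.
  - by move=> n w; rewrite lee_fin exprn_ge0.
  - by move=> w; rewrite lee_fin exprn_ge0.
  - apply: filterS Qcvg => w h; apply: cvg_EFin; first exact: nearW.
    exact: cvg_exprn.
  - by move=> n; rewrite bE.
have intp (V : T -> R) m (c : R) : measurable_fun setT V -> (forall w, 0 <= V w) ->
    (\int[P]_w (V w ^+ m)%:E <= c%:E)%E -> P.-integrable setT (EFin \o (fun w => V w ^+ m)).
  move=> mV V0 Vc; apply/integrableP; split; first by apply/measurable_EFinP; exact: measurable_funX.
  rewrite [ltLHS](_ : _ = \int[P]_w (V w ^+ m)%:E)%E; first exact: le_lt_trans Vc (ltry _).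
  by apply: eq_integral => w _; rewrite gee0_abs // lee_fin exprn_ge0.
have iQ m := intp Q m _ mQ Q0 (up m).
move=> m.
  apply/eqP; rewrite eq_le up /= -[leRHS]fineK; last exact: integrable_fin_num (iQ m).
  rewrite lee_fin -[leRHS]/(\int[P]_w (Q w ^+ m)); apply/ler_addgt0Pr => eps eps0.
  have mm0 := e_gt0 m.+1.
  (* Chosen so that the loss [dl * e m.+1] is exactly [eps]. *)
  pose dl := eps / e m.+1; have dl0 : 0 < dl by exact: divr_gt0.
  have bE := Q_E m; have bE' := Q_E m.+1; have bcvg := ae m; have bcvg' := ae m.+1; set b := a m in bE bcvg; set b' := a m.+1 in bE' bcvg'.
  have idl (V : T -> R) : measurable_fun setT V -> (forall w, 0 <= V w) ->
      P.-integrable setT (EFin \o (fun w => V w ^+ m)) ->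
      P.-integrable setT (EFin \o (fun w => V w ^+ m.+1)) ->
      (\int[P]_w (dl * V w ^+ m.+1 + dl ^- m - V w ^+ m)%:E =
        (dl * \int[P]_w (V w ^+ m.+1) + dl ^- m - \int[P]_w (V w ^+ m))%:E)%E.
    move=> mV V0 i0 i1.
    have j1 : P.-integrable setT (EFin \o (fun w => dl * V w ^+ m.+1)).
      exact: (integrableZl measurableT dl i1).
    have j2 : P.-integrable setT (EFin \o (fun=> dl ^- m : R)).
      by apply: (@bounded_integrable _ _ _ _ _ `|dl ^- m|).
    have j3 : P.-integrable setT (EFin \o (fun w => dl * V w ^+ m.+1 + dl ^- m)).
      exact: (integrableD measurableT j1 j2).
    rewrite -[LHS]fineK; last exact: (integrable_fin_num _ (integrableB measurableT j3 i0)).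
    rewrite -[fine _]/(\int[P]_w (dl * V w ^+ m.+1 + dl ^- m - V w ^+ m)).
    by rewrite RintegralB // RintegralD // RintegralZl // Rintegral_cst //= probability_setT mulr1.
  have bm n : \int[P]_w (Q_ n w ^+ m) = b n by rewrite /Rintegral bE.
  have bm' n : \int[P]_w (Q_ n w ^+ m.+1) = b' n by rewrite /Rintegral bE'.
  have iQ_ n k c : (\int[P]_w (Q_ n w ^+ k)%:E = c%:E)%E -> P.-integrable setT (EFin \o (fun w => Q_ n w ^+ k)).
    by move=> h; apply: (intp (Q_ n) k c) => //; rewrite h.
  have : (\int[P]_w (dl * Q w ^+ m.+1 + dl ^- m - Q w ^+ m)%:E <= (dl * e m.+1 + dl ^- m - e m)%:E)%E.
    apply: (@fatou_le _ _ _ P (fun n w => (dl * Q_ n w ^+ m.+1 + dl ^- m - Q_ n w ^+ m)%:E) _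
      (fun n => dl * b' n + dl ^- m - b n)) => //.
    - move=> n; apply/measurable_EFinP; apply: measurable_funB; last exact: measurable_funX.
      by apply: measurable_funD => //; apply: measurable_funM => //; exact: measurable_funX.
    - apply/measurable_EFinP; apply: measurable_funB; last exact: measurable_funX.
      by apply: measurable_funD => //; apply: measurable_funM => //; exact: measurable_funX.
    - by move=> n w; rewrite lee_fin subr_ge0 pow_le_interpolation.
    - by move=> w; rewrite lee_fin subr_ge0 pow_le_interpolation.
    - apply: filterS Qcvg => w h; apply: cvg_EFin; first exact: nearW.
      apply: cvgB; last exact: cvg_exprn.
      apply: cvgD; last exact: cvg_cst.
      by apply: cvgM; [exact: cvg_cst|exact: cvg_exprn].
    - move=> n; rewrite (idl _ (mQ_ n) (Q_0 n) (iQ_ n m _ (bE n)) (iQ_ n m.+1 _ (bE' n))).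
      by rewrite bm bm'.
    - apply: cvgB => //; apply: cvgD; last exact: cvg_cst.
      by apply: cvgM => //; exact: cvg_cst.
  rewrite (idl Q mQ Q0 (iQ m) (iQ m.+1)) lee_fin.
  have : 0 <= dl * \int[P]_w (Q w ^+ m.+1).
    by rewrite mulr_ge0 ?(ltW dl0) // Rintegral_ge0 // => w _; rewrite exprn_ge0.
  by rewrite {3}/dl divfK ?gt_eqF //; lra.
Qed.

(** [ln] is continuous only at positive points, so convergence of [Q_] passes through it where the
    limit is positive; boundedness of [g] does the rest. *)
Lemma log_limit (u : R) (g : R -> R) (a : nat -> R) (L : R) :
  {ae P, forall w, 0 < Q w} -> continuous g -> (forall x, `|g x| <= 1) ->
  (forall n, \int[P]_w g (u * ln (Q_ n w)) = a n) -> a n @[n --> \oo] --> L ->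
  \int[P]_w g (u * ln (Q w)) = L.
Proof.
move=> Qpos cg g1 aE aL.
have mgu : measurable_fun setT (fun x : R => g (u * ln x)).
  apply: measurableT_comp; first exact: continuous_measurable_fun.
  by apply: measurable_funM => //; exact: measurable_ln.
have c1 : \int[P]_w g (u * ln (Q_ n w)) @[n --> \oo] --> L by under eq_cvg do rewrite aE.
have c2 : \int[P]_w g (u * ln (Q_ n w)) @[n --> \oo] --> \int[P]_w g (u * ln (Q w)).
  apply: fine_cvg; rewrite /Rintegral fineK; last first.
    apply: integrable_fin_num => //; apply: (@bounded_integrable _ _ _ _ _ 1) => //.
    exact: measurableT_comp mgu mQ.
  apply: (@bounded_convergence _ _ _ P _ _ 1) => //.
  - by move=> n; exact: measurableT_comp mgu (mQ_ n).
  - exact: measurableT_comp mgu mQ.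
  - apply: filterS2 Qcvg Qpos => w h Qw.
    apply: (@continuous_cvg _ _ _ _ _ _ g); first exact: cg.
    apply: cvgM; first exact: cvg_cst.
    by apply: (@continuous_cvg _ _ _ _ _ _ (@ln R)) => //; exact: continuous_ln.
exact: (cvg_unique _ c2 c1).
Qed.
End limit_of_laws.

Section limit_law.
Context (R : realType).
Let leb : {measure set (measurableTypeR R) -> \bar R} := @lebesgue_measure R.
Variables (f : R -> R) (beta : R).
Hypotheses (mf : measurable_fun setT f) (f0 : forall x, 0 <= f x).
Hypothesis fneg : forall x, x <= 0 -> f x = 0.
Hypothesis fquad : forall x, 0 < x -> x ^+ 2 * f x <= expR (- (2^-1 * x)).

Let mom (m : nat) := expR (m%:R * beta + \int[leb]_x (compensated_exp m x * f x)).

(** Quantile functions of the approximations converge almost everywhere along a subsequence.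
    Positivity of the limit remains a premise of the trigonometric clause: it becomes available only
    after the moments have identified the law of [Q]. *)
Lemma limit_law : exists d (T : measurableType d) (P : probability T R) (Q : T -> R),
  [/\ measurable_fun setT Q, forall w, 0 <= Q w,
      forall m, (\int[P]_w (Q w ^+ m)%:E = (mom m)%:E)%E &
      {ae P, forall w, 0 < Q w} -> forall u,
        let A := \int[leb]_x ((cos (u * x) - 1) * f x) in
        let B := u * beta + \int[leb]_x (compensated_sin u x * f x) in
        \int[P]_w cos (u * ln (Q w)) = expR A * cos B /\ \int[P]_w sin (u * ln (Q w)) = expR A * sin B].
Proof.
have [nu [nu1 nuM nuC]] := levy_approximation beta mf f0 fneg fquad.
have mE : measurable_fun setT (fun x : measurableTypeR R => expR x : R) := @measurable_expR R.
have [phi [Q_ [Q [phin [mQ_ mQ] [Q_0 Q0] Qlaw Qcvg]]]] :=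
  @helly_quantiles R _ (measurableTypeR R) nu (fun x => expR x : R) (expR beta) mE (fun x => expR_ge0 x)
    (expR_ge0 beta) nu1.
have phioo (a : nat -> R) (l : R) : a p @[p --> \oo] --> l -> a (phi n) @[n --> \oo] --> l.
  move=> al; apply: (cvg_comp phi a _ al); apply/cvgnyPge => k.
  by exists k => // n /= kn; exact: leq_trans kn (phin n).
pose P : probability _ R := uniform_prob (@ltr01 R).
have Plaw n (B : set R) : measurable B ->
    P (Q_ n @^-1` B) = nu (phi n) ((fun x : measurableTypeR R => expR x : R) @^-1` B).
  exact: Qlaw.
have Q_E m : exists b : nat -> R, (forall n, (\int[P]_w (Q_ n w ^+ m)%:E = (b n)%:E)%E) /\ (b n @[n --> \oo] --> mom m).
  have [a [aE acvg]] := nuM m; exists (a \o phi); split; last exact: phioo.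
  move=> n; rewrite -aE.
  pose g (x : R) : \bar R := (`|x ^+ m|)%:E.
  have mg : measurable_fun setT g.
    by apply/measurable_EFinP; apply: measurableT_comp => //; exact: measurable_funX.
  have g0 x : (0 <= g x)%E by rewrite lee_fin.
  have := @same_law_integral R _ _ P _ _ (nu (phi n)) _ _ (Q_ n) _ g (mQ_ n) mE (Plaw n) mg g0.
  have -> : (\int[P]_w g (Q_ n w) = \int[P]_w (Q_ n w ^+ m)%:E)%E.
    by apply: eq_integral => w _; rewrite /g ger0_norm // exprn_ge0.
  move=> ->; apply: eq_integral => x _; rewrite /g ger0_norm ?exprn_ge0 ?expR_ge0 //.
  by rewrite expRM_natl.
have [a aE] := choice Q_E.
exists _, _, P, Q; split => //.
  exact: (@moments_limit R _ _ P Q_ Q mQ_ mQ Q_0 Q0 Qcvg a mom (fun m => expR_gt0 _)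
    (fun m => (aE m).1) (fun m => (aE m).2)).
move=> Qpos u A B.
have trig (g : R -> R) (L : R) : continuous g -> (forall x, `|g x| <= 1) ->
    \int[nu p]_x g (u * x) @[p --> \oo] --> L -> \int[P]_w g (u * ln (Q w)) = L.
  move=> cg g1 gL.
  have mgu : measurable_fun setT (fun x : R => g (u * ln x)).
    apply: measurableT_comp; first exact: continuous_measurable_fun.
    by apply: measurable_funM => //; exact: measurable_ln.
  apply: (@log_limit R _ _ P Q_ Q mQ_ mQ Qcvg u g (fun n => \int[nu (phi n)]_x g (u * x)) L Qpos cg g1) => [n|].
    rewrite (@same_law_Rintegral R _ _ P _ _ (nu (phi n)) _ _ (Q_ n) _ (fun x => g (u * ln x)) (mQ_ n) mE (Plaw n) mgu (fun x => g1 _)).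
    by apply: eq_Rintegral => x _; rewrite expRK.
  exact: phioo gL.
have [h1 h2] := nuC u; split.
  exact: (trig cos _ (@continuous_cos R) (@norm_cos_le1 R) h1).
exact: (trig sin _ (@continuous_sin R) (@norm_sin_le1 R) h2).
Qed.
End limit_law.

(** * Powers of the law of the exponential functional *)

Lemma density_integral_signed d (T : measurableType d) (R : realType) (mu : {measure set T -> \bar R})
    (f g : T -> R) (mf : measurable_fun setT f) (f0 : forall x, 0 <= f x) :
  measurable_fun setT g -> mu.-integrable setT (EFin \o (fun x => g x * f x)) ->
  (\int[density mu mf f0]_x (g x)%:E = (\int[mu]_x (g x * f x))%:E)%E.
Proof.
move=> mg ig.
have mgE : measurable_fun setT (EFin \o g) by exact/measurable_EFinP.
rewrite /Rintegral fineK; last exact: integrable_fin_num ig.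
rewrite [LHS]integralE [RHS]integralE; congr (_ - _)%E.
  rewrite integral_density; [|exact: measurable_funepos|by move=> x; rewrite funepos_ge0].
  apply: eq_integral => x _; rewrite !funeposE /=.
  have [g0|g0] := leP 0 (g x).
    by rewrite !max_l ?lee_fin ?mulr_ge0 // -EFinM mulrC.
  by rewrite !max_r ?lee_fin ?mule0 ?(ltW g0) // mulr_le0_ge0 // ltW.
rewrite integral_density; [|exact: measurable_funeneg|by move=> x; rewrite funeneg_ge0].
apply: eq_integral => x _; rewrite !funenegE /=.
have [g0|g0] := leP 0 (g x).
  by rewrite !max_r ?mule0 // -?EFinN lee_fin oppr_le0 // mulr_ge0.
rewrite !max_l -?EFinN ?lee_fin ?oppr_ge0 ?(ltW g0) //.
  by rewrite -EFinM mulrN mulrC.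
by rewrite mulr_le0_ge0 // ltW.
Qed.

Lemma lebesgue_reflect (R : realType) (h : R -> \bar R) :
  measurable_fun setT h -> (forall x, (0 <= h x)%E) ->
  (\int[@lebesgue_measure R]_x h (- x)%R = \int[@lebesgue_measure R]_x h x)%E.
Proof.
move=> mh h0.
transitivity (\int[pushforward (@lebesgue_measure R) (-%R : _ -> measurableTypeR R)]_x h x)%E.
  by rewrite ge0_integral_pushforward.
by apply: eq_measure_integral => A mA _; exact: lebesgue_measureN.
Qed.

Section density_of_kappa.
Context (R : realType).
Local Notation D := (`[0%R, +oo[%classic : set R).
Local Notation leb := (@lebesgue_measure R : {measure set (measurableTypeR R) -> \bar R}).
Variables (kappa : {measure set (measurableTypeR R) -> \bar R}) (k : R -> R).
Hypothesis mk : measurable_fun setT k.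
Hypothesis kE : forall A : set (measurableTypeR R), measurable A -> A `<=` `[0%R, +oo[%classic ->
  kappa A = (\int[lebesgue_measure]_(x in A) (k x)%:E)%E.
Hypothesis kle : forall A : set (measurableTypeR R), measurable A -> A `<=` `[0%R, +oo[%classic ->
  (kappa A <= lebesgue_measure A)%E.

Let mD : measurable (D : set (measurableTypeR R)). Proof. exact: measurable_itv. Qed.

Let mkE (c : R) : measurable_fun setT (fun x : measurableTypeR R => (k x - c)%:E : \bar R).
Proof. by apply/measurable_EFinP; exact: measurable_funB. Qed.

Let null_of_integral (A : set (measurableTypeR R)) (g : R -> R) : measurable A -> measurable_fun setT g ->
  (forall x, A x -> 0 < g x) -> (\int[leb]_(x in A) (g x)%:E <= 0)%E -> leb.-negligible A.
Proof.
move=> mA mg g0 gint.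
have i0 : (\int[leb]_(x in A) `|(g x)%:E| = 0)%E.
  apply/eqP; rewrite eq_le integral_ge0 // andbT; apply: le_trans gint.
  by rewrite le_eqVlt; apply/orP; left; apply/eqP; apply: eq_integral => x /set_mem Ax; rewrite gee0_abs // lee_fin ltW // g0.
have mgA : measurable_fun A (fun x => (g x)%:E : \bar R).
  by apply/measurable_EFinP; exact: measurable_funTS.
have := (ae_eq_integral_abs leb mA mgA).1 i0.
apply: negligibleS => x Ax /= h; have := g0 x Ax; have [->] := h Ax.
by rewrite ltxx.
Qed.

Let mneg : measurable (D `&` k @^-1` `]-oo, 0%R[%classic : set (measurableTypeR R)).
Proof.
by apply: measurableI => //; rewrite -[X in measurable X]setTI; apply: mk => //; exact: measurable_itv.
Qed.

Let mbig (n : nat) : measurable (`[0%R, n%:R]%classic `&` k @^-1` `]1%R, +oo[%classic : set (measurableTypeR R)).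
Proof.
apply: measurableI; first exact: measurable_itv.
by rewrite -[X in measurable X]setTI; apply: mk => //; exact: measurable_itv.
Qed.

Let neg_null : leb.-negligible (D `&` k @^-1` `]-oo, 0%R[%classic).
Proof.
apply: (null_of_integral (g := fun x => - k x)) => //.
- exact: measurableT_comp.
- by move=> x [_] /=; rewrite in_itv /= oppr_gt0.
have : (0 <= \int[lebesgue_measure]_(x in D `&` k @^-1` `]-oo, 0%R[%classic) (k x)%:E)%E.
  by rewrite -kE // => x [].
have -> : (\int[lebesgue_measure]_(x in D `&` k @^-1` `]-oo, 0%R[) (k x)%:E =
    - \int[lebesgue_measure]_(x in D `&` k @^-1` `]-oo, 0%R[) (- k x)%:E)%E.
  rewrite -integral_ge0N; last by move=> x [_] /=; rewrite in_itv /= lee_fin oppr_ge0 => /ltW.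
  by apply: eq_integral => x _; rewrite -EFinN opprK.
by rewrite oppe_ge0.
Qed.

(** Restricting to [[0, n]] makes the Lebesgue measure of the set finite, so that it can be
    cancelled from [kappa A <= leb A]; a countable union recovers the half-line. *)
Let big_null : leb.-negligible (D `&` k @^-1` `]1%R, +oo[%classic).
Proof.
have : leb.-negligible (\bigcup_n (`[0%R, n%:R]%classic `&` k @^-1` `]1%R, +oo[%classic)).
  apply: negligible_bigcup => n.
  set A := _ `&` _; have mA : measurable A by exact: mbig.
  have Afin : (leb A < +oo)%E.
    apply: (@le_lt_trans _ _ (leb `[0%R, n%:R]%classic)).
      by apply: le_measure; [exact: mem_set|apply: mem_set; exact: measurable_itv|move=> x []].
    have E := lebesgue_measure_itv (`[0%R, n%:R] : interval R).
    rewrite (_ : leb _ = lebesgue_measure (`[0%R, n%:R]%classic : set R)) // E /=.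
    by case: ifP => _; rewrite ltry.
  apply: (null_of_integral (g := fun x => k x - 1)) => //.
  - exact: measurable_funB.
  - by move=> x [_] /=; rewrite in_itv /= andbT subr_gt0.
  have AD : A `<=` `[0%R, +oo[%classic.
    by move=> x [] /=; rewrite !in_itv /= => /andP[x0 _] _; rewrite x0.
  have := kle mA AD; rewrite kE //.
  have -> : (\int[lebesgue_measure]_(x in A) (k x)%:E = leb A + \int[leb]_(x in A) (k x - 1)%:E)%E.
    rewrite -[X in (X + _)%E]mul1e -integral_cst // -ge0_integralD //.
    - by apply: eq_integral => x _; rewrite -EFinD addrC subrK.
    - by move=> x [_] /=; rewrite in_itv /= andbT => /ltW h; rewrite lee_fin subr_ge0.
    - by apply: measurable_funTS; exact: mkE.
  rewrite (_ : lebesgue_measure A = leb A) //.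
  have Af : leb A \is a fin_num by rewrite ge0_fin_numE.
  by rewrite -[X in (_ <= X)%E -> _]adde0 leeD2lE.
apply: negligibleS => x [] /=; rewrite in_itv /= andbT => x0 kx.
exists (Num.truncn x).+1 => //; split => //=.
by rewrite in_itv /= x0 ltW // truncnS_gt.
Qed.

(** A density is only determined almost everywhere; this version lies in [[0, 1]] at every point,
    which makes the Levy density nonnegative everywhere. *)
Definition clip (x : R) : R := Num.min 1 (Num.max 0 (k x)).

Lemma measurable_clip : measurable_fun setT clip.
Proof. by apply: measurable_minr => //; exact: measurable_maxr. Qed.

Lemma clip01 x : 0 <= clip x <= 1.
Proof. by rewrite /clip le_min ler01 le_max lexx /= ge_min lexx. Qed.

Lemma clip_ae : {ae leb, forall x, 0 <= x -> k x = clip x}.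
Proof.
apply: negligibleS (negligibleU neg_null big_null) => x /= nx.
apply: contrapT => /not_orP[h1 h2]; apply: nx => x0.
have xD : D x by rewrite /= in_itv /= x0.
have k0 : 0 <= k x.
  by rewrite leNgt; apply/negP => kx; apply: h1; split => //=; rewrite in_itv.
have k1 : k x <= 1.
  by rewrite leNgt; apply/negP => kx; apply: h2; split => //=; rewrite in_itv /= kx.
by rewrite /clip max_r // min_r.
Qed.

Lemma kappa_clip (A : set (measurableTypeR R)) : measurable A -> A `<=` `[0%R, +oo[%classic ->
  kappa A = (\int[lebesgue_measure]_(x in A) (clip x)%:E)%E.
Proof.
move=> mA AD; rewrite kE //; apply: ae_eq_integral => //.
- by apply/measurable_EFinP; exact: measurable_funTS.
- by apply/measurable_EFinP; apply: measurable_funTS; exact: measurable_clip.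
- apply: negligibleS clip_ae => x /= h h'; apply: h => Ax; congr EFin; apply: h'.
  by have := AD x Ax; rewrite /= in_itv /= andbT.
Qed.
End density_of_kappa.

Lemma integral_kappa (R : realType) (kappa : {measure set (measurableTypeR R) -> \bar R}) (k g : R -> R) :
  measurable_fun setT k -> (forall x, 0 <= k x) ->
  (forall A : set (measurableTypeR R), measurable A -> A `<=` `[0%R, +oo[%classic ->
     kappa A = (\int[lebesgue_measure]_(x in A) (k x)%:E)%E) ->
  measurable_fun setT g -> (forall x, 0 <= x -> 0 <= g x) ->
  (\int[kappa]_(x in `[0%R, +oo[) (g x)%:E = \int[lebesgue_measure]_(x in `[0%R, +oo[) (g x * k x)%:E)%E.
Proof.
move=> mk k0 kE mg g0; set D := `[0, +oo[%classic : set R.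
have mD : measurable (D : set (measurableTypeR R)) by exact: measurable_itv.
pose lebm : {measure set (measurableTypeR R) -> \bar R} := @lebesgue_measure R.
have mk' : measurable_fun setT (k : measurableTypeR R -> R) by [].
transitivity (\int[density lebm mk' k0]_(x in D) (g x)%:E)%E.
  by apply: eq_measure_integral => A mA AD; rewrite kE.
have gp0 x : (0 <= ((fun x => (g x)%:E) \_ D) x)%E.
  by rewrite patchE; case: ifPn => // /set_mem; rewrite /D /= in_itv /= andbT => x0; rewrite lee_fin g0.
rewrite integral_mkcond integral_density //; last first.
  by apply/measurable_restrict => //; apply: measurable_funTS; exact/measurable_EFinP.
rewrite [RHS]integral_mkcond; apply: eq_integral => x _; rewrite !patchE.
by case: ifP => _; rewrite ?mule0 // -EFinM mulrC.
Qed.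

Section levy_density.
Context (R : realType).
Local Notation D := (`[0%R, +oo[%classic : set R).
Local Notation leb := (@lebesgue_measure R : {measure set (measurableTypeR R) -> \bar R}).
Variables (Phi : R -> R) (kappa : {measure set (measurableTypeR R) -> \bar R}) (k : R -> R).
Hypothesis Phi_gt0 : forall s, 0 < s -> 0 < Phi s.
Hypothesis dPhi : forall s, 0 < s -> derivable Phi s 1.
Hypothesis kappa0 : kappa `]-oo, 0%R[%classic = 0%E.
Hypothesis kappaL : forall s, 0 < s ->
     (\int[kappa]_x (expR (- (s * x)))%:E)%E = (derive1 Phi s / Phi s)%:E.
Hypothesis mk : measurable_fun setT k.
Hypothesis k01 : forall x, 0 <= k x <= 1.
Hypothesis kE : forall A : set (measurableTypeR R), measurable A -> A `<=` `[0%R, +oo[%classic ->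
  kappa A = (\int[lebesgue_measure]_(x in A) (k x)%:E)%E.

Definition levy_density (c x : R) : R :=
  if 0 < x then c * ((x * (expR x - 1))^-1 * (1 - k x)) else 0.

Lemma measurable_levy_density c : measurable_fun setT (levy_density c).
Proof.
apply: measurable_fun_ifT => //; first exact: measurable_fun_ltr.
apply: measurable_funM => //; apply: measurable_funM; last exact: measurable_funB.
apply: (measurableT_comp (@measurable_invr R)); apply: measurable_funM => //.
exact: measurable_funB.
Qed.

Lemma levy_density_ge0 c x : 0 <= c -> 0 <= levy_density c x.
Proof.
move=> c0; rewrite /levy_density; case: ifP => // x0.
have /andP[_ k1] := k01 x.
rewrite mulr_ge0 // mulr_ge0 ?subr_ge0 // invr_ge0 mulr_ge0 ?(ltW x0) //.
by rewrite subr_ge0 -[leLHS]expR0 ler_expR ltW.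
Qed.

Lemma levy_density_neg c x : x <= 0 -> levy_density c x = 0.
Proof. by rewrite /levy_density ltNge => ->. Qed.

(** With [y = x / 2] this is [2 * y <= expR y - expR (- y)], whose right side has derivative at
    least 2. It yields the exponential decay in [levy_density_quad]. *)
Let expB1_ge (x : R) : 0 < x -> x * expR (2^-1 * x) <= expR x - 1.
Proof.
move=> x0; set y := 2^-1 * x; have y0 : 0 <= y by rewrite mulr_ge0 // ltW.
have -> : expR x = expR y * expR y by rewrite -expRD; congr expR; rewrite /y; lra.
have -> : x = 2 * y by rewrite /y; lra.
have e0 := expR_gt0 y.
have ee : expR y * expR (- y) = 1 by rewrite -expRD subrr expR0.
suff h : 2 * y <= expR y - expR (- y).
  have := ler_wpM2r (ltW e0) h; rewrite mulrBl [expR (- y) * _]mulrC ee; lra.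
have dS (z : R) : z \in `]0, y[ -> is_derive z (1 : R) (fun z : R => expR z - expR (- z)) (expR z + expR (- z)).
  move=> _; apply: is_derive_eq; rewrite /GRing.scale /=; ring.
have cS : {within `[0, y], continuous (fun z : R => expR z - expR (- z))}.
  apply: continuous_subspaceT => z; apply: cvgB; first exact: continuous_expR.
  apply: (@continuous_cvg _ _ _ _ _ _ expR); first exact: continuous_expR.
  by apply: cvgN; exact: cvg_id.
have [c _] := @MVT_segment R (fun z => expR z - expR (- z)) (fun z => expR z + expR (- z)) 0 y y0 dS cS.
move=> hc; have -> : expR y - expR (- y) = (expR c + expR (- c)) * y.
  by move: hc; rewrite oppr0 expR0; lra.
rewrite ler_wpM2r //.
have c0 := expR_gt0 c; have c1 := expR_gt0 (- c).
have cc : expR c * expR (- c) = 1 by rewrite -expRD subrr expR0.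
have := sqr_ge0 (expR c - 1); have := expR_ge1Dx c; have := expR_ge1Dx (- c); lra.
Qed.

Lemma levy_density_quad c x : 0 <= c <= 1 -> 0 < x -> x ^+ 2 * levy_density c x <= expR (- (2^-1 * x)).
Proof.
move=> /andP[c0 c1] x0; rewrite /levy_density x0; have /andP[k0 k1] := k01 x.
have h := expB1_ge x0.
have e0 : 0 < expR x - 1 by apply: lt_le_trans h; rewrite mulr_gt0 ?expR_gt0.
have -> : x ^+ 2 * (c * ((x * (expR x - 1))^-1 * (1 - k x))) = c * (1 - k x) * (x / (expR x - 1)).
  by rewrite invfM; field; rewrite !gt_eqF.
apply: (@le_trans _ _ (x / (expR x - 1))).
  rewrite ler_piMl ?divr_ge0 ?(ltW x0) ?(ltW e0) //.
  by rewrite mulr_ile1 // ?subr_ge0 // lerBlDr lerDl.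
by rewrite ler_pdivrMr // expRN ler_pdivlMl ?expR_gt0 // mulrC.
Qed.

Let f := levy_density 1.
Let mf : measurable_fun setT f. Proof. exact: measurable_levy_density. Qed.
Let f0 x : 0 <= f x. Proof. exact: levy_density_ge0. Qed.
Let fneg x : x <= 0 -> f x = 0. Proof. exact: levy_density_neg. Qed.
Let fquad x : 0 < x -> x ^+ 2 * f x <= expR (- (2^-1 * x)).
Proof. by apply: levy_density_quad; rewrite ler01 lexx. Qed.

Let mPsi m : measurable_fun setT (@compensated_exp R m).
Proof.
apply: measurable_funD; first by apply: measurable_funB => //; exact: measurable_expRN.
by apply: measurable_funM => //; apply: measurable_funB => //; apply: measurableT_comp.
Qed.

Let iPsi m : leb.-integrable setT (EFin \o (fun x => compensated_exp m x * f x)).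
Proof. exact: (integrable_quad mf f0 fneg fquad (mPsi m) (@compensated_exp_quad R m)). Qed.

(** The compensator is linear in [m] and drops out. With [b = expR (- x)], the second difference of
    the powers is [b ^ m * (1 - b) ^ 2], and the denominator [x * (1 / b - 1)] cancels one factor
    [1 - b]. *)
Let Psi_diff m x : 0 < x ->
  compensated_exp m.+2 x * f x - 2 * (compensated_exp m.+1 x * f x) + compensated_exp m x * f x =
  frullani m.+1%:R m.+2%:R x * (1 - k x).
Proof.
move=> x0; rewrite /compensated_exp /f /levy_density x0 /frullani gt_eqF //.
set a := expR (- (m%:R * x)); set b := expR (- x).
have bp : 0 < b by exact: expR_gt0.
have E1 : expR (- (m.+1%:R * x)) = a * b by rewrite -expRD; congr expR; rewrite -natr1; ring.
have E2 : expR (- (m.+2%:R * x)) = a * b ^+ 2.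
  by rewrite -expRM_natl -expRD; congr expR; rewrite -[m.+2]addn2 natrD; ring.
have Ex : expR x = b^-1 by rewrite /b expRN invrK.
have b1 : b < 1 by rewrite -[ltRHS]expR0 ltr_expR oppr_lt0.
rewrite E1 E2 Ex -!natr1; field.
have b1' : 1 + -1 * b != 0 by rewrite mulN1r gt_eqF // subr_gt0.
by rewrite (gt_eqF x0) (gt_eqF bp) b1'.
Qed.

(** Two sequences with equal second differences that agree at [m = 0] and [m = 1], where the
    compensated integral vanishes. *)
Lemma log_exp_moment m : ln (exp_moment (fun m => Phi m%:R) m) =
  m%:R * ln (exp_moment (fun m => Phi m%:R) 1) + \int[leb]_x (compensated_exp m x * f x).
Proof.
set M := exp_moment _; pose E m := \int[leb]_x (compensated_exp m x * f x).
have zero (g : R -> R) : (forall x, g x = 0) -> \int[leb]_x (g x * f x) = 0.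
  move=> g0; transitivity (\int[leb]_x (0 : R)); last by rewrite Rintegral_cst // mul0r.
  by apply: eq_Rintegral => x _; rewrite g0 mul0r.
have E0 : E 0%N = 0 by apply: zero => x; rewrite /compensated_exp !mul0r oppr0 expR0; ring.
have E1 : E 1%N = 0 by apply: zero => x; rewrite /compensated_exp !mul1r; ring.
have mO : measurable (`]0, +oo[%classic : set (measurableTypeR R)) by exact: measurable_itv.
have rec n : E n.+2 - 2 * E n.+1 + E n = moment_diff Phi n.
  have i2 : leb.-integrable setT (EFin \o (fun x => 2 * (compensated_exp n.+1 x * f x))).
    exact: (integrableZl measurableT 2 (iPsi n.+1)).
  have i3 : leb.-integrable setT (EFin \o (fun x => compensated_exp n.+2 x * f x - 2 * (compensated_exp n.+1 x * f x))).
    exact: (integrableB measurableT (iPsi n.+2) i2).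
  have -> : E n.+2 - 2 * E n.+1 + E n = \int[leb]_x (compensated_exp n.+2 x * f x -
      2 * (compensated_exp n.+1 x * f x) + compensated_exp n x * f x).
    rewrite RintegralD; [|by []|exact: i3|exact: iPsi].
    rewrite RintegralB; [|by []|exact: iPsi|exact: i2].
    by rewrite RintegralZl //; exact: iPsi.
  have nn : n.+1%:R <= n.+2%:R :> R by rewrite ler_nat.
  have n0 : 0 < n.+1%:R :> R by [].
  have il := lebesgue_integrable_frullani n0 nn.
  have mF := @measurable_frullani R n.+1%:R n.+2%:R.
  have F0 (x : R) : 0 <= x -> 0 <= frullani n.+1%:R n.+2%:R x.
    move=> x0; have /andP[h _] := frullani_bounds nn x0.
    by apply: le_trans h; rewrite mulr_ge0 ?expR_ge0 // subr_ge0.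
  have iFk : leb.-integrable D (EFin \o (fun x => frullani n.+1%:R n.+2%:R x * k x)).
    apply: le_integrable il => //.
      by apply/measurable_EFinP; apply: measurable_funTS; exact: measurable_funM.
    move=> x /=; rewrite in_itv /= andbT => x0; have /andP[k0 k1] := k01 x.
    by rewrite lee_fin normrM (ger0_norm k0) ler_piMr.
  rewrite (moment_diffE Phi_gt0 dPhi kappa0 kappaL).
  have -> : \int[kappa]_(x in D) frullani n.+1%:R n.+2%:R x =
      \int[leb]_(x in D) (frullani n.+1%:R n.+2%:R x * k x).
    rewrite /Rintegral (integral_kappa mk _ kE mF F0) // => x.
    by have /andP[] := k01 x.
  rewrite -RintegralB //.
  have iD : leb.-integrable D (EFin \o (fun x => frullani n.+1%:R n.+2%:R x - frullani n.+1%:R n.+2%:R x * k x)).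
    exact: (integrableB _ il iFk).
  rewrite -Rintegral_itv_obnd_cbnd; last first.
    by apply: integrableS iD => // x /=; rewrite !in_itv /= !andbT => /ltW.
  rewrite /Rintegral [in RHS]integral_mkcond; congr fine; apply: eq_integral => x _.
  rewrite patchE; case: ifPn => [/set_mem|] /=.
    by rewrite in_itv /= andbT => x0; rewrite Psi_diff // mulrBr mulr1.
  move=> xD; have x0 : x <= 0.
    by rewrite leNgt; apply: contra xD => x0; apply/mem_set; rewrite /= in_itv /= x0.
  by rewrite fneg // !mulr0 subr0 addr0.
have M0 : ln (M 0%N) = 0 by rewrite /M /exp_moment big_ord0 ln1.
suff h n : ln (M n) = n%:R * ln (M 1%N) + E n /\ ln (M n.+1) = n.+1%:R * ln (M 1%N) + E n.+1.
  by have [] := h m.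
elim: n => [|n [IH1 IH2]]; first by rewrite M0 E0 E1 mul0r mul1r !addr0.
split=> //; have := rec n; rewrite /moment_diff -/M.
have -> : n.+2%:R = n%:R + 2 :> R by rewrite -natrD addn2.
move: IH1 IH2; rewrite -natr1; nra.
Qed.

Lemma power_law (c : R) : 0 <= c <= 1 ->
  exists d (T : measurableType d) (P : probability T R) (Q : T -> R),
  [/\ measurable_fun setT Q, forall w, 0 <= Q w,
      forall m, (\int[P]_w (Q w ^+ m)%:E = (expR (c * ln (exp_moment (fun m => Phi m%:R) m)))%:E)%E &
      {ae P, forall w, 0 < Q w} -> forall u,
        let beta := c * ln (exp_moment (fun m => Phi m%:R) 1) in
        let A := \int[leb]_x ((cos (u * x) - 1) * levy_density c x) in
        let B := u * beta + \int[leb]_x (compensated_sin u x * levy_density c x) in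
        \int[P]_w cos (u * ln (Q w)) = expR A * cos B /\ \int[P]_w sin (u * ln (Q w)) = expR A * sin B].
Proof.
move=> c01; have /andP[c0 c1] := c01.
have [d [T [P [Q [mQ Q0 QM QC]]]]] := limit_law (c * ln (exp_moment (fun m => Phi m%:R) 1))
  (measurable_levy_density c) (fun x => levy_density_ge0 x c0) (@levy_density_neg c)
  (fun x => levy_density_quad c01).
exists d, T, P, Q; split => // m; rewrite QM (log_exp_moment m); congr EFin; congr expR.
have -> : \int[leb]_x (compensated_exp m x * levy_density c x) = c * \int[leb]_x (compensated_exp m x * f x).
  rewrite -RintegralZl //.
  apply: eq_Rintegral => x _; rewrite /f /levy_density; case: ifP => _; last by rewrite !mulr0.
  by rewrite mul1r; ring.
ring.
Qed.
End levy_density.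

Lemma ae_eq_measure d (T : measurableType d) (R : realType) (mu : {measure set T -> \bar R}) (A B : set T) :
  measurable A -> measurable B -> {ae mu, forall x, A x <-> B x} -> mu A = mu B.
Proof.
move=> mA mB AB.
have ind (C : set T) : measurable C -> mu C = (\int[mu]_x (\1_C x)%:E)%E.
  by move=> mC; rewrite integral_indic // setIT.
rewrite !ind //; apply: ge0_ae_eq_integral => //.
- by apply/measurable_EFinP; exact: measurable_indic.
- by apply/measurable_EFinP; exact: measurable_indic.
- apply: filterS AB => x [h1 h2] _; rewrite !indicE; congr ((_ : bool)%:R)%:E.
  by apply/idP/idP => /set_mem h; apply/mem_set; auto.
Qed.

Lemma exp_moment_le (R : realType) (Phi : R -> R) m : (forall s, 0 < s -> 0 < Phi s) ->
  (forall s t, 0 < s -> s <= t -> Phi s <= Phi t) ->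
  exp_moment (fun m => Phi m%:R) m <= (Phi 1)^-1 ^+ m * m`!%:R.
Proof.
move=> P0 Pmono; elim: m => [|m IH]; first by rewrite /exp_moment big_ord0 expr0 mul1r.
rewrite /exp_moment big_ord_recr /= -/(exp_moment (fun m => Phi m%:R) m) factS natrM exprSr.
have -> : (Phi 1)^-1 ^+ m * (Phi 1)^-1 * (m.+1%:R * m`!%:R) = (Phi 1)^-1 ^+ m * m`!%:R * (m.+1%:R * (Phi 1)^-1) by ring.
rewrite ler_pM ?(ltW (exp_moment_gt0 P0 m)) ?divr_ge0 ?(ltW (P0 _ _)) //.
by rewrite ler_wpM2l // lef_pV2 ?posrE ?P0 // Pmono // ler1n.
Qed.

Lemma preimage_EFin_measurable (R : realType) (B : set (\bar R)) : measurable B ->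
  measurable (@EFin R @^-1` B : set R).
Proof.
move=> mB; rewrite -[X in measurable X]setTI.
have : measurable_fun setT (@EFin R) by exact/measurable_EFinP.
exact.
Qed.

(** * From prescribed moments to multiplicative infinite divisibility *)

Section law_of_fine.
Context (R : realType) d (Omega : measurableType d) (P : probability Omega R) (Y : Omega -> \bar R).
Hypothesis mY : measurable_fun setT Y.
Hypothesis Yfin : P [set w | (0 < Y w < +oo)%E] = 1%E.

Let mset_fin : measurable [set w | (0 < Y w < +oo)%E].
Proof.
rewrite (_ : [set w | _] = setT `&` Y @^-1` `]0%E, +oo%E[%classic).
  by apply: mY => //; exact: emeasurable_itv.
by rewrite setTI; apply/seteqP; split=> w /=; rewrite in_itv.
Qed.

Lemma ae_finite : {ae P, forall w, (0 < Y w < +oo)%E}.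
Proof.
exists (~` [set w | (0 < Y w < +oo)%E]); split => //; first exact: measurableC.
by rewrite probability_setC // Yfin subee.
Qed.

Lemma measurable_fine_RV : measurable_fun setT (fun w => fine (Y w)).
Proof. exact: measurableT_comp. Qed.

Lemma law_fine (B : set (\bar R)) : measurable B ->
  P ((fun w => fine (Y w)) @^-1` (@EFin R @^-1` B)) = P (Y @^-1` B).
Proof.
move=> mB; apply: ae_eq_measure.
- rewrite -[X in measurable X]setTI; apply: measurable_fine_RV => //.
  exact: preimage_EFin_measurable.
- by rewrite -[X in measurable X]setTI; exact: mY.
- apply: filterS ae_finite => w /andP[w0 wy] /=.
  by rewrite fineK // fin_numE gt_eqF ?lt_eqF // (lt_trans _ w0) // ltNyr.
Qed.

Lemma fine_pt0 : P ((fun w => fine (Y w)) @^-1` [set 0]) = 0%E.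
Proof.
rewrite -(measure0 P); apply: ae_eq_measure => //.
  by rewrite -[X in measurable X]setTI; apply: measurable_fine_RV.
apply: filterS ae_finite => w /andP[w0 wy] /=; split => // f0.
by have := fine_gt0 (introT andP (conj w0 wy)); rewrite f0 ltxx.
Qed.
End law_of_fine.

Section sufficiency.
Context (R : realType) d (Omega : measurableType d) (P : probability Omega R) (Y : Omega -> \bar R).
Variables (M : nat -> R) (C : R).
Hypothesis mY : measurable_fun setT Y.
Hypothesis Yfin : P [set w | (0 < Y w < +oo)%E] = 1%E.
Hypothesis Y0 : forall w, (0 <= Y w)%E.
Hypothesis YM : forall m, (\int[P]_w (fine (Y w) ^+ m)%:E = (M m)%:E)%E.
Hypothesis M0 : forall m, 0 < M m.
Hypothesis C0 : 0 < C.
Hypothesis MC : forall m, M m <= C ^+ m * m`!%:R.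

Lemma law_of_moments d' (T : measurableType d') (P' : probability T R) (Q : T -> R) :
  measurable_fun setT Q -> (forall w, 0 <= Q w) ->
  (forall m, (\int[P']_w (Q w ^+ m)%:E = (M m)%:E)%E) ->
  forall B : set R, measurable B -> P' (Q @^-1` B) = P ((fun w => fine (Y w)) @^-1` B).
Proof.
move=> mQ Q0 QM; apply: (same_moments_same_law C0) => //.
- exact: measurable_fine_RV.
- by move=> w; exact: fine_ge0.
- by move=> n; rewrite QM YM.
- by move=> n; rewrite QM lee_fin.
Qed.

(** The factors must be positive everywhere, while the copies are known to be nonzero and
    nonnegative only almost surely; [psi] alters them on a null set. *)
Let psi (x : R) : R := if x == 0 then 1 else `|x|.

Let mpsi : measurable_fun setT psi.
Proof. by apply: measurable_fun_ifT => //; exact: measurable_fun_eqr. Qed.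

Let psi_gt0 x : 0 < psi x.
Proof. by rewrite /psi; case: ifPn => // x0; rewrite normr_gt0. Qed.

(** A product of [n] independent copies of a root has the moments [M], hence the law of [Y], since
    these moments determine it. *)
Lemma mult_inf_div_of_roots :
  (forall n, (2 <= n)%N -> exists d (T : measurableType d) (P' : probability T R) (Q : T -> R),
    [/\ measurable_fun setT Q, forall w, 0 <= Q w &
      forall m, (\int[P']_w (Q w ^+ m)%:E = (expR (n%:R^-1 * ln (M m)))%:E)%E]) ->
  mult_inf_div P Y.
Proof.
move=> roots; split => // n n2.
have [d1 [T [P1 [Q [mQ Q0 QM]]]]] := roots n n2.
have [d2 [T2 [P2 [Z [mZ iZ lZ _]]]]] := iid_copies P1 n mQ.
have n0 : (0 < n)%N by exact: ltn_trans n2.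
pose pr w := \prod_(i < n) `|Z i w|.
have mnZ i : measurable_fun setT (fun w => `|Z i w|) by exact: measurableT_comp.
have mpr : measurable_fun setT pr by apply: measurable_prod => i _; exact: mnZ.
have pr0 w : 0 <= pr w by apply: prodr_ge0.
have prM m : (\int[P2]_w (pr w ^+ m)%:E = (M m)%:E)%E.
  pose g (x : R) : \bar R := (`|x| ^+ m)%:E.
  have mg' : measurable_fun setT (fun x : R => `|x| ^+ m).
    by apply: measurable_funX; exact: normr_measurable.
  have mg : measurable_fun setT g by exact/measurable_EFinP.
  have g0 x : (0 <= g x)%E by rewrite lee_fin exprn_ge0.
  transitivity (\int[P2]_w (\prod_(i < n) `|Z i w| ^+ m)%:E)%E.
    by apply: eq_integral => w _; rewrite /pr prodrXl.
  rewrite (@expectation_prod _ _ R P2 n Z (fun i => mZ i) iZ (fun _ x => `|x| ^+ m)) //.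
  transitivity (\prod_(i < n) (expR (n%:R^-1 * ln (M m)))%:E)%E.
    apply: eq_bigr => i _; rewrite -QM.
    have := same_law_integral (mZ i) mQ (lZ i) mg g0; rewrite /g => ->.
    by apply: eq_integral => w _; rewrite ger0_norm.
  rewrite prodEFin prodr_const card_ord -expRM_natl mulrA mulfV ?pnatr_eq0 -?lt0n // mul1r.
  by rewrite lnK // posrE.
have prlaw := law_of_moments mpr pr0 prM.
(* A zero factor would make the product 0, and the product has the law of the almost surely positive
   [Y]. *)
have Z_pt0 (i : 'I_n) : P2 (Z i @^-1` [set 0]) = 0%E.
  apply/eqP; rewrite eq_le measure_ge0 andbT -(fine_pt0 mY Yfin) -prlaw //.
  apply: le_measure.
  - by apply: mem_set; rewrite -[X in measurable X]setTI; exact: mZ.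
  - by apply: mem_set; rewrite -[X in measurable X]setTI; exact: mpr.
  - by move=> w /= Zw; rewrite /pr (bigD1 i) //= Zw normr0 mul0r.
have Zneq0 : {ae P2, forall w, forall i : 'I_n, Z i w != 0}.
  have mZ0 (i : nat) : measurable (if (i < n)%N then Z i @^-1` [set 0] else set0).
    by case: ifP => // _; rewrite -[X in measurable X]setTI; exact: mZ.
  have : P2.-negligible (\bigcup_i (if (i < n)%N then Z i @^-1` [set 0] else set0)).
    apply: negligible_bigcup => i; apply/negligibleP => //.
    by case: ifP => [ilt|_]; [exact: (Z_pt0 (Ordinal ilt))|exact: measure0].
  apply: negligibleS => w /= nw; apply: contrapT => h; apply: nw => i; apply/eqP => Zi.
  by apply: h; exists (i : nat) => //; rewrite ltn_ord.
exists d2, T2, P2, (fun i w => psi (Z i w)); split.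
- by move=> i; exact: measurableT_comp.
- by move=> i w; exact: psi_gt0.
- move=> B mB; have := iZ (fun i => psi @^-1` B i); apply => i.
  by rewrite -[X in measurable X]setTI; exact: mpsi.
- move=> i j B mB.
  have mB' : measurable (psi @^-1` B) by rewrite -[X in measurable X]setTI; exact: mpsi.
  by have := lZ i _ mB'; rewrite -(lZ j _ mB').
- move=> B mB; rewrite -(law_fine mY Yfin mB) -prlaw; last exact: preimage_EFin_measurable.
  have mB' := preimage_EFin_measurable mB.
  apply: ae_eq_measure.
  + rewrite -[X in measurable X]setTI.
    have : measurable_fun setT (fun w => \prod_(i < n) psi (Z i w)).
      by apply: measurable_prod => i _; exact: measurableT_comp.
    by move=> h; exact: (h measurableT _ mB').
  + by rewrite -[X in measurable X]setTI; exact: mpr.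
  + apply: filterS Zneq0 => w Zw /=; rewrite /pr.
    have -> : \prod_(i < n) psi (Z i w) = \prod_(i < n) `|Z i w|; last by [].
    by apply: eq_bigr => i _; rewrite /psi (negbTE (Zw i)).
Qed.
End sufficiency.

(** * Levy-Khintchine representation *)

Section reflection.
Context (R : realType).
Local Notation leb := (@lebesgue_measure R : {measure set (measurableTypeR R) -> \bar R}).

Lemma lebesgue_reflect_signed (h : R -> \bar R) : measurable_fun setT h ->
  (\int[leb]_x h (- x)%R = \int[leb]_x h x)%E.
Proof.
move=> mh; rewrite [LHS]integralE [RHS]integralE; congr (_ - _)%E.
  rewrite -[RHS]lebesgue_reflect; [|exact: measurable_funepos|by move=> x; rewrite funepos_ge0].
  by apply: eq_integral => x _; rewrite !funeposE.
rewrite -[RHS]lebesgue_reflect; [|exact: measurable_funeneg|by move=> x; rewrite funeneg_ge0].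
by apply: eq_integral => x _; rewrite !funenegE.
Qed.

Lemma integrable_reflect (h : R -> R) : leb.-integrable setT (EFin \o h) ->
  leb.-integrable setT (EFin \o (fun x => h (- x))).
Proof.
move=> ih; have mh : measurable_fun setT (EFin \o h) by exact: (measurable_int leb).
have mN : measurable_fun setT (fun x : R => - x) by exact: measurableT_comp.
apply/integrableP; split.
  by have := measurableT_comp mh mN.
have /integrableP[_ fin] := ih.
rewrite -(@lebesgue_reflect _ (fun x => `|(EFin \o h) x|%E)) // in fin.
exact: measurableT_comp.
Qed.

Lemma ae_reflect (Q : R -> Prop) : {ae leb, forall x, Q x} -> {ae leb, forall x, Q (- x)}.
Proof.
move=> [N [mN N0 QN]]; exists ((-%R : R -> R) @^-1` N); split.
- rewrite -[X in measurable X]setTI.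
  have mo : measurable_fun setT (fun x : R => - x) by exact: measurableT_comp.
  exact: mo.
- by have := @lebesgue_measureN R N mN; rewrite /pushforward => h; rewrite -[RHS]N0; exact: h.
- by move=> x /= nQ; apply: QN.
Qed.
End reflection.

Section levy_triplet.
Context (R : realType).
Local Notation leb := (@lebesgue_measure R : {measure set (measurableTypeR R) -> \bar R}).
Variables (f : R -> R) (beta : R).
Hypotheses (mf : measurable_fun setT f) (f0 : forall x, 0 <= f x).
Hypothesis fneg : forall x, x <= 0 -> f x = 0.
Hypothesis fquad : forall x, 0 < x -> x ^+ 2 * f x <= expR (- (2^-1 * x)).

Let fN (x : measurableTypeR R) : R := f (- x).
Let mfN : measurable_fun setT fN.
Proof.
have mN : measurable_fun setT (fun x : R => - x) by exact: measurableT_comp.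
exact: (measurableT_comp mf mN).
Qed.
Let fN0 x : 0 <= fN x. Proof. exact: f0. Qed.

(** [f] is the density of the jump sizes; the jumps of the logarithm are negative, hence the
    reflection. *)
Definition levy_measure : {measure set (measurableTypeR R) -> \bar R} := density leb mfN fN0.

Let levy_integral (G : R -> R) : measurable_fun setT G ->
  leb.-integrable setT (EFin \o (fun x => G (- x) * f x)) ->
  (\int[levy_measure]_x (G x)%:E = (\int[leb]_x (G (- x) * f x))%:E)%E.
Proof.
move=> mG iG; have iG' := integrable_reflect iG.
have iG2 : leb.-integrable setT (EFin \o (fun x => G x * fN x)).
  by apply: eq_integrable iG' => // x _; rewrite /= opprK.
rewrite /levy_measure density_integral_signed //; congr EFin; congr fine.
have mGf : measurable_fun setT (fun x : R => (G (- x) * f x)%:E) by exact: (measurable_int leb iG).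
rewrite -[RHS]lebesgue_reflect_signed //.
by apply: eq_integral => x _; rewrite opprK.
Qed.

Let trunc1 (x : R) : R := if `|x| < 1 then 1 else 0.

Let mtrunc1 : measurable_fun setT trunc1.
Proof.
apply: measurable_fun_ifT => //; apply: measurable_fun_ltr => //.
Qed.

Let mexp1 : measurable_fun setT (fun x : R => 1 - expR (- x)).
Proof. by apply: measurable_funB => //; apply: measurableT_comp. Qed.

(** The exponent is already that of an infinitely divisible law without Gaussian part, up to the
    choice of compensator: passing from [1 - expR (- x)] to the truncation at 1 only changes the
    drift. *)
Lemma levy_khintchine_density d (T : measurableType d) (P : probability T R) (V : T -> R) :
  (forall u, let A := \int[leb]_x ((cos (u * x) - 1) * f x) in
    let B := u * beta + \int[leb]_x (compensated_sin u x * f x) in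
    \int[P]_w cos (u * V w) = expR A * cos B /\ \int[P]_w sin (u * V w) = expR A * sin B) ->
  measurable_fun setT V ->
  exists b s2 : R, levy_khintchine P V b s2 levy_measure.
Proof.
move=> VE mV.
(* Difference of the two compensators; it is at most quadratic at 0, so its integral against [f] is
   a finite correction of the drift. *)
pose cut x := (1 - expR (- x)) - x * trunc1 x.
have mcut : measurable_fun setT cut by apply: (measurable_funB mexp1); exact: measurable_funM.
have cut_quad x : 0 < x -> `|cut x| <= 1 * x ^+ 2.
  move=> x0; rewrite mul1r /cut /trunc1 (gtr0_norm x0).
  have e0 := expR_gt0 (- x); have /andP[h1 h2] := expRN_bounds (ltW x0).
  case: ltP => x1.
    by rewrite mulr1 ler_norml; apply/andP; split; lra.
  rewrite mulr0 subr0 ler_norml; have := sqr_ge0 (x - 1).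
  have e1 : expR (- x) <= 1 by rewrite -[leRHS]expR0 ler_expR oppr_le0 ltW.
  by rewrite sqrrB1 => h3; apply/andP; split; nra.
have icut := integrable_quad mf f0 fneg fquad mcut cut_quad.
exists (beta + \int[leb]_x (cut x * f x)), 0; split => //.
- by have E := @integral_set1 R (fun x => (fN x)%:E) 0; exact: E.
- pose G (x : R) := Num.min 1 (x ^+ 2).
  have mG : measurable_fun setT G by apply: measurable_minr => //; exact: measurable_funX.
  have G_quad x : 0 < x -> `|G x| <= 1 * x ^+ 2.
    by move=> _; rewrite mul1r ger0_norm /G ?ge_min ?lexx ?orbT // le_min ler01 sqr_ge0.
  have iG := integrable_quad mf f0 fneg fquad mG G_quad.
  rewrite levy_integral ?ltry //.
  by apply: eq_integrable iG => // x _; rewrite /= sqrrN.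
- move=> u; rewrite mul0r oppr0 mul0r add0r.
  have [hc hs] := VE u.
  have fin_cos : P.-integrable setT (EFin \o (fun w => cos (u * V w))) by exact: integrable_cosX.
  have fin_sin : P.-integrable setT (EFin \o (fun w => sin (u * V w))) by exact: integrable_sinX.
  have mc : measurable_fun setT (fun x : R => cos (u * x) - 1).
    by apply: measurable_funB => //; apply: measurable_cosX.
  have ic := integrable_quad mf f0 fneg fquad mc (fun x _ => cos_quad u x).
  have -> : (\int[levy_measure]_x (cos (u * x) - 1)%:E = (\int[leb]_x ((cos (u * x) - 1) * f x))%:E)%E.
    rewrite (levy_integral mc); last by apply: eq_integrable ic => // x _; rewrite /= mulrN cosN.
    by congr EFin; apply: eq_Rintegral => x _; rewrite mulrN cosN.
  pose G (x : R) := sin (u * x) - u * x * trunc1 x.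
  have ms : measurable_fun setT (fun x : R => sin (u * x)) by apply: measurable_sinX.
  have mG : measurable_fun setT G.
    by apply: measurable_funB => //; apply: measurable_funM => //; exact: measurable_funM.
  have GN x : G (- x) = compensated_sin u x - u * cut x.
    rewrite /G /compensated_sin /cut (_ : trunc1 (- x) = trunc1 x) ?mulrN ?sinN; last by rewrite /trunc1 normrN.
    by move: (trunc1 x) => t; ring.
  have msin : measurable_fun setT (compensated_sin u).
    by apply: measurable_funB => //; exact: measurable_funM.
  have is_ := integrable_quad mf f0 fneg fquad msin (@compensated_sin_quad R u).
  have iucut : leb.-integrable setT (EFin \o (fun x => u * (cut x * f x))).
    exact: (integrableZl measurableT u icut).
  have iG : leb.-integrable setT (EFin \o (fun x => G (- x) * f x)).
    apply: eq_integrable (integrableB measurableT is_ iucut) => // x _ /=.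
    by rewrite (_ : G (- x) * f x = compensated_sin u x * f x - u * (cut x * f x)) // GN mulrBl mulrA.
  have -> : (\int[levy_measure]_x (sin (u * x) - u * x * (if (`|x| < 1)%R then 1 else 0))%:E =
      (\int[leb]_x (compensated_sin u x * f x) - u * \int[leb]_x (cut x * f x))%:E)%E.
    rewrite (levy_integral mG iG); congr EFin.
    rewrite -RintegralZl // -RintegralB //.
    by apply: eq_Rintegral => x _; rewrite GN mulrBl -mulrA.
  have -> : (beta + \int[leb]_x (cut x * f x)) * u +
     fine (\int[leb]_x (compensated_sin u x * f x) - u * \int[leb]_x (cut x * f x))%:E =
     u * beta + \int[leb]_x (compensated_sin u x * f x) by rewrite /=; ring.
  rewrite /= -hc -hs /Rintegral !fineK //; first exact: (integrable_fin_num _ fin_sin).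
  exact: (integrable_fin_num _ fin_cos).
Qed.
End levy_triplet.

(** * Radon-Nikodym density of kappa *)

Section density_existence.
Context (R : realType).
Local Notation leb := (@lebesgue_measure R : {measure set (measurableTypeR R) -> \bar R}).
Variables (kappa : {measure set (measurableTypeR R) -> \bar R}).
Hypothesis kappa0 : kappa `]-oo, 0%R[%classic = 0%E.
Hypothesis kappa_fin : (\int[kappa]_x (expR (- (1 * x)))%:E < +oo)%E.
Hypothesis kle : forall A : set (measurableTypeR R), measurable A -> A `<=` `[0%R, +oo[%classic ->
  (kappa A <= lebesgue_measure A)%E.

Let e (x : measurableTypeR R) : R := expR (- (1 * x)).
Let me : measurable_fun setT e. Proof. exact: measurable_expRN. Qed.
Let e0 x : 0 <= e x. Proof. exact: expR_ge0. Qed.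

Let kfin : {measure set (measurableTypeR R) -> \bar R} := density kappa me e0.

Let kfinT : fin_num_fun kfin.
Proof.
move=> B mB; rewrite ge0_fin_numE //; apply: le_lt_trans kappa_fin.
have -> : (\int[kappa]_x (expR (- (1 * x)))%:E = kfin setT)%E by [].
by apply: (le_measure kfin (mem_set mB) (mem_set measurableT)).
Qed.

Let kappa_dom (A : set (measurableTypeR R)) : measurable A -> leb A = 0%E -> kappa A = 0%E.
Proof.
move=> mA A0; apply/eqP; rewrite eq_le measure_ge0 andbT.
have mP : measurable (A `&` `[0%R, +oo[%classic : set (measurableTypeR R)).
  by apply: measurableI => //; exact: measurable_itv.
have mNeg : measurable (`]-oo, 0%R[%classic : set (measurableTypeR R)) by exact: measurable_itv.
have sub : A `<=` (A `&` `[0%R, +oo[%classic) `|` `]-oo, 0%R[%classic.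
  move=> x Ax /=; rewrite !in_itv /= andbT; have [x0|x0] := leP 0 x; [by left|by right].
apply: le_trans (le_measure kappa (mem_set mA) (mem_set (measurableU _ _ mP mNeg)) sub) _.
apply: le_trans (measureU2 _ mP mNeg) _.
rewrite [X in (_ + X)%E](_ : _ = 0%E) ?adde0; last exact: kappa0.
apply: le_trans (kle mP (fun x => @proj2 _ _)) _.
rewrite -[leRHS]A0; apply: (le_measure leb (mem_set mP) (mem_set mA)).
exact: subIsetl.
Qed.

(** The weight [expR (- x)] makes [kappa] a finite measure, by its Laplace transform at 1, still
    dominated by Lebesgue measure. Radon-Nikodym applies to that measure, and multiplying by
    [expR x] undoes the weight. *)
Lemma kappa_density_exists : exists k : R -> R, measurable_fun setT k /\
  (forall A : set (measurableTypeR R), measurable A -> A `<=` `[0%R, +oo[%classic ->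
     kappa A = (\int[lebesgue_measure]_(x in A) (k x)%:E)%E).
Proof.
pose kf : {finite_measure set (measurableTypeR R) -> \bar R} :=
  HB.pack (Measure.sort kfin) (Measure_isFinite.Build _ _ _ kfin kfinT).
have dom : kf `<< (@lebesgue_measure R : {sigma_finite_measure set (measurableTypeR R) -> \bar R}).
  apply/null_content_dominatesP => A mA A0.
  apply: null_set_integral => //; last exact: kappa_dom.
  by apply/measurable_EFinP; exact: measurable_funTS.
have [g [g0 gfin ig gE]] := radon_nikodym_sigma_finite dom.
pose gr (x : measurableTypeR R) : R := fine (g x).
have mgE : measurable_fun setT g by exact: (measurable_int _ ig).
have mg : measurable_fun setT gr by exact: measurableT_comp.
have gr0 x : 0 <= gr x by exact: fine_ge0.
exists (fun x => expR x * gr x); split; first by apply: measurable_funM => //; exact: measurable_expR.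
move=> A mA _.
have mh : measurable_fun setT (fun x : measurableTypeR R => (\1_A x * expR x : R)%:E).
  apply/measurable_EFinP; apply: measurable_funM; first exact: measurable_indic.
  exact: measurable_expR.
have h0 x : (0 <= (\1_A x * expR x : R)%:E)%E by rewrite lee_fin mulr_ge0 ?expR_ge0.
transitivity (\int[kfin]_x (\1_A x * expR x : R)%:E)%E.
  rewrite integral_density //.
  transitivity (\int[kappa]_x (\1_A x : R)%:E)%E; first by rewrite integral_indic // setIT.
  apply: eq_integral => x _; rewrite -EFinM /e mul1r; congr EFin.
  by rewrite mulrCA -expRD addNr expR0 mulr1.
transitivity (\int[density leb mg gr0]_x (\1_A x * expR x : R)%:E)%E.
  apply: eq_measure_integral => B mB _.
  rewrite -[LHS]/(kf B) gE //; apply: eq_integral => x _.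
  by rewrite /gr fineK.
rewrite integral_density // [RHS]integral_mkcond; apply: eq_integral => x _.
rewrite patchE indicE; case: ifP => _; last by rewrite mul0r mule0.
by rewrite mul1r -EFinM mulrC.
Qed.
End density_existence.

(** For [x < 0] both [x] and [1 - expR (- x)] are negative, so the product of their inverses is the
    value at [- x] of the positive density; [clip k] and [k] agree almost everywhere. *)
Lemma levy_measure_density (R : realType) (k : R -> R)
  (mf : measurable_fun setT (levy_density (clip k) 1)) (f0 : forall x, 0 <= levy_density (clip k) 1 x)
  (A : set (measurableTypeR R)) : measurable A -> measurable_fun setT k ->
  {ae (@lebesgue_measure R : {measure set (measurableTypeR R) -> \bar R}), forall x : R, 0 <= x -> k x = clip k x} ->
  levy_measure mf f0 A = (\int[lebesgue_measure]_(x in A `&` `]-oo, 0%R[%classic)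
                    (x^-1 * (1 - expR (- x))^-1 * (1 - k (- x)))%:E)%E.
Proof.
move=> mA mk kc.
have mneg : measurable (`]-oo, 0%R[%classic : set (measurableTypeR R)) by exact: measurable_itv.
have mI : measurable (A `&` `]-oo, 0%R[%classic) by exact: measurableI.
have mN : measurable_fun setT (fun x : R => - x) by exact: measurableT_comp.
have mh (l : R -> R) : measurable_fun setT l ->
    measurable_fun setT (fun x : R => (x^-1 * (1 - expR (- x))^-1 * (1 - l (- x)))%:E).
  move=> ml; apply/measurable_EFinP; apply: measurable_funM.
    apply: measurable_funM; first exact: measurable_invr.
    apply: (measurableT_comp (@measurable_invr R)); apply: measurable_funB => //.
    exact: measurableT_comp.
  by apply: measurable_funB => //; exact: (measurableT_comp ml mN).
transitivity (\int[lebesgue_measure]_(x in A `&` `]-oo, 0%R[%classic)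
    (x^-1 * (1 - expR (- x))^-1 * (1 - clip k (- x)))%:E)%E.
  rewrite integral_mkcondr; apply: eq_integral => x _.
  rewrite patchE /levy_density oppr_gt0.
  have [x0|x0] := ltP x 0; last by rewrite memNset //= in_itv /= ltNge x0.
  rewrite mem_set //= ?in_itv //=; congr EFin.
  by rewrite mul1r invfM invrN -[expR (- x) - 1]opprB invrN mulrNN.
apply: ae_eq_integral => //.
- by apply: measurable_funTS; apply: mh; exact: measurable_clip.
- by apply: measurable_funTS; exact: mh.
have [N [mN' N0 sub]] := ae_reflect kc.
exists N; split => // x nx; apply: sub => /= kx; apply: nx => -[_].
by rewrite /= in_itv /= => x0; rewrite kx // oppr_ge0 ltW.
Qed.

Theorem theorem3p3 (R : realType) (d : measure_display) (Omega : measurableType d)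
  (P : probability Omega R) (X : R -> Omega -> R) (zeta : Omega -> \bar R) (q : R)
  (Phi : R -> R) (kappa : {measure set (measurableTypeR R) -> \bar R}) :
  subordinator P X ->
  killing_time P X zeta q ->
  (* Laplace-Bernstein exponent: E[exp(-s xi_l)] = exp(-l Phi(s)) *)
  (forall l s, 0 <= l -> 0 < s ->
     (\int[P]_w expeR (- (s%:E * killed X zeta l w)) = (expR (- (l * Phi s)))%:E)%E) ->
  (* Phi is not identically 0 *)
  (exists s, 0 < s /\ Phi s != 0) ->
  (* kappa is a measure on R_+ with Laplace transform Phi'/Phi *)
  kappa `]-oo, 0%R[%classic = 0%E ->
  (forall s, 0 < s ->
     (\int[kappa]_x (expR (- (s * x)))%:E)%E = (derive1 Phi s / Phi s)%:E) ->
  (mult_inf_div P (expfun (killed X zeta)) <->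
     (forall A : set (measurableTypeR R), measurable A -> A `<=` `[0%R, +oo[%classic -> (kappa A <= lebesgue_measure A)%E))
  /\
  (mult_inf_div P (expfun (killed X zeta)) ->
   forall k : R -> R, measurable_fun setT k ->
     (forall A : set (measurableTypeR R), measurable A -> A `<=` `[0%R, +oo[%classic ->
        kappa A = (\int[lebesgue_measure]_(x in A) (k x)%:E)%E) ->
     exists nu : {measure set (measurableTypeR R) -> \bar R},
       (forall A : set (measurableTypeR R), measurable A ->
          nu A = (\int[lebesgue_measure]_(x in A `&` `]-oo, 0%R[%classic)
                    (x^-1 * (1 - expR (- x))^-1 * (1 - k (- x)))%:E)%E) /\
       exists b s2 : R,
         levy_khintchine P (fun w => ln (fine (expfun (killed X zeta) w))) b s2 nu).
Proof.
move=> sX kX LX Phi_neq0 kappa0 kappaL.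
have Phi_gt0 := exponent_gt0 sX kX LX Phi_neq0.
have Phi_mono := le_exponent sX kX LX.
have dPhi := derivable_exponent sX kX LX.
set Y := expfun (killed X zeta).
have Phi_nat m : 0 < Phi m.+1%:R by apply: Phi_gt0.
have mY : measurable_fun setT Y := measurable_expfun sX kX.
have Yfin : P [set w | (0 < Y w < +oo)%E] = 1%E := expfun_gt0_fin sX kX LX Phi_nat.
have Y0 w : (0 <= Y w)%E by apply: integral_ge0 => t _; exact: expeR_ge0.
have YM := expfun_moment sX kX LX Phi_nat.
have M0 := exp_moment_gt0 Phi_gt0.
have C0 : 0 < (Phi 1)^-1 by rewrite invr_gt0 Phi_gt0.
have MC m := exp_moment_le m Phi_gt0 Phi_mono.
have kle (idY : mult_inf_div P Y) (A : set (measurableTypeR R)) : measurable A -> A `<=` `[0%R, +oo[%classic ->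
    (kappa A <= lebesgue_measure A)%E.
  by move=> mA _; exact: (kappa_le_lebesgue Phi_gt0 dPhi kappa0 kappaL mY Y0 YM idY mA).
split; [split => [|kappa_le]|move=> idY k mk kE].
- exact: kle.
- have kappa_fin : (\int[kappa]_x (expR (- (1 * x)))%:E < +oo)%E by rewrite kappaL ?ltry.
  have [k [mk kE]] := kappa_density_exists kappa0 kappa_fin kappa_le.
  apply: (mult_inf_div_of_roots mY Yfin Y0 YM M0 C0 MC) => n n2.
  have c01 : 0 <= (n%:R^-1 : R) <= 1.
    by rewrite invr_ge0 ler0n invf_le1 ?ler1n ?ltr0n ltnW // ltnW.
  have [d' [T [P' [Q [mQ Q0 QM _]]]]] := power_law Phi_gt0 dPhi kappa0 kappaL (measurable_clip mk)
    (@clip01 R k) (kappa_clip mk kE kappa_le) c01.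
  by exists d', T, P', Q.
have kc := clip_ae mk kE (kle idY).
have k01 := @clip01 R k.
have c01 : 0 <= (1 : R) <= 1 by rewrite ler01 lexx.
have [d' [T [P' [Q [mQ Q0 QM QC]]]]] := power_law Phi_gt0 dPhi kappa0 kappaL (measurable_clip mk)
  k01 (kappa_clip mk kE (kle idY)) c01.
have QM1 m : (\int[P']_w (Q w ^+ m)%:E = (exp_moment (fun m => Phi m%:R) m)%:E)%E.
  by rewrite QM mul1r lnK // posrE.
have law B := law_of_moments mY Y0 YM C0 MC mQ Q0 QM1 (B := B).
have mfY := measurable_fine_RV mY.
(* [Q] has the law of the functional, which is almost surely positive; this discharges the premise
   under which [ln Q] has the stated exponent. *)
have Qpos : {ae P', forall w, 0 < Q w}.
  exists (Q @^-1` [set 0]); split.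
  - by rewrite -[X in measurable X]setTI; exact: mQ.
  - by rewrite law //; exact: fine_pt0.
  - move=> w /= /negP; rewrite lt0r Q0 andbT => /negPn/eqP; exact.
have {}QC := QC Qpos.
have mf := measurable_levy_density (measurable_clip mk) 1.
have f0 x : 0 <= levy_density (clip k) 1 x by exact: levy_density_ge0.
exists (levy_measure mf f0); split; first by move=> A mA; exact: levy_measure_density.
apply: (levy_khintchine_density (beta := 1 * ln (exp_moment (fun m => Phi m%:R) 1))).
- exact: levy_density_neg.
- by move=> x x0; exact: levy_density_quad.
- move=> u; have [hc hs] := QC u.
  have mu_ln : measurable_fun setT (fun x : R => u * ln x) by apply: measurable_funM => //; exact: measurable_ln.
  rewrite /= -hc -hs; split; symmetry.
    apply: (same_law_Rintegral (g := fun x => cos (u * ln x)) mQ mfY law) => [|x]; last exact: norm_cos_le1.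
    by apply: (measurableT_comp _ mu_ln); exact: continuous_measurable_fun (@continuous_cos R).
  apply: (same_law_Rintegral (g := fun x => sin (u * ln x)) mQ mfY law) => [|x]; last exact: norm_sin_le1.
  by apply: (measurableT_comp _ mu_ln); exact: continuous_measurable_fun (@continuous_sin R).
- exact: measurableT_comp (@measurable_ln R) mfY.
Qed.
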